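(* Assume $b=0$ and that $\bar\pi(u):=\pi((u,\infty))$ satisfies $\bar\pi(u)\sim-\frac{1}{\Gamma(-\alpha)}u^{-1-\alpha}\ell(u)$ as $u\to\infty$, for some $0<\alpha<1$ and some $\ell$ slowly varying at $\infty$. Let $(Y_t,t\ge0)$ be a CBI$(\Psi,\Phi)$ process (under $\mathbb P_x$ for some $x\ge0$). (i) If Condition (S) holds, let $m(x):=\exp\big(\int_{1/x}^1\frac{\Phi(u)}{\Psi(u)}\mathrm{d}u\big)$ for $x>0$. Then $m(Y_t)/m(1/g(t))\to V$ in law as $t\to\infty$, where $V$ is uniformly distributed on $[0,1]$. (ii) If Condition (L) holds with constant $a>0$, then $g(t)Y_t\to V_L$ in law as $t\to\infty$, where $\mathbb E[e^{-\lambda V_L}]=(1+\lambda^\alpha)^{-a}$ for all $\lambda\ge0$. (iii) If Condition (F) holds with $\delta>0$, then $\varrho_tY_t\to V_F$ in law as $t\to\infty$, where $\mathbb E[e^{-\theta V_F}]=\exp(-\theta^{\delta\alpha})$ for all $\theta\ge0$, with $\varrho_t=\Phi^{-1}(1/t)=t^{-1/(\delta\alpha)}\bar\ell(t)$ (for large $t$) for some function $\bar\ell$ slowly varying at $\infty$. If Condition (F) holds with $\delta=0$, then $t\,\Phi(1/Y_t)\to\mathrm{e}_1$ in law as $t\to\infty$, where $\mathrm{e}_1$ is standard exponential.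
   Context: Let $\sigma\ge 0$, $b\in\mathbb R$, $\beta\ge 0$, and let $\pi,\nu$ be $\sigma$-finite measures on $(0,\infty)$ with $\int_0^\infty (z\wedge z^2)\pi(\mathrm{d}z)<\infty$ and $\int_0^\infty(1\wedge z)\nu(\mathrm{d}z)<\infty$. The branching mechanism is $\Psi(q)=bq+\frac12\sigma^2q^2+\int_0^\infty(e^{-qu}-1+qu)\pi(\mathrm{d}u)$ and the immigration mechanism is $\Phi(q)=\beta q+\int_0^\infty(1-e^{-qu})\nu(\mathrm{d}u)$, $q\ge 0$; it is assumed that $\Phi(q)>0$ for all $q>0$; $\Phi^{-1}$ is the inverse function of $\Phi$. For $\lambda\ge 0$, $t\mapsto v_t(\lambda)$ solves $\frac{\partial}{\partial t}v_t(\lambda)=-\Psi(v_t(\lambda))$, $v_0(\lambda)=\lambda$. A CBI$(\Psi,\Phi)$ process is a $[0,\infty)$-valued Markov process $(Y_t)$ with $\mathbb E_x[e^{-\lambda Y_t}]=\exp\big(-xv_t(\lambda)-\int_0^t\Phi(v_s(\lambda))\mathrm{d}s\big)$, where $\mathbb E_x$ refers to the process started at $x$. Fix $\lambda_0\in(0,\infty)$ and set $\varphi(\lambda)=\int_\lambda^{\lambda_0}\frac{\mathrm{d}u}{|\Psi(u)|}$ for $0<\lambda<\lambda_0$, a strictly decreasing bijection $(0,\lambda_0)\to(0,\infty)$; let $g$ be its inverse. Define $H(x)=\int_{g(x)}^{\lambda_0}\frac{\Phi(u)}{|\Psi(u)|}\mathrm{d}u$ for $x>0$, $H(0)=0$.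 Conditions: (S) $xH'(x)\to0$ and $H(x)\to\infty$ as $x\to\infty$; (L) $xH'(x)\to a$ for some constant $a>0$ as $x\to\infty$; (F) $xH'(x)\to\infty$ as $x\to\infty$ and $H'$ is regularly varying at $\infty$, i.e. $H'(x)=x^{-\delta}/L(x)$ with $L$ slowly varying at $\infty$ and $0\le\delta\le1$ (if $\delta=0$ then $L(x)\to\infty$, if $\delta=1$ then $L(x)\to0$). *)

(* Defs.v *)
From HB Require Import structures.
From mathcomp Require Import all_boot all_order all_algebra.
From mathcomp Require Import all_classical all_reals all_analysis.
Set Implicit Arguments. Unset Strict Implicit. Unset Printing Implicit Defensive.
Import Order.TTheory GRing.Theory Num.Theory.
Import numFieldNormedType.Exports.
Local Open Scope classical_set_scope.
Local Open Scope ring_scope.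

Section Defs.
Context {R : realType}.
Local Notation mu := (@lebesgue_measure R).

Definition integ (a b : R) (f : R -> R) : R :=
  fine (\int[mu]_(u in `[a, b]) (f u)%:E)%E.

Definition oint (a b : R) (f : R -> R) : R :=
  if a <= b then integ a b f else - integ b a f.

(* branching mechanism; pi is a measure on R carried by (0,oo) *)
Definition Psi (b sigma : R) (pi : {measure set R -> \bar R}) (q : R) : R :=
  b * q + sigma ^+ 2 * q ^+ 2 / 2
  + fine (\int[pi]_(u in [set u : R | (0 < u)%R]) ((expR (- (q * u)) - 1 + q * u)%R)%:E)%E.

(* immigration mechanism; nu is a measure on R carried by (0,oo) *)
Definition Phi (beta : R) (nu : {measure set R -> \bar R}) (q : R) : R :=
  beta * q + fine (\int[nu]_(u in [set u : R | (0 < u)%R]) ((1 - expR (- (q * u)))%R)%:E)%E.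

Definition solves_v (Psi : R -> R) (v : R -> R -> R) : Prop :=
  forall lam : R, 0 <= lam ->
    [/\ v 0 lam = lam,
        (forall t : R, 0 <= t -> 0 <= v t lam),
        (fun s => v s lam) s @[s --> 0^'+] --> lam &
        (forall t : R, 0 < t -> is_derive t (1 : R) (fun s => v s lam) (- Psi (v t lam)))].

Definition phi_fun (Psi : R -> R) (lam0 lam : R) : R :=
  integ lam lam0 (fun u => `|Psi u|^-1).

Definition is_g (Psi : R -> R) (lam0 : R) (g : R -> R) : Prop :=
  forall x : R, 0 < x -> 0 < g x < lam0 /\ phi_fun Psi lam0 (g x) = x.

Definition H_fun (Psi Phi : R -> R) (lam0 : R) (g : R -> R) (x : R) : R :=
  if x == 0 then 0 else integ (g x) lam0 (fun u => Phi u / `|Psi u|).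

Definition slowly_varying (l : R -> R) : Prop :=
  (\forall x \near +oo, 0 < l x) /\
  forall c : R, 0 < c -> (fun x => l (c * x) / l x) x @[x --> +oo] --> (1 : R).

Definition condS (H : R -> R) : Prop :=
  (fun x => x * derive1 H x) x @[x --> +oo] --> (0 : R) /\
  H x @[x --> +oo] --> +oo.

Definition condL (H : R -> R) (a : R) : Prop :=
  (fun x => x * derive1 H x) x @[x --> +oo] --> a.

Definition condF (H : R -> R) (delta : R) : Prop :=
  (fun x => x * derive1 H x) x @[x --> +oo] --> +oo /\
  0 <= delta <= 1 /\
  exists L : R -> R, slowly_varying L /\
    (forall x, 0 < x -> derive1 H x = x `^ (- delta) / L x) /\
    (delta = 0 -> L x @[x --> +oo] --> +oo) /\
    (delta = 1 -> L x @[x --> +oo] --> (0 : R)).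

(* GammaF function on (0,oo) and its continuation on (-1,0): GammaF(s) = GammaF(s+1)/s *)
Definition Gamma_pos (s : R) : R :=
  fine (\int[mu]_(x in [set x : R | (0 < x)%R]) ((x `^ (s - 1) * expR (- x))%R)%:E)%E.
Definition GammaF (s : R) : R :=
  if 0 < s then Gamma_pos s else Gamma_pos (s + 1) / s.

Definition cvg_law {d} {T : measurableType d} (P : probability T R)
  (Z : R -> T -> R) (m : probability R R) : Prop :=
  forall f : R -> R, continuous f -> (exists M : R, forall y, `|f y| <= M) ->
    (\int[P]_w (f (Z t w))%:E)%E @[t --> +oo] --> (\int[m]_y (f y)%:E)%E.

(* m(x) = exp(int_{1/x}^1 Phi/Psi) for x>0 (continuously extended by 0 at x<=0) *)
Definition m_fun (Psi Phi : R -> R) (x : R) : R :=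
  if 0 < x then expR (oint x^-1 1 (fun u => Phi u / Psi u)) else 0.

End Defs.

(* Main.v *)
(** Write [phi] for the clock [phi_fun] and [h = Phi \o g = H']. Along the flow,
    [v_t(lam) = g (t + phi lam)] and the immigration integral is
    [H (t + phi lam) - H (phi lam)]. The tail of [pi] makes [Psi] regularly
    varying of index [1 + alpha] at [0] (compare the level sets of the integrand
    against the tail; the Gaussian part and the small jumps are [O(q^2)], which is
    [o(Psi q)]), so that [phi (th * g s) ~ th^(-alpha) s] as [s -> oo]. All the limits
    then come from increments of [H], applied at [lam = th * g (tau t)] for a
    suitable [tau t -> oo].

    - (L): [tau t = t]; the increment tends to [a ln (1 + th^alpha)].
    - (F): [t h (tau t) = u]; the increment tends to [u th^(delta alpha)].
    - (S): [tau t <= t] and [H (tau t) = H t + ln u]; the increment tends to [- ln u].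

    In (S), and in (F) with [delta = 0], the limit does not depend on [th]: letting
    [th -> 0] and [th -> oo] shows that [P (g (tau t) Y_t <= 1)] converges, to [u] and
    [exp (- u)] respectively, which is the limiting distribution function once the
    event is rewritten through the monotone functions [m] and [Phi].

    The continuity theorem for Laplace transforms is obtained by squeezing the
    indicator of a half-line between polynomials in [exp (- y)]. *)

Require Import Defs.
From HB Require Import structures.
From mathcomp Require Import all_boot all_order all_algebra.
From mathcomp Require Import all_classical all_reals all_analysis.
From mathcomp Require Import measurable_realfun ring lra.
Import Order.TTheory GRing.Theory Num.Theory.
Import numFieldNormedType.Exports.
Local Open Scope classical_set_scope.
Local Open Scope ring_scope.
Set Implicit Arguments. Unset Strict Implicit. Unset Printing Implicit Defensive.

(** In (F), regular variation of [h] is a limit at one fixed factor at a time, whereas the points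
    that occur, [phi (th * g (tau t))], are only equivalent to a multiple of [tau t]. Monotonicity
    supplies the uniformity: [g] decreases and [Phi] is nondecreasing, so [h] is nonincreasing and
    its values at nearby exact multiples trap the one wanted.

    The choice of [tau] decides which time scale dominates. In (F), [t] is negligible against
    [tau t], and the increment of [H] is [t] times a nearly constant [h]. In (S), [tau t <= t], and
    [H] is so slow that multiplying time by a bounded factor changes it by [o(1)]. (L) is the
    balanced case, where [H] behaves like [a] times a logarithm.

    When the Laplace limit is the same [p] for every [th > 0], the scaled variable has no proper
    limit law: mass [p] collapses to [0] and the rest escapes to infinity. This is why [tau] carries
    a parameter [u]: each [u] yields one value of the limiting distribution function, and varying
    [u] recovers all of it. *)

Lemma bernoulli_ge (R : realType) (x : R) n : 0 <= x -> 1 + n%:R * x <= (1 + x) ^+ n.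
Proof.
move=> x0; elim: n => [|n IH]; first by rewrite mul0r addr0 expr0.
rewrite exprS; apply: (le_trans (y := (1 + x) * (1 + n%:R * x))).
  have : 0 <= n%:R * x * x by rewrite !mulr_ge0.
  rewrite -natr1; nra.
by apply: ler_wpM2l IH; rewrite addr_ge0.
Qed.

Lemma bernoulli_onem (R : realType) (x : R) n :
  0 <= x <= 1 -> 1 - n%:R * x <= (1 - x) ^+ n.
Proof.
move=> /andP[x0 x1]; elim: n => [|n IH]; first by rewrite mul0r subr0 expr0.
rewrite exprS; apply: (le_trans (y := (1 - x) * (1 - n%:R * x))).
  have : 0 <= n%:R * x * x by rewrite !mulr_ge0.
  rewrite -natr1; nra.
by apply: ler_wpM2l IH; rewrite subr_ge0.
Qed.

(** With [s = expR (- y)], such a polynomial approximates the indicator of a half-line in [y], and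
    its integral involves Laplace transforms at integers only. The witness [1 - (1 - s^n)^N] is the
    one of the elementary proof of the Stone-Weierstrass theorem. *)
Lemma poly_step (R : realType) (a b e : R) : 0 <= a -> a < b -> b <= 1 -> 0 < e ->
  exists p : {poly R}, forall s, 0 <= s <= 1 ->
   [/\ 0 <= p.[s], p.[s] <= 1, s <= a -> p.[s] <= e & b <= s -> 1 - e <= p.[s] ].
Proof.
move=> a0 ab b1 e0; pose c := (a + b) / 2.
have c0 : 0 < c by rewrite /c; lra.
have ac : a < c by rewrite /c; lra.
have cb : c < b by rewrite /c; lra.
(* With [c] between [a] and [b], all three bases are below [1]. [(a / c)^n] and [a^n] bound [N s^n]
   for [s <= a], the second one paying for the rounding of [N]; [(c / b)^n] bounds the defect for
   [s >= b]. *)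
have [n [h1 h2 h3]] : exists n, [/\ (a / c) ^+ n < e / 2, a ^+ n < e / 2 & (c / b) ^+ n < e].
  have lim (z f : R) : 0 <= z -> z < 1 -> 0 < f -> \forall n \near \oo, z ^+ n < f.
    move=> z0 z1 f0; have : z ^+ n @[n --> \oo] --> (0:R).
      by apply: cvg_expr; rewrite ger0_norm.
    by move/cvgr_lt; apply.
  have e2 : 0 < e / 2 by lra.
  near \oo => n; exists n; split; near: n; apply: lim => //.
  - by rewrite divr_ge0// ltW.
  - by rewrite ltr_pdivrMr// mul1r.
  - by lra.
  - by rewrite divr_ge0//; lra.
  - by rewrite ltr_pdivrMr ?mul1r//; lra.
pose N := (Num.truncn (c ^- n)).+1.
have cn0 : 0 < c ^- n by rewrite invr_gt0 exprn_gt0.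
have N1 : c ^- n < N%:R by apply: truncnS_gt.
have N2 : N%:R <= c ^- n + 1 by rewrite /N -natr1 lerD2r truncn_le// ltW.
(* [N s^n] is small for [s <= a] and large for [s >= b], since [N ~ c^-n] with [a < c < b]. *)
exists (1 - (1 - 'X ^+ n) ^+ N) => s /andP[s0 s1].
have -> : (1 - (1 - 'X ^+ n) ^+ N).[s] = 1 - (1 - s ^+ n) ^+ N.
  by rewrite !(hornerE, horner_exp).
have x0 : 0 <= s ^+ n by apply: exprn_ge0.
have x1 : s ^+ n <= 1 by apply: exprn_ile1.
have y0 : 0 <= (1 - s ^+ n) ^+ N by apply: exprn_ge0; lra.
have y1 : (1 - s ^+ n) ^+ N <= 1 by apply: exprn_ile1; lra.
split; [lra|lra| |].
  move=> sa; have : 1 - N%:R * s ^+ n <= (1 - s ^+ n) ^+ N by apply: bernoulli_onem; rewrite x0.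
  suff : N%:R * s ^+ n <= e by lra.
  have sn : s ^+ n <= a ^+ n by apply: lerXn2r => //; rewrite nnegrE.
  apply: (le_trans (y := (c ^- n + 1) * a ^+ n)).
    by apply: ler_pM.
  rewrite mulrDl mul1r mulrC.
  by move: h1; rewrite expr_div_n; lra.
move=> bs; rewrite lerD2l lerN2.
have sn : b ^+ n <= s ^+ n by apply: lerXn2r => //; rewrite ?nnegrE//; lra.
have bn : 0 < b ^+ n by apply: exprn_gt0; lra.
(* Bernoulli gives [N s^n <= (1 + s^n)^N], and [(1 - s^n)(1 + s^n) <= 1]; hence [(1 - s^n)^N] is at
   most the inverse of [N s^n]. *)
have k : (1 - s ^+ n) ^+ N * (N%:R * s ^+ n) <= 1.
  apply: (le_trans (y := (1 - s ^+ n) ^+ N * (1 + s ^+ n) ^+ N)).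
    by apply: ler_wpM2l => //; have := @bernoulli_ge R (s ^+ n) N x0; lra.
  rewrite -exprMn; apply: exprn_ile1; first by apply: mulr_ge0; lra.
  have : 0 <= s ^+ n * s ^+ n by apply: mulr_ge0.
  lra.
have k2 : (b / c) ^+ n <= N%:R * s ^+ n.
  by rewrite expr_div_n mulrC; apply: ler_pM => //; apply: ltW.
have bc0 : 0 < (b / c) ^+ n by apply: exprn_gt0; rewrite divr_gt0//; lra.
have : (1 - s ^+ n) ^+ N <= ((b / c) ^+ n)^-1.
  rewrite -[leRHS]mul1r ler_pdivlMr//; apply: le_trans k.
  exact: ler_wpM2l.
move: h3; rewrite -exprVn invf_div; lra.
Unshelve. all: by end_near.
Qed.

(** Heine's theorem with only [x] confined to the segment; the covering form of compactness provides
    one radius for all [x]. *)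
Lemma segment_unif_continuous (R : realType) (f : R -> R) (a b e : R) :
  continuous f -> 0 < e ->
  exists2 d, 0 < d & forall x y, a <= x <= b -> `|x - y| < d -> `|f x - f y| < e.
Proof.
move=> cf e0.
have /compact_near_coveringP ncov := @segment_compact R a b.
have [|d /=] := @filter_ex _ (0^'+ : set_system R) _ _
  (filterI (ncov _ (0^'+ : set_system R)
    (fun d x => forall y, `|x - y| < d -> `|f x - f y| < e) _ _) (nbhs_right_gt 0)).
  move=> x _; have /cvgrPdist_lt/(_ (e / 2)) := cf x.
  move=> /(_ _)/nbhs_ballP[|r /= r0 fr]; first lra.
  near=> x' d => y /= x'y.
  have x'x : ball x (r / 2) x' by near: x'; apply: nbhsx_ballx; lra.
  have dr : d < r / 2 by near: d; apply: nbhs_right_lt; lra.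
  have h1 : `|f x - f x'| < e / 2.
    by apply: fr; apply: le_ball x'x; lra.
  have h2 : `|f x - f y| < e / 2.
    have {}x'x : `|x - x'| < r / 2 := x'x.
    apply: fr; rewrite /ball /=.
    by have := ler_distD x' x y; lra.
  have := ler_distD (f x) (f x') (f y); rewrite (distrC (f x') (f x)); lra.
move=> [h d0]; exists d => // x y xab; apply: h => //=.
Unshelve. all: by end_near.
Qed.

(** Abel summation moves the increments from [D], a difference of distribution functions, to [f],
    whose oscillation on a fine grid is small. *)
Lemma sum_increments_abel (R : comRingType) (f D : nat -> R) (n : nat) :
  \sum_(i < n) f i * (D i.+1 - D i) =
  f n * D n - f 0%N * D 0%N - \sum_(i < n) (f i.+1 - f i) * D i.+1.
Proof.
elim: n => [|n IH]; first by rewrite !big_ord0; ring.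
by rewrite !big_ord_recr/= IH; ring.
Qed.

(** * Convergence in law from distribution functions *)

Definition law_cdf {d} {T : measurableType d} {R : realType} (P : probability T R)
  (X : T -> R) (x : R) : R := fine (P [set w | X w <= x]).

Section Cdf.
Context d (T : measurableType d) (R : realType) (P : probability T R) (X : T -> R).
Hypothesis mX : measurable_fun setT X.

Lemma measurable_le_cst x : measurable [set w | X w <= x].
Proof.
have -> : [set w | X w <= x] = X @^-1` `]-oo, x].
  by apply/seteqP; split => w /=; rewrite in_itv/=.
by rewrite -[X in measurable X]setTI; exact: mX.
Qed.

Lemma law_cdfE x : P [set w | X w <= x] = (law_cdf P X x)%:E.
Proof. by rewrite fineK// fin_num_measure//; exact: measurable_le_cst. Qed.

Lemma law_cdf_ge0 x : 0 <= law_cdf P X x.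
Proof. exact: fine_ge0. Qed.

Lemma law_cdf_le1 x : law_cdf P X x <= 1.
Proof.
by rewrite -lee_fin -law_cdfE probability_le1//; exact: measurable_le_cst.
Qed.

Lemma law_cdf_homo x y : x <= y -> law_cdf P X x <= law_cdf P X y.
Proof.
move=> xy; rewrite -lee_fin -!law_cdfE.
apply: le_measure; rewrite ?inE; [exact: measurable_le_cst..|].
by move=> w /= /le_trans; apply.
Qed.

Lemma law_cdf_itv x y : x <= y ->
  fine (P (X @^-1` `]x, y])) = law_cdf P X y - law_cdf P X x.
Proof.
move=> xy; rewrite -[RHS]/(fine (law_cdf P X y - law_cdf P X x)%:E) EFinB -!law_cdfE.
have -> : X @^-1` `]x, y] = [set w | X w <= y] `\` [set w | X w <= x].
  apply/seteqP; split => w /=; rewrite in_itv/=.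
    by move=> /andP[xX ->]; split => //; apply/negP; rewrite -ltNge.
  by move=> [-> /negP]; rewrite -ltNge => ->.
rewrite measureD; [|exact: measurable_le_cst..|].
  congr (fine (_ - P _)%E); apply/seteqP; split => w /=; first by case.
  by move=> h; split=> //; apply: le_trans h xy.
by rewrite ltey_eq fin_num_measure//; exact: measurable_le_cst.
Qed.

End Cdf.

(** * Step functions on a grid *)

Section StepApprox.
Context d (T : measurableType d) (R : realType) (P : probability T R) (X : T -> R).
Hypothesis mX : measurable_fun setT X.
Variables (f : R -> R) (M a del eta : R).
Hypothesis mf : measurable_fun setT f.
Hypothesis fM : forall y, `|f y| <= M.
Hypothesis del0 : 0 < del.

Let u (i : nat) : R := a + i%:R * del.
Let sn n (y : R) : R := \sum_(i < n) f (u i) * \1_`]u i, u i.+1] y.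

Let uS i : u i < u i.+1. Proof. by rewrite /u -natr1 mulrDl mul1r addrA ltrDl. Qed.
Let u0 : u 0%N = a. Proof. by rewrite /u mul0r addr0. Qed.
Let u_ge n : a <= u n.
Proof. by elim: n => [|n]; [rewrite u0|have := uS n; lra]. Qed.

Let mul_indic_itv (c x y z : R) :
  c * \1_`]x, y] z = if (x < z) && (z <= y) then c else 0.
Proof.
rewrite indicE mem_setE /= in_itv/=.
by case: (_ && _); rewrite (mulr1, mulr0).
Qed.

Let sn_out n y : (y <= a \/ u n < y) -> sn n y = 0.
Proof.
elim: n => [|n IH] h; first by rewrite /sn big_ord0.
rewrite /sn big_ord_recr/= -/(sn n y) IH; last by case: h => h; [left|right; exact: lt_trans (uS n) h].
rewrite add0r mul_indic_itv; case: h => h.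
  by rewrite ltNge (le_trans h (u_ge n)).
by rewrite andbC leNgt h.
Qed.

Let sn_in n y : (forall i y, (i < n)%N -> u i < y <= u i.+1 -> `|f y - f (u i)| <= eta) ->
  a < y <= u n -> `|f y - sn n y| <= eta.
Proof.
elim: n => [|n IH] h /andP[ay yu].
  by move: ay; rewrite -u0; lra.
rewrite /sn big_ord_recr/= -/(sn n y) mul_indic_itv yu andbT.
have [uy|yun] := ltP (u n) y.
  by rewrite sn_out ?add0r; [apply: h => //; rewrite uy|right].
rewrite addr0; apply: IH => [i z ilt|]; last by rewrite ay.
by apply: h; rewrite ltnW.
Qed.

Let mB x y : measurable (X @^-1` `]x, y]).
Proof. by rewrite -[X in measurable X]setTI; exact: mX. Qed.

Let bnd_integrable (g : T -> R) (C : R) : measurable_fun setT g -> (forall w, `|g w| <= C) ->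
  P.-integrable setT (EFin \o g).
Proof.
move=> mg gC; apply: measurable_bounded_integrable => //.
  by rewrite ltey_eq fin_num_measure.
exists C; split; first by rewrite num_real.
by move=> x Cx w _; apply: (le_trans (gC w)); exact: ltW.
Qed.

Let eqi (g h : T -> \bar R) : P.-integrable setT g -> g =1 h -> P.-integrable setT h.
Proof. by move=> ig gh; apply: eq_integrable ig => // w _; rewrite gh. Qed.

Let int_indic x y : P.-integrable setT (EFin \o (fun w => \1_`]x, y] (X w))).
Proof.
apply: (@bnd_integrable _ 1).
  have : measurable_fun setT (\1_(X @^-1` `]x, y]) : T -> R).
    by apply: measurable_indic; exact: mB.
  by [].
by move=> w; rewrite indicE; case: (_ \in _); rewrite ?normr1 ?normr0.
Qed.

Let snX_int n : P.-integrable setT (EFin \o (fun w => sn n (X w))) /\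
  (\int[P]_w sn n (X w) =
   \sum_(i < n) f (u i) * (law_cdf P X (u i.+1) - law_cdf P X (u i)))%R.
Proof.
elim: n => [|n [IH1 IH2]].
  rewrite big_ord0 /sn; split.
    by apply: eqi (@integrable0 _ _ _ P setT) _ => w /=; rewrite big_ord0.
  rewrite (@eq_Rintegral _ _ _ P setT (fun=> 0)) ?Rintegral_cst ?mul0r//.
  by move=> w _; rewrite big_ord0.
have h : P.-integrable setT (EFin \o (fun w => f (u n) * \1_`]u n, u n.+1] (X w))).
  by apply: eqi (integrableZl _ (f (u n)) (int_indic (u n) (u n.+1))) _.
split.
  apply: eqi (integrableD _ IH1 h) _ => // w /=.
  by rewrite /sn big_ord_recr.
rewrite (@eq_Rintegral _ _ _ P setT (fun w => sn n (X w) + f (u n) * \1_`]u n, u n.+1] (X w))); last first.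
  by move=> w _; rewrite /sn big_ord_recr.
rewrite RintegralD// big_ord_recr/= IH2; congr (_ + _).
rewrite RintegralZl//; congr (_ * _).
rewrite -law_cdf_itv//; last exact: ltW.
congr fine; have := @integral_indic _ _ _ P setT measurableT (X @^-1` `]u n, u n.+1]) (@mB _ _).
by rewrite setIT => <-.
Qed.

(** On []a, u n]] the step function [sn] is within [eta] of [f]; outside it vanishes, and there the
    error is at most [M] times the mass outside. *)
Lemma step_approx_integral n :
  (forall i y, (i < n)%N -> u i < y <= u i.+1 -> `|f y - f (u i)| <= eta) ->
  0 <= eta ->
  `|(\int[P]_w f (X w))%R -
    \sum_(i < n) f (u i) * (law_cdf P X (u i.+1) - law_cdf P X (u i))|
  <= eta + M * (1 - (law_cdf P X (u n) - law_cdf P X a)).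
Proof.
move=> h eta0; have [i1 <-] := snX_int n.
have M0 : 0 <= M by apply: le_trans (fM 0).
have i2 : P.-integrable setT (EFin \o (fun w => f (X w))).
  by apply: (@bnd_integrable _ M) => //; exact: measurableT_comp.
rewrite -RintegralB//.
have i3 : P.-integrable setT (EFin \o (fun w => f (X w) - sn n (X w))).
  by apply: eqi (integrableB _ i2 i1) _.
apply: (le_trans (le_normr_Rintegral measurableT i3)).
have ci (c : R) : P.-integrable setT (EFin \o (fun _ => c)).
  by apply: (@bnd_integrable _ `|c|).
have h4 : P.-integrable setT (EFin \o (fun w => M * \1_`]a, u n] (X w))).
  by apply: eqi (integrableZl _ M (int_indic a (u n))) _.
apply: (@le_trans _ _ (\int[P]_w (eta + M - M * \1_`]a, u n] (X w)))%R).
  apply: le_Rintegral => //.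
  - exact: integrable_norm.
  - by apply: eqi (integrableB _ (ci (eta + M)) h4) _.
  move=> w _; rewrite mul_indic_itv; case: ifPn => [aX|].
    by rewrite addrK; exact: sn_in.
  rewrite negb_and -leNgt -ltNge => /orP aX; rewrite sn_out// subr0.
  by rewrite subr0 (le_trans (fM _))// lerDr.
rewrite RintegralB// RintegralZl// Rintegral_cst// -law_cdf_itv//.
have PT : fine (P setT) = 1 by rewrite probability_setT.
have := @integral_indic _ _ _ P setT measurableT (X @^-1` `]a, u n]) (@mB _ _).
rewrite setIT => h5.
have -> : (\int[P]_w (\1_`]a, u n] (X w) : R))%R = fine (P (X @^-1` `]a, u n])) by rewrite -h5.
rewrite [X in _ * X - _]PT; lra.
Qed.

End StepApprox.

Lemma cvg_EFin_fin (R : realType) (f : R -> R) (l : R) (F : set_system R) :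
  Filter F -> f x @[x --> F] --> l -> (f x)%:E @[x --> F] --> l%:E.
Proof.
move=> FF fl; apply: (cvg_comp f EFin fl).
exact: cvg_id.
Qed.

Section Window.
Context d (T : measurableType d) (R : realType) (P : probability T R) (X : T -> R).
Hypothesis mX : measurable_fun setT X.

(** Tightness of a single law: the events []-n, n]] increase to the whole space. *)
Lemma law_cdf_window e : 0 < e ->
  exists2 K, 0 < K & 1 - e <= law_cdf P X K - law_cdf P X (- K).
Proof.
move=> e0; pose F n := X @^-1` `]- (n%:R : R), n%:R].
have mF n : measurable (F n) by rewrite -[X in measurable X]setTI; exact: mX.
have FT : \bigcup_n F n = setT.
  apply/seteqP; split => // w _; exists (Num.truncn `|X w|).+1 => //=.
  have h := truncnS_gt `|X w|; rewrite /F/= in_itv/=; move: h; rewrite ltr_norml => /andP[-> h].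
  exact: ltW.
have : P (F n) @[n --> \oo] --> P (\bigcup_n F n).
  apply: nondecreasing_cvg_mu => //; first exact: bigcup_measurable.
  move=> n k nk; apply/subsetPset => w /=; rewrite /F/= !in_itv/= => /andP[h1 h2].
  have nk' : (n%:R : R) <= k%:R by rewrite ler_nat.
  by apply/andP; split; [apply: le_lt_trans h1; rewrite lerN2|apply: le_trans nk'].
rewrite FT probability_setT => /fine_cvg/= /cvgrPdist_le/(_ _ e0) [N _ hN].
exists N.+1%:R; first by rewrite ltr0n.
have := hN N.+1 (leqnSn N); rewrite /= law_cdf_itv//; last by rewrite ge0_cp.
by rewrite ler_norml => /andP[_]; lra.
Qed.

End Window.

(** [F] and [G] are compared only up to a shift by one grid step, so they may differ much near a
    jump of [G]. Their distance at [u i.+1] is still at most [G (u i.+2) - G (u i) + e2], which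
    telescopes; after Abel summation only this sum and the oscillation of [f] matter. *)
Lemma cdf_grid_estimate (R : realFieldType) (F G f : R -> R) (u : nat -> R)
    (M K del e e1 e2 IP Im : R) (n : nat) :
  (forall y, `|f y| <= M) -> 0 < e -> 20 * M * e1 <= e ->
  0 < e1 -> 0 < e2 -> n%:R * e2 <= 1 -> 0 < del -> del < 1 ->
  (forall y, 0 <= F y <= 1) -> (forall y, 0 <= G y <= 1) ->
  (forall y z, y <= z -> G y <= G z) -> G (- K) <= e1 /\ 1 - e1 <= G K ->
  u 0%N = - (K + 1) -> (forall i, u i.+1 = u i + del) -> u n = K + 1 ->
  (forall i y, (i < n)%N -> u i < y <= u i.+1 -> `|f y - f (u i)| <= e / 10) ->
  (forall i : 'I_n, F (u i.+1) <= G (u i.+2) + e2 /\ G (u i) <= F (u i.+1) + e2) ->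
  F (- (K + 1)) <= G (- K) + e1 -> G K <= F (K + 1) + e1 ->
  `|Im - \sum_(i < n) f (u i) * (G (u i.+1) - G (u i))|
    <= e / 10 + M * (1 - (G (K + 1) - G (- (K + 1)))) ->
  `|IP - \sum_(i < n) f (u i) * (F (u i.+1) - F (u i))|
    <= e / 10 + M * (1 - (F (K + 1) - F (- (K + 1)))) ->
  `|Im - IP| <= e.
Proof.
move=> fM e0 Me1 e10 e20 e2n delp d1 F01 G01 Gmono [GK1 GK2] u0 uS un fu hg h1 h2.
have M0 : 0 <= M by apply: le_trans (fM 0).
set SG := \sum_(i < n) _; set SF := \sum_(i < n) _ => hG hF.
have SD : SF - SG = f (u n) * (F (u n) - G (u n)) - f (u 0%N) * (F (u 0%N) - G (u 0%N))
    - \sum_(i < n) (f (u i.+1) - f (u i)) * (F (u i.+1) - G (u i.+1)).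
  rewrite -(sum_increments_abel (f \o u) (fun i => F (u i) - G (u i))) /SF /SG -sumrB.
  by apply: eq_bigr => i _ /=; ring.
(* The bound [3] is two telescoping sums of increments of [G], each at most [1], plus
   [n * e2 <= 1]. *)
have Dsum : \sum_(i < n) `|F (u i.+1) - G (u i.+1)| <= 3.
  apply: (@le_trans _ _ (\sum_(i < n) ((G (u i.+2) - G (u i.+1)) + (G (u i.+1) - G (u i)) + e2))).
    apply: ler_sum => i _; have [k1 k2] := hg i.
    have := Gmono (u i.+1) (u i.+2); have := Gmono (u i) (u i.+1).
    rewrite !uS => /(_ _)k3 /(_ _)k4.
    have {}k3 := k3 ltac:(lra); have {}k4 := k4 ltac:(lra).
    rewrite !uS in k1 k2 *.
    by rewrite ler_norml; lra.
  rewrite 2!big_split/= sumr_const card_ord -[e2 *+ n]mulr_natl.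
  have tel (g : nat -> R) k : \sum_(i < k) (g i.+1 - g i) = g k - g 0%N.
    by rewrite -(big_mkord xpredT (fun i => g i.+1 - g i)) telescope_sumr.
  have := tel (fun i => G (u i.+1)) n; have := tel (fun i => G (u i)) n => /= -> ->.
  by have := G01 (u n.+1); have := G01 (u n); have := G01 (u 1%N); have := G01 (u 0%N); lra.
have Sbnd : `|\sum_(i < n) (f (u i.+1) - f (u i)) * (F (u i.+1) - G (u i.+1))| <= e / 10 * 3.
  apply: le_trans (ler_norm_sum _ _ _) _.
  apply: (@le_trans _ _ (e / 10 * \sum_(i < n) `|F (u i.+1) - G (u i.+1)|)); last first.
    by rewrite ler_pM2l ?divr_gt0.
  rewrite mulr_sumr; apply: ler_sum => i _; rewrite normrM ler_wpM2r//.
  by apply: fu => //; rewrite uS; lra.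
have Dn : `|f (u n) * (F (u n) - G (u n))| <= M * (2 * e1).
  rewrite normrM ler_pM// un ler_norml.
  have := Gmono K (K + 1); rewrite lerDl => /(_ ler01).
  by have := F01 (K + 1); have := G01 (K + 1); lra.
have D0 : `|f (u 0%N) * (F (u 0%N) - G (u 0%N))| <= M * (2 * e1).
  rewrite normrM ler_pM// u0 ler_norml.
  have := Gmono (- (K + 1)) (- K) ltac:(lra).
  by have := F01 (- (K + 1)); have := G01 (- (K + 1)); lra.
have b1 : M * (1 - (F (K + 1) - F (- (K + 1)))) <= M * (4 * e1).
  by apply: ler_wpM2l => //; lra.
have b2 : M * (1 - (G (K + 1) - G (- (K + 1)))) <= M * (2 * e1).
  apply: ler_wpM2l => //.
  have := Gmono (- (K + 1)) (- K) ltac:(lra).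
  have := Gmono K (K + 1); rewrite lerDl => /(_ ler01).
  lra.
move: hG hF Sbnd Dn D0; rewrite !ler_norml; lra.
Qed.

Section Portmanteau.
Context d (T : measurableType d) (R : realType) (P : probability T R).
Variables (Z : R -> T -> R) (m : probability R R).
Hypothesis mZ : forall t, measurable_fun setT (Z t).
Let F t := law_cdf P (Z t).
Let G := law_cdf m (fun y : R => y).
Hypothesis FG : forall x y e, x < y -> 0 < e -> \forall t \near +oo, F t x <= G y + e.
Hypothesis GF : forall x y e, x < y -> 0 < e -> \forall t \near +oo, G x <= F t y + e.

Let mid : measurable_fun setT (fun y : R => y). Proof. exact: measurable_id. Qed.

(** The hypotheses compare distribution functions across a gap [x < y], which spares the choice of
    continuity points of [G]. The grid is finite, so for large [t] the comparison holds at all its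
    points at once. *)
Lemma cvg_law_of_cdf : cvg_law P Z m.
Proof.
move=> f cf [M fM].
have mf : measurable_fun setT f by exact: continuous_measurable_fun.
have M0 : 0 <= M by apply: le_trans (fM 0).
have bi d' (T' : measurableType d') (Q : probability T' R) (X : T' -> R) :
    measurable_fun setT X -> Q.-integrable setT (EFin \o (fun w => f (X w))).
  move=> mX; apply: measurable_bounded_integrable => //.
  - by rewrite ltey_eq fin_num_measure.
  - exact: measurableT_comp.
  by exists M; split; [exact: num_real | move=> x Mx w _; exact: le_trans (fM _) (ltW Mx)].
have -> : (fun t => \int[P]_w (f (Z t w))%:E)%E =
          (fun t => (\int[P]_w f (Z t w))%R%:E).
  by apply/funext => t; rewrite fineK//; apply: integrable_fin_num => //; exact: bi.
have -> : (\int[m]_y (f y)%:E)%E = (\int[m]_y f y)%R%:E.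
  by rewrite fineK//; apply: integrable_fin_num => //; exact: bi.
apply: cvg_EFin_fin; apply/cvgrPdist_le => e e0.
(* Two step approximations and the Abel sum cost [5 * e / 10]; boundary terms and tail masses cost
   [10 * M * e1], whence the factor [20]. The [+ 1] keeps the divisor positive. *)
pose e1 := e / (20 * (M + 1)).
have e10 : 0 < e1 by rewrite divr_gt0// mulr_gt0//; lra.
have Me1 : 20 * M * e1 <= e.
  rewrite /e1 mulrA ler_pdivrMr; last by rewrite mulr_gt0//; lra.
  by rewrite -mulrA [leRHS]mulrC mulrA; nra.
have [K K0 hK] := law_cdf_window m mid e10.
have G01 y : 0 <= G y <= 1 by rewrite law_cdf_ge0 law_cdf_le1.
have GK : G (- K) <= e1 /\ 1 - e1 <= G K.
  by have := G01 K; have := G01 (- K); rewrite /G; lra.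
have eta0 : 0 < e / 10 by lra.
(* The grid reaches one unit beyond [K] on both sides, which leaves the gap that [FG] and [GF]
   require at its ends. *)
pose a := - (K + 1).
have [del0 del00 hdel] := @segment_unif_continuous R f a (K + 1 + 1) (e / 10) cf eta0.
have dm0 : 0 < Num.min del0 1 by rewrite lt_min del00/=.
have [n [n0 ndel]] : exists n : nat, 0 < n%:R :> R /\ 2 * (K + 1) / n%:R < Num.min del0 1.
  exists (Num.truncn (2 * (K + 1) / Num.min del0 1)).+1; split; first by rewrite ltr0n.
  by rewrite ltr_pdivrMr ?ltr0n// [ltRHS]mulrC -ltr_pdivrMr//; exact: truncnS_gt.
pose del := 2 * (K + 1) / n%:R.
have delp : 0 < del by rewrite divr_gt0//; lra.
move: (ndel); rewrite -/del lt_min => /andP[dd d1].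
pose u (i : nat) := a + i%:R * del.
have uS i : u i.+1 = u i + del by rewrite /u -natr1; ring.
have un : u n = K + 1 by rewrite /u /del /a mulrCA divff ?gt_eqF//; ring.
have u0 : u 0%N = a by rewrite /u mul0r addr0.
have u_le i : (i <= n)%N -> a <= u i <= K + 1.
  move=> ilen; have i0 : 0 <= i%:R * del by rewrite mulr_ge0// ltW.
  have : i%:R * del <= n%:R * del by rewrite ler_pM2r// ler_nat.
  by have := un; rewrite /u; lra.
have fu i y : (i < n)%N -> u i < y <= u i.+1 -> `|f y - f (u i)| <= e / 10.
  move=> iltn /andP[y1 y2]; rewrite distrC ltW//; apply: hdel.
    by have := u_le _ (ltnW iltn); lra.
  by rewrite distrC gtr0_norm; move: y2; rewrite uS; lra.
pose e2 := Num.min e1 (n%:R^-1).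
have e20 : 0 < e2 by rewrite lt_min e10 invr_gt0.
have e21 : e2 <= e1 by rewrite ge_min lexx.
have e2n : n%:R * e2 <= 1.
  by rewrite mulrC -ler_pdivlMr// mul1r ge_min lexx orbT.
have near_grid : \forall t \near +oo, forall i : 'I_n,
    F t (u i.+1) <= G (u i.+2) + e2 /\ G (u i) <= F t (u i.+1) + e2.
  apply: filter_forall => i; apply: filterI; [apply: FG|apply: GF] => //; rewrite !uS; lra.
near=> t.
have hg : forall i : 'I_n, F t (u i.+1) <= G (u i.+2) + e2 /\ G (u i) <= F t (u i.+1) + e2.
  by near: t.
have h1 : F t a <= G (- K) + e1 by near: t; apply: FG => //; rewrite /a; lra.
have h2 : G K <= F t (K + 1) + e1 by near: t; apply: GF => //; lra.
have F01 y : 0 <= F t y <= 1 by rewrite law_cdf_ge0 ?law_cdf_le1//.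
have := @step_approx_integral _ _ _ P (Z t) (mZ t) f M a del (e / 10) mf fM delp n fu (ltW eta0).
have := @step_approx_integral _ _ _ m _ mid f M a del (e / 10) mf fM delp n fu (ltW eta0).
rewrite -/(F t) -/G -![a + _ * del]/(u _) un => hG hF.
exact: (cdf_grid_estimate fM e0 Me1 e10 e20 e2n delp d1 F01 G01 (law_cdf_homo m mid) GK u0 uS un fu hg h1 h2 hG hF).
Unshelve. all: by end_near.
Qed.

End Portmanteau.

(** * Laplace transforms *)

(* [R] and [measurableTypeR R] carry the same sigma-algebra under different displays. *)
Lemma probability_of_measurableTypeR (R : realType) (m : probability (measurableTypeR R) R) :
  exists m' : probability R R, forall A : set R, m' A = m A.
Proof.
have mid : @measurable_fun _ _ (measurableTypeR R) R setT idfun by exact: measurable_id.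
pose X : {mfun measurableTypeR R >-> R} :=
  HB.pack (idfun : measurableTypeR R -> R) (@isMeasurableFun.Build _ _ (measurableTypeR R) R idfun mid).
by exists (distribution m X).
Qed.

Lemma exists_law_of_cdf (R : realType) (G : R -> R) :
  nondecreasing_fun G -> right_continuous G ->
  G @ -oo --> (0 : R) -> G @ +oo --> (1 : R) ->
  exists m : probability R R, forall x, m [set y | y <= x] = (G x)%:E.
Proof.
move=> nd rc Gl Gr.
pose H1 := isCumulative.Build R _ R G nd rc.
pose G1 : cumulative R R := HB.pack G H1.
pose G2 : cumulativeBounded (0 : R) (1 : R) := HB.pack G H1 (isCumulativeBounded.Build R 0 1 G1 Gl Gr).
pose m1 : probability (measurableTypeR R) R := lebesgue_stieltjes_measure G2.
have [m2 m2E] := probability_of_measurableTypeR m1.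
exists m2 => x; rewrite m2E.
have := cdf_lebesgue_stieltjes_id G2 x; rewrite /cdf /distribution /pushforward/= => <-.
congr (m1 _).
Qed.

Lemma cvg_sum_ord (R : realType) (F : set_system R) (f : nat -> R -> R) (l : nat -> R) n :
  Filter F -> (forall i, f i x @[x --> F] --> l i) ->
  \sum_(i < n) f i x @[x --> F] --> \sum_(i < n) l i.
Proof.
move=> FF fl; elim: n => [|n IH].
  rewrite big_ord0; have -> : (fun x => \sum_(i < 0) f i x) = cst 0.
    by apply/funext => x; rewrite big_ord0.
  exact: cvg_cst.
rewrite big_ord_recr.
have -> : (fun x => \sum_(i < n.+1) f i x) = (fun x => \sum_(i < n) f i x + f n x).
  by apply/funext => x; rewrite big_ord_recr.
exact: cvgD.
Qed.

Section Laplace.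
Context d (T : measurableType d) (R : realType) (P : probability T R).

Lemma bounded_Rintegrable (g : T -> R) (C : R) : measurable_fun setT g ->
  (forall w, `|g w| <= C) -> P.-integrable setT (EFin \o g).
Proof.
move=> mg gC; apply: measurable_bounded_integrable => //.
  by rewrite ltey_eq fin_num_measure.
exists C; split; first by rewrite num_real.
by move=> x Cx w _; apply: (le_trans (gC w)); exact: ltW.
Qed.

Lemma Rintegral_sum_ord (f : nat -> T -> R) n :
  (forall i, P.-integrable setT (EFin \o f i)) ->
  P.-integrable setT (EFin \o (fun w => \sum_(i < n) f i w)) /\
  (\int[P]_w (\sum_(i < n) f i w) = \sum_(i < n) \int[P]_w f i w)%R.
Proof.
move=> fi; elim: n => [|n [IH1 IH2]].
  have e0 : (fun w => \sum_(i < 0) f i w) = (fun _ : T => 0 : R).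
    by apply/funext => w; rewrite big_ord0.
  rewrite e0 big_ord0; split; first exact: (@integrable0 _ _ _ P setT).
  by rewrite Rintegral_cst ?mul0r.
have eS : (fun w => \sum_(i < n.+1) f i w) = (fun w => \sum_(i < n) f i w + f n w).
  by apply/funext => w; rewrite big_ord_recr.
rewrite eS big_ord_recr/= -IH2; split; last by rewrite RintegralD.
exact: (integrableD measurableT IH1 (fi n)).
Qed.

Lemma Rintegral_le_cst (X : T -> R) x : measurable_fun setT X ->
  (\int[P]_w (\1_[set w | X w <= x] w : R))%R = law_cdf P X x.
Proof.
move=> mX; rewrite /Rintegral integral_indic//; last exact: measurable_le_cst.
by rewrite setIT.
Qed.

Lemma probability_Rintegral_cst (c : R) : (\int[P]_w c)%R = c.
Proof.
rewrite Rintegral_cst//.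
have PT : fine (P setT) = 1 by rewrite probability_setT.
by rewrite [X in _ * X]PT mulr1.
Qed.

Variables (Z : R -> T -> R) (L : R -> R).
Hypothesis mZ : forall t, measurable_fun setT (Z t).
(** Only for large [t]: the normalizing factors, such as [g t], are positive only there. *)
Hypothesis Z0 : \forall t \near +oo, forall w, 0 <= Z t w.

Let LT t lam : R := (\int[P]_w expR (- (lam * Z t w)))%R.

Let m_exp lam t : measurable_fun setT (fun w => expR (- (lam * Z t w))).
Proof.
have h : measurable_fun setT (fun w => - (lam * Z t w)).
  by apply: measurable_funN; apply: measurable_funM => //; exact: measurable_cst.
exact: (measurableT_comp (@measurable_expR R) h).
Qed.

Let m_le t x : measurable_fun setT (\1_[set w | Z t w <= x] : T -> R).
Proof. by apply: measurable_indic; exact: measurable_le_cst. Qed.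

Section Polynomial.
Hypothesis hL : forall n : nat, LT t n%:R @[t --> +oo] --> L n%:R.

Let m_poly (p : {poly R}) t : measurable_fun setT (fun w => p.[expR (- Z t w)]).
Proof.
have hp : measurable_fun setT (fun s => p.[s]).
  by apply: continuous_measurable_fun; exact: continuous_horner.
have h : measurable_fun setT (fun w => expR (- Z t w)).
  by have := m_exp 1 t; under eq_fun do rewrite mul1r.
exact: (measurableT_comp hp h).
Qed.

Lemma laplace_poly_cvg (p : {poly R}) :
  (\int[P]_w p.[expR (- Z t w)])%R @[t --> +oo] --> \sum_(i < size p) p`_i * L i%:R.
Proof.
apply: (@cvg_trans _ ((\sum_(i < size p) p`_i * LT t i%:R) @[t --> +oo])); last first.
  apply: (cvg_sum_ord (f := fun i t => p`_i * LT t i%:R) (l := fun i => p`_i * L i%:R)) => i.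
  by apply: cvgMl_tmp; exact: hL.
apply: near_eq_cvg; near=> t; have Zt w : 0 <= Z t w by move: w; near: t.
have ei i w : `|expR (- (i%:R * Z t w))| <= 1.
  by rewrite ger0_norm ?expR_ge0// -expR0 ler_expR oppr_le0 mulr_ge0.
have inte i : P.-integrable setT (EFin \o (fun w => p`_i * expR (- (i%:R * Z t w)))).
  exact: (integrableZl measurableT p`_i (bounded_Rintegrable (m_exp _ _) (ei i))).
have -> : (fun w => p.[expR (- Z t w)]) = (fun w => \sum_(i < size p) p`_i * expR (- (i%:R * Z t w))).
  apply/funext => w; rewrite horner_coef; apply: eq_bigr => i _.
  by rewrite -expRM_natl mulrN.
have [_ ->] := Rintegral_sum_ord (size p) inte.
apply: eq_bigr => i _; rewrite /LT -RintegralZl//; exact: (bounded_Rintegrable (m_exp _ _) (ei i)).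
Unshelve. all: by end_near.
Qed.

(** For the thresholds [expR (- y) < expR (- x)], the polynomial of [poly_step] lies between the
    indicators of [Z t <= x] and [Z t <= y] up to [e / 2], and its integral converges to [r]. Since
    [r] does not depend on [t], it ties together the distribution functions at different large
    times. *)
Lemma laplace_cdf_sandwich (x y e : R) : 0 < x -> x < y -> 0 < e ->
  exists r, \forall t \near +oo,
    law_cdf P (Z t) x <= r + e /\ r - e <= law_cdf P (Z t) y.
Proof.
move=> x0 xy e0.
have [||||p hp] := @poly_step R (expR (- y)) (expR (- x)) (e / 2).
- exact: expR_ge0.
- by rewrite ltr_expR ltrN2.
- by rewrite -expR0 ler_expR; lra.
- by lra.
exists (\sum_(i < size p) p`_i * L i%:R).
have /cvgrPdist_le/(_ (e / 2)) := @laplace_poly_cvg p.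
move=> /(_ ltac:(lra)) hlim.
near=> t; have Zt w : 0 <= Z t w by move: w; near: t.
have : `|\sum_(i < size p) p`_i * L i%:R - (\int[P]_w p.[expR (- Z t w)])%R| <= e / 2.
  by near: t.
rewrite ler_norml => /andP[l1 l2].
have s01 w : 0 <= expR (- Z t w) <= 1.
  by rewrite expR_ge0/= -[leRHS]expR0 ler_expR oppr_le0 Zt.
have pb w : `|p.[expR (- Z t w)]| <= 1.
  by have [? ? _ _] := hp _ (s01 w); rewrite ger0_norm.
have ib (c z : R) w : `|c * \1_[set w | Z t w <= z] w| <= `|c|.
  by rewrite indicE normrM; case: (_ \in _); rewrite ?normr1 ?normr0 ?mulr1 ?mulr0.
have ii (c z : R) : P.-integrable setT (EFin \o (fun w => c * \1_[set w | Z t w <= z] w)).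
  by apply: (bounded_Rintegrable _ (ib c z)); apply: measurable_funM => //; exact: measurable_cst.
have ii1 (z : R) : P.-integrable setT (EFin \o (\1_[set w | Z t w <= z] : T -> R)).
  by apply: (@bounded_Rintegrable _ 1) => // w; have := ib 1 z w; rewrite mul1r normr1.
have F01 z : 0 <= law_cdf P (Z t) z <= 1 by rewrite law_cdf_ge0 law_cdf_le1.
have lo : (1 - e / 2) * law_cdf P (Z t) x <= (\int[P]_w p.[expR (- Z t w)])%R.
  rewrite -Rintegral_le_cst// -RintegralZl//.
  apply: le_Rintegral => //; first exact: (bounded_Rintegrable (m_poly _ _) pb).
  move=> w _; have [p0 _ _ p3] := hp _ (s01 w).
  rewrite indicE; have [Zx|Zx] := leP (Z t w) x.
    by rewrite mem_set// mulr1; apply: p3; rewrite ler_expR lerN2.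
  by rewrite memNset ?mulr0//=; apply/negP; rewrite -ltNge.
have hi : (\int[P]_w p.[expR (- Z t w)])%R <= law_cdf P (Z t) y + e / 2.
  rewrite -Rintegral_le_cst// -[e / 2]probability_Rintegral_cst -RintegralD//; last first.
    exact: (@bounded_Rintegrable (fun=> e / 2) `|e / 2|).
  apply: le_Rintegral => //; first exact: (bounded_Rintegrable (m_poly _ _) pb).
    apply: (@bounded_Rintegrable _ (1 + `|e / 2|)).
      by apply: measurable_funD => //; exact: measurable_cst.
    by move=> w; apply: le_trans (ler_normD _ _) _; rewrite lerD2r indicE; case: (_ \in _); rewrite ?normr1 ?normr0.
  move=> w _; have [_ p1 p2 _] := hp _ (s01 w).
  rewrite indicE; have [Zx|Zx] := leP (Z t w) y.
    by rewrite mem_set// mulr1n; lra.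
  rewrite memNset/=; last by apply/negP; rewrite -ltNge.
  by rewrite mulr0n add0r; apply: p2; rewrite ler_expR lerN2 ltW.
have := F01 x; have := F01 y; nra.
Unshelve. all: by end_near.
Qed.

End Polynomial.

End Laplace.

Section LaplaceBounds.
Context d (T : measurableType d) (R : realType) (P : probability T R).
Variable X : T -> R.
Hypothesis mX : measurable_fun setT X.
Hypothesis X0 : forall w, 0 <= X w.

Let m_exp (lam : R) : measurable_fun setT (fun w => expR (- (lam * X w))).
Proof.
have h : measurable_fun setT (fun w => - (lam * X w)).
  by apply: measurable_funN; apply: measurable_funM => //; exact: measurable_cst.
exact: (measurableT_comp (@measurable_expR R) h).
Qed.

Let e_le1 (lam : R) w : 0 <= lam -> `|expR (- (lam * X w))| <= 1.
Proof.
by move=> lam0; rewrite ger0_norm ?expR_ge0// -[leRHS]expR0 ler_expR oppr_le0 mulr_ge0.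
Qed.

Let i_norm x w : `|\1_[set w | X w <= x] w : R| <= 1.
Proof. by rewrite indicE; case: (_ \in _); rewrite ?normr1 ?normr0. Qed.

Let i_int x : P.-integrable setT (EFin \o (\1_[set w | X w <= x] : T -> R)).
Proof.
by apply: (@bounded_Rintegrable _ _ _ P _ 1) => //; apply: measurable_indic; exact: measurable_le_cst.
Qed.

Let i_exp (lam : R) : 0 <= lam -> P.-integrable setT (EFin \o (fun w => expR (- (lam * X w)))).
Proof. by move=> lam0; apply: (@bounded_Rintegrable _ _ _ P _ 1) => // w; exact: e_le1. Qed.

Lemma laplace_le_cdf (lam x : R) : 0 <= lam ->
  (\int[P]_w expR (- (lam * X w)) <= law_cdf P X x + expR (- (lam * x)))%R.
Proof.
move=> lam0.
have ci (c : R) : P.-integrable setT (EFin \o (fun _ : T => c)).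
  by apply: (@bounded_Rintegrable _ _ _ _ _ `|c|) => //; exact: measurable_cst.
rewrite -Rintegral_le_cst// -[expR (- (lam * x))](probability_Rintegral_cst P) -RintegralD//.
apply: le_Rintegral => //.
- exact: i_exp.
- exact: (integrableD measurableT (i_int x) (ci _)).
move=> w _; rewrite indicE; have [Xx|Xx] := leP (X w) x.
  rewrite mem_set// mulr1n; have := e_le1 w lam0.
  by rewrite ger0_norm ?expR_ge0// => h; rewrite (le_trans h)// lerDl expR_ge0.
rewrite memNset/=; last by apply/negP; rewrite -ltNge.
by rewrite mulr0n add0r ler_expR lerN2 ler_wpM2l// ltW.
Qed.

Lemma cdf_le_laplace (lam x : R) : 0 <= lam ->
  law_cdf P X x * expR (- (lam * x)) <= (\int[P]_w expR (- (lam * X w)))%R.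
Proof.
move=> lam0; rewrite mulrC -Rintegral_le_cst// -RintegralZl//.
apply: le_Rintegral => //.
- exact: (integrableZl measurableT _ (i_int x)).
- exact: i_exp.
move=> w _; rewrite indicE; have [Xx|Xx] := leP (X w) x.
  by rewrite mem_set// mulr1 ler_expR lerN2 ler_wpM2l.
rewrite memNset/=; last by apply/negP; rewrite -ltNge.
by rewrite mulr0 expR_ge0.
Qed.

End LaplaceBounds.

Section LaplaceContinuity.
Context d (T : measurableType d) (R : realType) (P : probability T R).
Variables (Z : R -> T -> R) (L : R -> R).
Hypothesis mZ : forall t, measurable_fun setT (Z t).
Hypothesis Z0 : \forall t \near +oo, forall w, 0 <= Z t w.

Let LT t lam : R := (\int[P]_w expR (- (lam * Z t w)))%R.
Hypothesis hL : forall lam : R, 0 <= lam -> LT t lam @[t --> +oo] --> L lam.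
Hypothesis L1 : L lam @[lam --> 0^'+] --> (1 : R).

Let F t := law_cdf P (Z t).
(** [S x] collects the eventual upper bounds of [F t y] for [y > x], so [G x] is the infimum over
    [y > x] of the upper limits of [F t y]. Taking [y] strictly larger makes [G]
    right-continuous. *)
Let S (x : R) : set R := [set r | exists2 y, x < y & \forall t \near +oo, F t y <= r].
Let G (x : R) : R := inf (S x).

Let S1 x : S x 1.
Proof. by exists (x + 1); [lra|near=> t; exact: law_cdf_le1]. Unshelve. all: by end_near. Qed.

Let S_lb x : lbound (S x) 0.
Proof.
move=> r [y _ /filter_ex[t]]; apply: le_trans; exact: law_cdf_ge0.
Qed.

Let S_inf x : has_inf (S x).
Proof. by split; [exists 1; exact: S1|exists 0; exact: S_lb]. Qed.

Let G_le x r : S x r -> G x <= r.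
Proof. by apply: ge_inf; exists 0; exact: S_lb. Qed.

Let G_ge x c : (forall r, S x r -> c <= r) -> c <= G x.
Proof. by move=> h; apply: lb_le_inf => //; exists 1; exact: S1. Qed.

Let G_adh x e : 0 < e -> exists2 r, S x r & r < G x + e.
Proof. by move=> e0; exact: (inf_adherent e0 (S_inf x)). Qed.

Let G_nd : nondecreasing_fun G.
Proof.
move=> x y xy; apply: G_ge => r [z yz hz]; apply: G_le; exists z => //.
exact: le_lt_trans yz.
Qed.

Let G_rc : right_continuous G.
Proof.
move=> x; apply/cvgrPdist_le => e e0.
have [r [z xz hz] re] := G_adh x e0.
near=> y; have xy : x < y by near: y; exact: nbhs_right_gt.
have yz : y < z by near: y; exact: nbhs_right_lt.
have h1 : G y <= r by apply: G_le; exists z.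
by have := G_nd (ltW xy); rewrite ler_norml; lra.
Unshelve. all: by end_near.
Qed.

Let G_neg x : x < 0 -> G x = 0.
Proof.
move=> x0; apply/eqP; rewrite eq_le; apply/andP; split; last by apply: G_ge => r; exact: S_lb.
apply: G_le; exists (x / 2); first lra.
near=> t; have Zt w : 0 <= Z t w by move: w; near: t.
rewrite /F /law_cdf (_ : [set w | Z t w <= x / 2] = set0) ?measure0//.
apply/seteqP; split => // w /= h; have := Zt w; lra.
Unshelve. all: by end_near.
Qed.

Let G_Ny : G @ -oo --> (0 : R).
Proof.
apply: (@cvg_trans _ ((cst (0 : R)) @ -oo)); last exact: cvg_cst.
apply: near_eq_cvg; near=> x; have x0 : x < 0 by near: x; exact: nbhs_ninfty_lt.
by rewrite G_neg.
Unshelve. all: by end_near.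
Qed.

(** No mass escapes to infinity: [L lam] is close to [1] for some small [lam > 0], and
    [laplace_le_cdf] turns this into a lower bound for [F t y] at all large [y]. *)
Let G_y : G @ +oo --> (1 : R).
Proof.
apply/cvgrPdist_le => e e0.
have [lam [lam0 hlam]] : exists lam, 0 < lam /\ 1 - e / 4 <= L lam.
  have e4 : 0 < e / 4 by lra.
  move/cvgrPdist_le : L1 => /(_ _ e4) h.
  have [lam [l1 l2]] := @filter_ex _ (0^'+ : set_system R) _ _ (filterI h (nbhs_right_gt (0 : R))).
  by exists lam; split => //; move: l1; rewrite ler_norml; lra.
near=> x.
have x_large : expR (- (lam * x)) <= e / 4.
  have k : - ln (e / 4) / lam <= x by near: x; apply: nbhs_pinfty_ge; exact: num_real.
  have h2 : - ln (e / 4) <= lam * x by move: k; rewrite ler_pdivrMr// [x * lam]mulrC.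
  by rewrite -[leRHS]lnK ?ler_expR ?posrE; lra.
have G1 : G x <= 1 by apply: G_le.
suff : 1 - e <= G x by rewrite ler_norml; lra.
apply: G_ge => r [y xy hy].
have e4 : 0 < e / 4 by lra.
have /cvgrPdist_le/(_ _ e4) hl := hL (ltW lam0).
have [t [[ht1 ht2] Zt]] := filter_ex (filterI (filterI hl hy) Z0).
have := laplace_le_cdf P (mZ t) Zt x (ltW lam0).
have := law_cdf_homo P (mZ t) (ltW xy).
move: ht1; rewrite -/(LT t lam) -!/(F t _) ler_norml.
move: ht2; rewrite /LT /F; lra.
Unshelve. all: by end_near.
Qed.

(** The upper comparison of [F t] with [G] is the definition of [G]. The lower one uses the sandwich
    between [(x + y) / 2] and [y]: the midpoint exceeds [x], so [G x <= r + e / 2], while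
    [r - e / 2] is a lower bound at [y]. *)
Lemma laplace_continuity : exists m : probability R R,
  [/\ m [set y : R | y < 0] = 0%E,
      forall lam : R, 0 <= lam -> (\int[m]_y (expR (- (lam * y)))%:E)%E = (L lam)%:E &
      cvg_law P Z m].
Proof.
have [m mG] := exists_law_of_cdf G_nd G_rc G_Ny G_y.
have mF x : law_cdf m (fun y : R => y) x = G x by rewrite /law_cdf mG.
have m0 : m [set y : R | y < 0] = 0%E.
  pose A n := [set y : R | y <= - n.+1%:R^-1].
  have mA n : measurable (A n).
    have -> : A n = [set` `]-oo, - n.+1%:R^-1]] by apply/seteqP; split => y; rewrite /A/= in_itv.
    exact: measurable_itv.
  have AE : \bigcup_n A n = [set y : R | y < 0].
    apply/seteqP; split => y /=.
      by move=> [n _]; rewrite /A/= => /le_lt_trans; apply; rewrite oppr_lt0 invr_gt0.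
    move=> y0; exists (Num.truncn (- y)^-1) => //; rewrite /A/=.
    rewrite lerNr -[leRHS]invrK lef_pV2 ?posrE ?invr_gt0 ?oppr_gt0//.
    exact/ltW/truncnS_gt.
  have : m (A n) @[n --> \oo] --> m (\bigcup_n A n).
    apply: nondecreasing_cvg_mu => //; first exact: bigcup_measurable.
    move=> n k nk; apply/subsetPset => y; rewrite /A/= => /le_trans; apply.
    by rewrite lerN2 lef_pV2 ?posrE// ler_nat.
  have -> : (fun n => m (A n)) = cst 0%E.
    by apply/funext => n; rewrite mG G_neg// oppr_lt0 invr_gt0.
  by rewrite AE => h; apply: (cvg_unique (@ereal_hausdorff R) h); exact: cvg_cst.
have claw : cvg_law P Z m.
  apply: cvg_law_of_cdf => // [x y e xy e0|x y e xy e0].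
    rewrite mF; have [r [z yz hz] re] := G_adh y e0.
    near=> t; apply: (@le_trans _ _ (F t z)); first by apply: law_cdf_homo => //; apply: ltW; apply: lt_trans yz.
    by apply: (@le_trans _ _ r); [near: t|exact: ltW].
  rewrite mF; have [x0|x0] := ltP x 0.
    by near=> t; rewrite G_neg// addr_ge0 ?law_cdf_ge0// ltW.
  have xm : 0 < (x + y) / 2 by lra.
  have my : (x + y) / 2 < y by lra.
  have e2 : 0 < e / 2 by lra.
  have [r hr] := laplace_cdf_sandwich mZ Z0 (fun n => hL (ler0n R n)) xm my e2.
  have Gr : G x <= r + e / 2.
    apply: G_le; exists ((x + y) / 2); first lra.
    by apply: filterS hr => t [].
  near=> t; have : r - e / 2 <= law_cdf P (Z t) y by near: t; apply: filterS hr => t [].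
  lra.
exists m; split => // lam lam0.
(* Replacing [y] by [Num.max y 0] gives a test function bounded on the whole line; nothing changes
   almost everywhere for [m], nor at the values of [Z t] for large [t]. *)
pose f (y : R) := expR (- (lam * Num.max y 0)).
have cf : continuous f.
  move=> y; apply: continuous_comp; last exact: continuous_expR.
  apply: (@continuousN _ R^o); apply: cvgMl_tmp.
  by apply: continuous_max; [exact: cvg_id|exact: cvg_cst].
have f1 y : `|f y| <= 1.
  rewrite /f ger0_norm ?expR_ge0// -[leRHS]expR0 ler_expR oppr_le0 mulr_ge0//.
  by rewrite le_max lexx orbT.
have h1 := claw f cf (ex_intro _ 1 f1).
have h2 : (\int[P]_w (f (Z t w))%:E)%E @[t --> +oo] --> (L lam)%:E.
  apply: cvg_trans (cvg_EFin_fin _ (hL lam0)).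
  apply: near_eq_cvg; near=> t; have Zt w : 0 <= Z t w by move: w; near: t.
  have fZ : (fun w => f (Z t w)) = (fun w => expR (- (lam * Z t w))).
    by apply/funext => w; rewrite /f max_l.
  rewrite /LT -fZ fineK//; apply: (integrable_fin_num measurableT).
  apply: (@bounded_Rintegrable _ _ _ P _ 1) => //.
  have mf : measurable_fun setT f by exact: continuous_measurable_fun.
  exact: (measurableT_comp mf (mZ t)).
rewrite -(cvg_unique (@ereal_hausdorff R) h1 h2).
have mneg : measurable [set y : R | y < 0].
  have -> : [set y : R | y < 0] = [set` `]-oo, (0:R)[] by apply/seteqP; split => y; rewrite /= in_itv.
  exact: measurable_itv.
apply: ae_eq_integral => //.
- apply/measurable_EFinP; apply: continuous_measurable_fun => y.
  apply: continuous_comp; last exact: continuous_expR.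
  by apply: (@continuousN _ R^o); apply: cvgMl_tmp; exact: cvg_id.
- by apply/measurable_EFinP; exact: continuous_measurable_fun.
exists [set y : R | y < 0]; split => // y /= /not_implyP[_] h.
rewrite ltNge; apply/negP => y0; apply: h; rewrite /f max_l//.
Unshelve. all: by end_near.
Qed.

End LaplaceContinuity.

(** A small [th] gives the upper bound, since [expR (- th * X)] is almost [1] on [X <= 1]; a large
    [th] gives the lower bound, since it is almost [0] on [X > 1]. *)
Lemma degenerate_laplace_cdf d (T : measurableType d) (R : realType) (P : probability T R)
  (X : R -> T -> R) (p : R) :
  (forall t, measurable_fun setT (X t)) ->
  (\forall t \near +oo, forall w, 0 <= X t w) ->
  (forall th : R, 0 < th ->
    (\int[P]_w expR (- (th * X t w)))%R @[t --> +oo] --> p) ->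
  law_cdf P (X t) 1 @[t --> +oo] --> p.
Proof.
move=> mX X0 hp; apply/cvgrPdist_le => e e0.
(* The small parameter will be [ln (1 + k)], whose exponential costs a factor [1 + k]; [k] and [eta]
   are such that [(p + eta) * (1 + k) <= p + e]. *)
pose k := e / (2 * (`|p| + 1)).
have p1 : 0 < `|p| + 1 by rewrite ltr_wpDl.
have k0 : 0 < k by rewrite divr_gt0// mulr_gt0.
have kp : k * (`|p| + 1) = e / 2.
  by rewrite /k invfM mulrA -mulrA mulVf ?mulr1// gt_eqF.
pose eta := Num.min 1 (e / 2).
have eta0 : 0 < eta by rewrite lt_min ltr01/=; lra.
have [eta1 eta2] : eta <= 1 /\ eta <= e / 2 by rewrite !ge_min !lexx orbT.
have th1 : 0 < ln (1 + k) by rewrite ln_gt0// ltrDl.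
have e2 : 0 < e / 2 by lra.
have [th2 [th20 hth2]] : exists th, 0 < th /\ expR (- (th * 1)) <= e / 2.
  exists (Num.max 1 (- ln (e / 2))); split; first by rewrite lt_max ltr01.
  by rewrite mulr1 -[leRHS]lnK ?posrE// ler_expR lerNl le_max lexx orbT.
have /cvgrPdist_le/(_ _ eta0) h1 := hp _ th1.
have /cvgrPdist_le/(_ _ e2) h2 := hp _ th20.
near=> t; have Xt w : 0 <= X t w by move: w; near: t.
have b1 := cdf_le_laplace P (mX t) Xt 1 (ltW th1).
have b2 := laplace_le_cdf P (mX t) Xt 1 (ltW th20).
have h1' : `|p - (\int[P]_w expR (- (ln (1 + k) * X t w)))%R| <= eta by near: t.
have h2' : `|p - (\int[P]_w expR (- (th2 * X t w)))%R| <= e / 2 by near: t.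
move: (law_cdf P (X t) 1) (\int[P]_w expR (- (ln (1 + k) * X t w)))%R (\int[P]_w expR (- (th2 * X t w)))%R b1 b2 h1' h2' => c I1 I2 b1 b2 h1' h2'.
move: b1; rewrite mulr1 expRN lnK ?posrE; last lra.
rewrite ler_pdivrMr; last lra.
move: h1' h2'; rewrite !ler_norml => /andP[l1 _] /andP[_ l2] b1.
have b3 : c <= p + e.
  apply: le_trans b1 _.
  apply: (@le_trans _ _ ((p + eta) * (1 + k))).
    by apply: ler_wpM2r; lra.
  have : k * (p + eta) <= k * (`|p| + 1).
    by apply: ler_wpM2l; [exact: ltW|have := ler_norm p; lra].
  by rewrite kp; lra.
lra.
Unshelve. all: by end_near.
Qed.

(** Both sides live on the nonnegative half-line and the limit has no atom at [0], so positive
    thresholds determine everything. *)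
Lemma cvg_law_of_cdf_pos d (T : measurableType d) (R : realType) (P : probability T R)
  (Z : R -> T -> R) (m : probability R R) :
  (forall t, measurable_fun setT (Z t)) ->
  (\forall t \near +oo, forall w, 0 <= Z t w) ->
  law_cdf m (fun y : R => y) 0 = 0 ->
  (forall x y e, 0 < x -> x < y -> 0 < e ->
     \forall t \near +oo, law_cdf P (Z t) x <= law_cdf m (fun y : R => y) y + e) ->
  (forall x e, 0 < x -> 0 < e ->
     \forall t \near +oo, law_cdf m (fun y : R => y) x <= law_cdf P (Z t) x + e) ->
  cvg_law P Z m.
Proof.
move=> mZ Z0 m0 FG GF.
have mid : measurable_fun setT (fun y : R => y) by exact: measurable_id.
apply: cvg_law_of_cdf => // [x y e xy e0|x y e xy e0].
- have [y0|y0] := leP y 0.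
    near=> t; have Zt w : 0 <= Z t w by move: w; near: t.
    have -> : law_cdf P (Z t) x = 0.
      rewrite /law_cdf (_ : [set w | Z t w <= x] = set0) ?measure0//.
      apply/seteqP; split => // w /= h; have := Zt w; lra.
    by rewrite addr_ge0 ?law_cdf_ge0// ltW.
  (* If [x <= 0 < y], the threshold [x] is first raised to a positive one still below [y]. *)
  have m1 : 0 < Num.max x (y / 2) by rewrite lt_max; apply/orP; right; lra.
  have m2 : Num.max x (y / 2) < y by rewrite gt_max xy; lra.
  have := FG _ _ _ m1 m2 e0; apply: filterS => t; apply: le_trans.
  by apply: law_cdf_homo => //; rewrite le_max lexx.
have [x0|x0] := leP x 0.
  near=> t; apply: (@le_trans _ _ 0); last by rewrite addr_ge0 ?law_cdf_ge0// ltW.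
  by rewrite -m0; exact: law_cdf_homo.
have := GF _ _ x0 e0; apply: filterS => t h; apply: le_trans h _.
by rewrite lerD2r; apply: law_cdf_homo => //; exact: ltW.
Unshelve. all: by end_near.
Qed.

(** * The uniform and exponential laws *)

Lemma uniform_law (R : realType) : exists m : probability R R,
  [/\ forall A : set R, m A = uniform_prob (@ltr01 R) A,
      forall x, 0 <= x <= 1 -> law_cdf m (fun y : R => y) x = x &
      law_cdf m (fun y : R => y) 0 = 0].
Proof.
pose m0 : probability (measurableTypeR R) R := uniform_prob (@ltr01 R).
have [m mE] := probability_of_measurableTypeR m0.
have hx x : 0 <= x <= 1 -> law_cdf m (fun y : R => y) x = x.
  move=> /andP[x0 x1]; rewrite /law_cdf mE /m0/= /uniform_prob integral_uniform_pdf.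
  have -> : [set w : R | w <= x] `&` `[0, 1] = `[0, x]%classic.
    apply/seteqP; split => y /=; rewrite !in_itv/=; first by move=> [-> /andP[->]].
    by move=> /andP[-> yx]; split => //=; exact: le_trans x1.
  rewrite (eq_integral (fun=> 1%:E)); last first.
    move=> y; rewrite inE/= in_itv/= => /andP[y0 yx].
    by rewrite /uniform_pdf y0 (le_trans yx)// subr0 invr1.
  rewrite integral_cst//= mul1e lebesgue_measure_itv/= lte_fin.
  by case: ltP => x0' /=; rewrite ?subr0//; apply: le_anti; rewrite x0.
exists m; split => //; apply: hx; lra.
Qed.

Lemma exponential_law (R : realType) : exists m : probability R R,
  [/\ forall A : set R, m A = exponential_prob 1 A,
      forall x, 0 < x -> law_cdf m (fun y : R => y) x = 1 - expR (- x) &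
      law_cdf m (fun y : R => y) 0 = 0].
Proof.
pose m0 : probability (measurableTypeR R) R := exponential_prob (1 : R).
have [m mE] := probability_of_measurableTypeR (m0 ltr01).
have mid : measurable_fun setT (fun y : R => y) by exact: measurable_id.
have mneg : m `]-oo, (0:R)[%classic = 0%E.
  rewrite mE /m0/= /exponential_prob; apply: integral0_eq => x.
  by rewrite /= in_itv/= => x0; rewrite lt0_exponential_pdf.
have hx x : 0 < x -> law_cdf m (fun y : R => y) x = 1 - expR (- x).
  move=> x0; rewrite /law_cdf.
  have -> : [set w : R | w <= x] = `]-oo, 0[%classic `|` `[0, x]%classic.
    apply/seteqP; split => y /=; rewrite !in_itv/=.
      by move=> yx; case: (ltP y 0) => y0; [left|right].
    by move=> [/ltW/le_trans|/andP[//]]; apply; exact: ltW.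
  rewrite measureU//; last first.
    by apply/seteqP; split => // y /= []; rewrite !in_itv/= => y0 /andP[]; rewrite leNgt y0.
  rewrite [X in (X + _)%E]mneg add0e.
  rewrite [X in fine X](mE `[0, x]%classic) /m0/= exponential_prob_itv0c//.
  by rewrite mulN1r.
exists m; split => //.
apply: le_anti; rewrite law_cdf_ge0 andbT; apply/ler_addgt0Pl => e e0; rewrite addr0.
apply: (@le_trans _ _ (law_cdf m (fun y : R => y) e)); first by apply: law_cdf_homo => //; exact: ltW.
by rewrite hx//; have := expR_ge1Dx (- e); lra.
Qed.

(** * Branching and immigration mechanisms *)

Section LevelSets.
Local Open Scope ereal_scope.
Context d (T : measurableType d) (R : realType).
Let mu : {sigma_finite_measure set (measurableTypeR R) -> \bar R} := @lebesgue_measure R.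
Variable g : T -> R.
Hypothesis mg : measurable_fun setT g.
Hypothesis g0 : forall x, (0 <= g x)%R.

Let A : set (T * measurableTypeR R) := [set p | ((0 : R) <= p.2 :> R)%R /\ (p.2 < g p.1)%R].

Let mA : measurable A.
Proof.
pose a1 (p : T * measurableTypeR R) := ((0 : R) <= (p.2 : R))%R.
pose a2 (p : T * measurableTypeR R) := ((p.2 : R) < g p.1)%R.
have -> : A = a1 @^-1` [set true] `&` a2 @^-1` [set true].
  by apply/seteqP; split => p.
apply: measurableI.
- have h : measurable_fun setT a1.
    by apply: measurable_fun_ler => //; exact: measurable_cst.
  by rewrite -[X in measurable X]setTI; exact: h.
- have h : measurable_fun setT a2.
    apply: measurable_fun_ltr => //.
    exact: (measurableT_comp mg (@measurable_fst _ _ _ _)).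
  by rewrite -[X in measurable X]setTI; exact: h.
Qed.

Let f (p : T * measurableTypeR R) : \bar R := (\1_A p)%:E.

Let mf : measurable_fun setT f.
Proof. by apply/measurable_EFinP; exact: measurable_indic. Qed.

Let f0 p : 0 <= f p. Proof. by rewrite lee_fin. Qed.

Let mlt s : measurable [set x | (s < g x)%R].
Proof.
have -> : [set x | (s < g x)%R] = g @^-1` `]s, +oo[.
  by apply/seteqP; split => x; rewrite /= in_itv/= andbT.
by rewrite -[X in measurable X]setTI; exact: mg.
Qed.

Let level (nu : {finite_measure set T -> \bar R}) s : \int[nu]_x f (x, s) =
  if (0 <= s)%R then nu [set x | (s < g x)%R] else 0.
Proof.
rewrite /f; case: ifPn => s0.
  rewrite (eq_integral (fun x => (\1_[set x | (s < g x)%R] x)%:E)).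
    by rewrite integral_indic// setIT.
  move=> x _; rewrite !indicE; congr (_%:R)%:E; congr nat_of_bool.
  by apply/idP/idP => /set_mem h; apply/mem_set; [case: h|split].
apply: integral0_eq => x _; rewrite indicE memNset// => -[/=].
by rewrite (negbTE s0).
Qed.

(** Layer-cake formula: by Tonelli on the region [A] under the graph, the integral of [g] is the
    Lebesgue integral over [s >= 0] of the measure of the set where [g > s]. *)
Lemma le_integral_level_sets (nu1 nu2 : {finite_measure set T -> \bar R}) :
  (forall s, (0 <= s)%R -> nu1 [set x | (s < g x)%R] <= nu2 [set x | (s < g x)%R]) ->
  \int[nu1]_x (g x)%:E <= \int[nu2]_x (g x)%:E.
Proof.
move=> h.
have cake (nu : {finite_measure set T -> \bar R}) :
    \int[nu]_x (g x)%:E = \int[mu]_s \int[nu]_x f (x, s).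
  rewrite -(fubini_tonelli f)//; apply: eq_integral => x _.
  rewrite /f; transitivity (\int[mu]_s (\1_(`[0%R, g x[%classic : set R) s)%:E).
    rewrite integral_indic//= setIT lebesgue_measure_itv/= lte_fin.
    case: ltP => [_|gx0]; first by rewrite sube0.
    by congr (_%:E); apply: le_anti; rewrite gx0 g0.
  apply: eq_integral => s _; rewrite !indicE; congr (_%:R)%:E; congr nat_of_bool.
  by apply/idP/idP => /set_mem k; apply/mem_set; move: k; rewrite /A/= in_itv/= => /andP.
rewrite !cake; apply: ge0_le_integral => //.
- by move=> s _; apply: integral_ge0.
- by have := @measurable_fun_fubini_tonelli_G _ _ _ _ _ nu1 _ mf f0.
- by have := @measurable_fun_fubini_tonelli_G _ _ _ _ _ nu2 _ mf f0.
- by move=> s _; rewrite !level; case: ifP => // s0; exact: h.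
Qed.

End LevelSets.

Lemma open_upper_ray (R : realType) (B : set R) (w : R) :
  open B -> (forall x y, B x -> x <= y -> B y) -> (forall x, B x -> w < x) ->
  B !=set0 -> exists2 b, w <= b & B = `]b, +oo[%classic.
Proof.
move=> oB upB wB B0; exists (inf B).
  by apply: lb_le_inf => // x /wB/ltW.
have hB : has_inf B by split => //; exists w => x /wB/ltW.
apply/seteqP; split => x; rewrite /= in_itv/= andbT.
  move=> Bx; have /nbhs_ballP[e /= e0 be] := open_nbhs_nbhs (conj oB Bx).
  have : B (x - e / 2).
    by apply: be; rewrite /ball/= opprB addrC subrK gtr0_norm; lra.
  by move/(ge_inf hB.2); lra.
move=> bx; have xb : 0 < x - inf B by lra.
by have [y By] := inf_adherent xb hB; rewrite addrC subrK => /ltW; exact: upB.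
Qed.

(** The level sets of a continuous nondecreasing [f] inside []w, +oo[] are open rays, on which the
    tails are compared by assumption. Restriction to []w, +oo[] makes both measures finite, as
    Tonelli requires. *)
Lemma tail_domination (R : realType) (m1 m2 : {measure set R -> \bar R}) (w : R) (f : R -> R) :
  continuous f -> nondecreasing_fun f -> (forall x, 0 <= f x) ->
  (m2 `]w, +oo[%classic < +oo)%E ->
  (forall y, w <= y -> (m1 `]y, +oo[%classic <= m2 `]y, +oo[%classic)%E) ->
  (\int[m1]_(x in `]w, +oo[) (f x)%:E <= \int[m2]_(x in `]w, +oo[) (f x)%:E)%E.
Proof.
move=> cf ndf f0 fin2 m12.
pose D : set R := `]w, +oo[%classic.
have mD : measurable D by exact: measurable_itv.
have fin1 : (m1 D < +oo)%E by apply: le_lt_trans fin2; exact: m12.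
pose n1 : {finite_measure set R -> \bar R} := mfrestr mD fin1.
pose n2 : {finite_measure set R -> \bar R} := mfrestr mD fin2.
have mf : measurable_fun setT f by exact: continuous_measurable_fun.
pose g : R -> R := f \_ D.
have mg : measurable_fun setT g.
  by apply/(measurable_restrictT _ mD)/measurable_funTS.
have g0 x : 0 <= g x by rewrite /g patchE; case: ifP.
have r1 : (\int[m1]_(x in D) (f x)%:E = \int[n1]_x (g x)%:E)%E.
  rewrite (@eq_measure_integral _ _ _ D n1).
    by rewrite integral_mkcond; apply: eq_integral => x _; rewrite /g !patchE; case: ifP.
  by move=> A mA AD; rewrite /n1/= /mfrestr /mrestr setIidl.
have r2 : (\int[m2]_(x in D) (f x)%:E = \int[n2]_x (g x)%:E)%E.
  rewrite (@eq_measure_integral _ _ _ D n2).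
    by rewrite integral_mkcond; apply: eq_integral => x _; rewrite /g !patchE; case: ifP.
  by move=> A mA AD; rewrite /n2/= /mfrestr /mrestr setIidl.
rewrite r1 r2; apply: le_integral_level_sets => // s s0.
rewrite /n1 /n2/= /mfrestr /mrestr.
set B := _ `&` D.
have BE : B = D `&` [set x | s < f x].
  rewrite /B setIC; apply/seteqP; split => x [Dx /=].
    by rewrite /g patchE mem_set.
  by move=> sf; split => //=; rewrite /g patchE mem_set.
have [->|B0] := eqVneq B set0; first by rewrite !measure0.
have [||||b wb ->] := @open_upper_ray R B w; last exact: m12.
- rewrite BE; apply: openI; first exact: interval_open.
  have -> : [set x | s < f x] = f @^-1` `]s, +oo[%classic.
    by apply/seteqP; split => x; rewrite /= in_itv/= andbT.
  by apply: open_comp => [x _|]; [exact: cf|exact: interval_open].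
- rewrite BE => x y [] /=; rewrite /D /= in_itv/= andbT => wx sx xy.
  split; first by rewrite /= in_itv/= andbT; exact: lt_le_trans xy.
  by apply: lt_le_trans sx _; exact: ndf.
- by rewrite BE => x [] /=; rewrite /D/= in_itv/= andbT.
- exact/set0P.
Qed.

(** * The integral part of the branching mechanism *)

Definition expm1_rem {R : realType} (z : R) : R := expR (- z) - 1 + z.

Section ExpRem.
Context {R : realType}.
Implicit Types y z : R.

Lemma expm1_rem_ge0 z : 0 <= expm1_rem z.
Proof. by have := expR_ge1Dx (- z); rewrite /expm1_rem; lra. Qed.

Lemma expm1_rem_gt0 z : 0 < z -> 0 < expm1_rem z.
Proof.
move=> z0; have := @expR_gt1Dx R (- z); rewrite oppr_eq0 gt_eqF// => /(_ isT).
by rewrite /expm1_rem; lra.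
Qed.

Lemma expm1_rem_homo y z : 0 <= y -> y <= z -> expm1_rem y <= expm1_rem z.
Proof.
move=> y0 yz; have e1 := expR_ge1Dx (- (z - y)).
have -> : expm1_rem z = expR (- y) * expR (- (z - y)) - 1 + z.
  by rewrite -expRD /expm1_rem; congr (expR _ - 1 + z); lra.
rewrite /expm1_rem.
have h0 := expR_ge0 (- y).
have h1 : expR (- y) <= 1 by rewrite -[leRHS]expR0 ler_expR; lra.
nra.
Qed.

Lemma expm1_rem_le_id z : 0 <= z -> expm1_rem z <= z.
Proof.
by move=> z0; have : expR (- z) <= 1; [rewrite -[leRHS]expR0 ler_expR; lra|rewrite /expm1_rem; lra].
Qed.

(** From [expR (- z) <= (1 + z)^-1] the left side is at most [z^2 / (1 + z)]. Together with the
    bound by [z], this gives domination by the weight [Num.min z (z ^+ 2)]. *)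
Lemma expm1_rem_le_sqr z : 0 <= z -> expm1_rem z <= z ^+ 2.
Proof.
move=> z0; have e1 := expR_ge1Dx z.
have z1 : 0 < 1 + z by lra.
have : expR (- z) <= (1 + z)^-1 by rewrite expRN lef_pV2// posrE// expR_gt0.
have : (1 + z)^-1 * (1 + z) = 1 by rewrite mulVf// gt_eqF.
rewrite /expm1_rem expr2; set v := (1 + z)^-1.
have : 0 < v by rewrite invr_gt0.
nra.
Qed.

Lemma continuous_expm1_rem : continuous (@expm1_rem R).
Proof.
move=> z; apply: cvgD; last exact: cvg_id.
apply: cvgB; last exact: cvg_cst.
by apply: continuous_comp; [exact: oppr_continuous|exact: continuous_expR].
Qed.

End ExpRem.

Lemma set_gtE (R : realType) (u : R) : [set z | u < z] = `]u, +oo[%classic.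
Proof. by apply/seteqP; split => z; rewrite /= in_itv/= andbT. Qed.

Section BranchingIntegral.
Context {R : realType} (pi : {measure set R -> \bar R}).
Local Notation D := [set z : R | 0 < z].
Hypothesis hpi : (\int[pi]_(z in D) ((Num.min z (z ^+ 2))%R)%:E < +oo)%E.

Let mD : measurable D. Proof. by rewrite set_gtE; exact: measurable_itv. Qed.

Let kmin (z : R) : R := Num.min z (z ^+ 2).

Let ckmin : continuous kmin.
Proof.
move=> z; have : {for z, continuous ((fun z : R => z) \min (fun z : R => z ^+ 2))}.
  by apply: continuous_min; [exact: cvg_id|exact: exprn_continuous].
by [].
Qed.

Let mkmin : measurable_fun setT kmin.
Proof. exact: continuous_measurable_fun. Qed.

Let kmin_ge0 (z : R) : 0 < z -> 0 <= kmin z.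
Proof. by move=> z0; rewrite /kmin le_min sqr_ge0 ltW. Qed.

Let kmin_homo (y z : R) : 0 < y -> y <= z -> kmin y <= kmin z.
Proof.
move=> y0 yz; rewrite /kmin le_min !ge_min yz/=; apply/orP; right.
by rewrite ler_sqr// nnegrE ltW//; exact: lt_le_trans yz.
Qed.

Let ikmin : pi.-integrable D (EFin \o kmin).
Proof.
apply/integrableP; split.
  by apply/measurable_EFinP; exact: measurable_funTS.
under eq_integral => z /[!inE] z0.
  rewrite /= ger0_norm; last exact: kmin_ge0.
  over.
exact: hpi.
Qed.

Let mpos a : measurable [set z : R | a < z].
Proof. by rewrite set_gtE; exact: measurable_itv. Qed.

Lemma levy_tail_lty (u : R) : 0 < u -> (pi [set z : R | (u < z)%R] < +oo)%E.
Proof.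
move=> u0; have ku : 0 < kmin u by rewrite /kmin lt_min u0 exprn_gt0.
have h : ((kmin u)%:E * pi [set z : R | (u < z)%R] < +oo)%E.
  apply: le_lt_trans hpi.
  rewrite -integral_cst//; apply: (@le_trans _ _ (\int[pi]_(z in [set z : R | (u < z)%R]) (kmin z)%:E)%E).
    apply: ge0_le_integral => //.
    - by move=> z _; rewrite lee_fin ltW.
    - by apply/measurable_EFinP; exact: measurable_funTS.
    - by move=> z /= uz; rewrite lee_fin; apply: kmin_homo => //; exact: ltW.
  apply: ge0_subset_integral => //.
  - by apply/measurable_EFinP; exact: measurable_funTS.
  - by move=> z /=; exact: lt_trans.
rewrite ltey; apply/eqP => piy; move: h; rewrite piy gt0_muley ?lte_fin//.
Qed.

Definition branching_int (q : R) : R := (\int[pi]_(u in D) expm1_rem (q * u))%R.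

Let rem_le (q z : R) : 0 <= q -> 0 < z -> expm1_rem (q * z) <= (q + q ^+ 2) * kmin z.
Proof.
move=> q0 z0; have qz : 0 <= q * z by rewrite mulr_ge0// ltW.
have h1 := expm1_rem_le_id qz; have h2 := expm1_rem_le_sqr qz.
rewrite /kmin; case: (leP z (z ^+ 2)) => _.
  by apply: le_trans h1 _; apply: ler_wpM2r; [exact: ltW|rewrite lerDl sqr_ge0].
by apply: le_trans h2 _; rewrite exprMn; apply: ler_wpM2r; [exact: sqr_ge0|rewrite lerDr].
Qed.

Let crem (q : R) : continuous (fun z : R => expm1_rem (q * z)).
Proof.
move=> z; apply: continuous_comp; last exact: continuous_expm1_rem.
by apply: cvgMl_tmp; exact: cvg_id.
Qed.

Let mrem (q : R) (E : set R) : measurable_fun E (fun z : R => expm1_rem (q * z)).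
Proof.
by apply: measurable_funTS; apply: continuous_measurable_fun; exact: crem.
Qed.

Let irem (q : R) : 0 <= q -> pi.-integrable D (EFin \o (fun z : R => expm1_rem (q * z))).
Proof.
move=> q0; apply: (@le_integrable _ _ _ pi D _ _ (fun z => (q + q ^+ 2)%:E * (kmin z)%:E)%E) => //.
- by apply/measurable_EFinP; exact: mrem.
- move=> z z0; rewrite /= ger0_norm ?expm1_rem_ge0// lee_fin ger0_norm; first exact: rem_le.
  by rewrite mulr_ge0// ?addr_ge0 ?sqr_ge0//; exact: kmin_ge0.
- exact: integrableZl.
Qed.

Let branching_intE (q : R) : 0 <= q ->
  (\int[pi]_(u in D) (expm1_rem (q * u))%:E)%E = (branching_int q)%:E.
Proof. by move=> q0; rewrite fineK//; apply: integrable_fin_num => //; exact: irem. Qed.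

Lemma branching_int_continuous (q : R) : 0 < q -> {for q, continuous branching_int}.
Proof.
move=> q0; have := @continuity_under_integral R _ _ pi (fun q z : R => expm1_rem (q * z)) D mD 0 (q + 1).
move=> /(_ _ _ (fun z => (q + 1 + (q + 1) ^+ 2) * kmin z)); apply.
- move=> p /=; rewrite in_itv/= => /andP[p0 _]; apply: irem; exact: ltW.
- apply: aeW => z _ p _.
  have : {for p, continuous (fun p : R => expm1_rem (p * z))}.
    apply: continuous_comp; last exact: continuous_expm1_rem.
    by apply: cvgMr_tmp; exact: cvg_id.
  by [].
- exact: (integrableZl mD (q + 1 + (q + 1) ^+ 2) ikmin).
- move=> p /=; rewrite in_itv/= => /andP[p0 pq]; apply: aeW => z z0.
  rewrite ger0_norm ?expm1_rem_ge0//; apply: le_trans (rem_le (ltW p0) z0) _.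
  apply: ler_wpM2r; first exact: kmin_ge0.
  by apply: lerD; [exact: ltW|rewrite ler_sqr ?nnegrE; lra].
by rewrite inE/= in_itv/=; lra.
Qed.

Lemma branching_int_ge_tail (q u : R) : 0 < q -> 0 < u ->
  expm1_rem (q * u) * fine (pi [set z : R | u < z]) <= branching_int q.
Proof.
move=> q0 u0; rewrite -lee_fin -(branching_intE (ltW q0)).
rewrite EFinM fineK; last by rewrite ge0_fin_numE// levy_tail_lty.
rewrite -integral_cst//.
apply: (@le_trans _ _ (\int[pi]_(z in [set z : R | (u < z)%R]) (expm1_rem (q * z))%:E)%E).
  apply: ge0_le_integral => //.
  - by move=> z _; rewrite lee_fin expm1_rem_ge0.
  - by apply/measurable_EFinP; exact: mrem.
  - move=> z /= uz; rewrite lee_fin; apply: expm1_rem_homo.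
      by rewrite mulr_ge0// ltW.
    by rewrite ler_wpM2l// ltW.
apply: ge0_subset_integral => //.
- by apply/measurable_EFinP; exact: mrem.
- by move=> z z0; rewrite lee_fin expm1_rem_ge0.
- by move=> z /=; exact: lt_trans.
Qed.

(** The integral at [lam * q] is the one at [q] against the image of [pi] under multiplication by
    [lam], whose tail at [y] is that of [pi] at [y / lam]; above [w] the tails compare with factor
    [C]. Jumps up to [a = w / lam] contribute [O(q^2)], because there [z^2] is at most [1 + a] times
    the weight; this is [K]. *)
Lemma branching_int_scale (lam C w : R) : 0 < lam -> 0 <= C -> 0 < w ->
  (forall y, w <= y -> fine (pi [set z : R | y / lam < z]) <= C * fine (pi [set z : R | y < z])) ->
  exists K, forall q, 0 < q -> branching_int (lam * q) <= C * branching_int q + K * q ^+ 2.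
Proof.
move=> lam0 C0 w0 hC.
pose a := w / lam; have a0 : 0 < a by rewrite divr_gt0.
pose M1 := (\int[pi]_(z in D) kmin z)%R.
exists (lam ^+ 2 * (1 + a) * M1) => q q0.
have lq : 0 <= lam * q by rewrite mulr_ge0// ltW.
have mDa : measurable [set z : R | (0 < z <= a)%R].
  have -> : [set z : R | (0 < z <= a)%R] = `]0, a]%classic by apply/seteqP; split => z; rewrite /= in_itv.
  exact: measurable_itv.
rewrite -lee_fin -(branching_intE lq) EFinD EFinM -(branching_intE (ltW q0)).
have DE : D = [set z : R | (0 < z <= a)%R] `|` [set z | a < z].
  apply/seteqP; split => z /=; last by move=> [/andP[]//|]; exact: lt_trans.
  by move=> z0; case: (leP z a) => za; [left; rewrite z0|right].
have small : (\int[pi]_(z in [set z : R | (0 < z <= a)%R]) (expm1_rem (lam * q * z))%:E <=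
    (lam ^+ 2 * (1 + a) * M1 * q ^+ 2)%:E)%E.
  have -> : lam ^+ 2 * (1 + a) * M1 * q ^+ 2 = (lam * q) ^+ 2 * (1 + a) * M1.
    by rewrite exprMn; ring.
  have c0 : 0 <= (lam * q) ^+ 2 * (1 + a) by rewrite mulr_ge0 ?sqr_ge0//; lra.
  rewrite EFinM /M1 fineK; last exact: integrable_fin_num.
  rewrite -ge0_integralZl//; last by apply/measurable_EFinP; exact: measurable_funTS.
  apply: (@le_trans _ _ (\int[pi]_(z in [set z : R | (0 < z <= a)%R])
      (((lam * q) ^+ 2 * (1 + a))%:E * (kmin z)%:E))%E); last first.
    apply: ge0_subset_integral => //.
    - by apply: measurable_funeM; apply/measurable_EFinP; exact: measurable_funTS.
    - by move=> z z0; rewrite mule_ge0// lee_fin; exact: kmin_ge0.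
    - by move=> z /= /andP[].
  apply: ge0_le_integral => //.
  - by move=> z _; rewrite lee_fin expm1_rem_ge0.
  - by apply/measurable_EFinP; exact: mrem.
  - by apply: measurable_funeM; apply/measurable_EFinP; exact: measurable_funTS.
  move=> z /= /andP[z0 za]; rewrite -EFinM lee_fin.
  apply: le_trans (expm1_rem_le_sqr _) _; first by rewrite mulr_ge0// ltW.
  rewrite exprMn -[leRHS]mulrA; apply: ler_wpM2l; first exact: sqr_ge0.
  rewrite /kmin; case: (leP z (z ^+ 2)) => _.
    by rewrite expr2 ler_wpM2r//; lra.
  by rewrite ler_peMl ?sqr_ge0//; lra.
have big : (\int[pi]_(z in [set z : R | (a < z)%R]) (expm1_rem (lam * q * z))%:E <=
    C%:E * \int[pi]_(z in D) (expm1_rem (q * z))%:E)%E.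
  (* [expm1_rem] decreases on the negative half-line; the cut at [0] makes the integrand
     nondecreasing everywhere. *)
  pose f (z : R) := expm1_rem (q * Num.max z 0).
  have mm (z : R) : 0 <= Num.max z 0 by rewrite le_max lexx orbT.
  have cf : continuous (fun z : R => expm1_rem (q * Num.max z 0)).
    move=> z; apply: (@continuous_comp _ _ _ (fun z : R => q * Num.max z 0) expm1_rem); last exact: continuous_expm1_rem.
    by apply: cvgMl_tmp; apply: continuous_max; [exact: cvg_id|exact: cvg_cst].
  have ndf : nondecreasing_fun f.
    move=> x y xy; apply: expm1_rem_homo; first by rewrite mulr_ge0// ltW.
    by apply: ler_wpM2l; [exact: ltW|rewrite ge_max !le_max xy lexx orbT].
  have f0 z : 0 <= f z by exact: expm1_rem_ge0.
  have mf (E : set R) : measurable_fun E (EFin \o f).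
    by apply/measurable_EFinP/measurable_funTS; exact: continuous_measurable_fun.
  pose phi (z : R) := lam * z.
  have mphi : measurable_fun setT phi by apply: measurable_funM => //; exact: measurable_cst.
  have C0' : (0 <= C)%R by [].
  pose m0 : {measure set R -> \bar R} := @pushforward _ _ _ _ R pi phi.
  pose m1 := m0 mphi.
  pose m2 : {measure set R -> \bar R} := mscale (NngNum C0) pi.
  have phiE y : phi @^-1` `]y, +oo[ = [set z | y / lam < z].
    by apply/seteqP; split => z; rewrite /phi/= in_itv/= andbT ltr_pdivrMr// mulrC.
  have wa : w / lam = a by [].
  have := @tail_domination R m1 m2 w f cf ndf f0.
  have -> : (\int[m1]_(x in `]w, +oo[) (f x)%:E = \int[pi]_(z in [set z : R | (a < z)%R]) (expm1_rem (lam * q * z))%:E)%E.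
    rewrite ge0_integral_pushforward//; last by move=> z _; rewrite lee_fin.
    rewrite phiE wa; apply: eq_integral => z /[!inE] /= az.
    rewrite /f /phi max_l; first by rewrite mulrA [q * lam]mulrC.
    by rewrite mulr_ge0// ltW//; exact: lt_trans az.
  have -> : (\int[m2]_(x in `]w, +oo[) (f x)%:E = C%:E * \int[pi]_(x in `]w, +oo[) (f x)%:E)%E.
    by rewrite ge0_integral_mscale// => z _; rewrite lee_fin.
  move=> h; apply: le_trans (h _ _) _.
  - rewrite /m2 /= /mscale/= -set_gtE -[pi _]fineK ?ltry//.
    by rewrite ge0_fin_numE// levy_tail_lty.
  - move=> y wy; rewrite /m1 /m2/= /mscale/= /pushforward phiE -set_gtE.
    have y0 : 0 < y by exact: lt_le_trans wy.
    have fin1 : pi [set z : R | (y / lam < z)%R] \is a fin_num.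
      by rewrite ge0_fin_numE// levy_tail_lty// divr_gt0.
    have fin2 : pi [set z : R | (y < z)%R] \is a fin_num.
      by rewrite ge0_fin_numE// levy_tail_lty.
    by rewrite -(fineK fin1) -(fineK fin2) -EFinM lee_fin; exact: hC.
  apply: lee_wpmul2l => //; rewrite -set_gtE.
  have -> : (\int[pi]_(x in [set z : R | (w < z)%R]) (f x)%:E = \int[pi]_(x in [set z : R | (w < z)%R]) (expm1_rem (q * x))%:E)%E.
    apply: eq_integral => z /[!inE] /= wz.
    by rewrite /f max_l// ltW//; exact: lt_trans wz.
  apply: ge0_subset_integral => //.
  - by apply/measurable_EFinP; exact: mrem.
  - by move=> z z0; rewrite lee_fin expm1_rem_ge0.
  - by move=> z /=; exact: lt_trans.
rewrite [X in (\int[_]_(_ in X) _ <= _)%E]DE ge0_integral_setU//.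
- by rewrite addeC; apply: leeD.
- by apply/measurable_EFinP; exact: mrem.
- by move=> z _; rewrite lee_fin expm1_rem_ge0.
- by apply/disj_setPS => z /= [/andP[_ za]]; rewrite ltNge za.
Qed.

End BranchingIntegral.

(** * The immigration mechanism *)

Section ImmigrationIntegral.
Context {R : realType} (nu : {measure set R -> \bar R}).
Local Notation D := [set z : R | 0 < z].
Hypothesis hnu : (\int[nu]_(z in D) ((Num.min 1 z)%R)%:E < +oo)%E.

Let mD : measurable D. Proof. by rewrite set_gtE; exact: measurable_itv. Qed.

Let kmin (z : R) : R := Num.min 1 z.

Let mkmin : measurable_fun setT kmin.
Proof.
apply: continuous_measurable_fun => z.
have : {for z, continuous ((fun z : R => 1 : R) \min (fun z : R => z))}.
  by apply: continuous_min; [exact: cvg_cst|exact: cvg_id].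
by [].
Qed.

Let kmin_ge0 (z : R) : 0 < z -> 0 <= kmin z.
Proof. by move=> z0; rewrite /kmin le_min ler01 ltW. Qed.

Let ikmin : nu.-integrable D (EFin \o kmin).
Proof.
apply/integrableP; split.
  by apply/measurable_EFinP; exact: measurable_funTS.
under eq_integral => z /[!inE] z0.
  rewrite /= ger0_norm; last exact: kmin_ge0.
  over.
exact: hnu.
Qed.

Definition immigration_int (q : R) : R := (\int[nu]_(u in D) (1 - expR (- (q * u))))%R.

Let e_ge0 (q z : R) : 0 <= q -> 0 < z -> 0 <= 1 - expR (- (q * z)).
Proof.
by move=> q0 z0; rewrite subr_ge0 -[leRHS]expR0 ler_expR oppr_le0 mulr_ge0// ltW.
Qed.

Let e_le (q z : R) : 0 <= q -> 0 < z -> 1 - expR (- (q * z)) <= (1 + q) * kmin z.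
Proof.
move=> q0 z0; have e0 := expR_ge0 (- (q * z)); have e1 := expR_ge1Dx (- (q * z)).
have qz : 0 <= q * z by rewrite mulr_ge0// ltW.
by rewrite /kmin; case: (leP 1 z) => _; lra.
Qed.

Let ce (q : R) : continuous (fun z : R => 1 - expR (- (q * z))).
Proof.
move=> z; apply: cvgB; first exact: cvg_cst.
apply: (@continuous_comp _ _ _ (fun z : R => - (q * z)) expR); last exact: continuous_expR.
by apply: cvgN; apply: cvgMl_tmp; exact: cvg_id.
Qed.

Let ie (q : R) : 0 <= q -> nu.-integrable D (EFin \o (fun z : R => 1 - expR (- (q * z)))).
Proof.
move=> q0; apply: (@le_integrable _ _ _ nu D _ _ (fun z => (1 + q)%:E * (kmin z)%:E)%E) => //.
- by apply/measurable_EFinP/measurable_funTS; apply: continuous_measurable_fun; exact: ce.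
- move=> z z0; rewrite /= ger0_norm; last exact: e_ge0.
  rewrite lee_fin ger0_norm; first exact: e_le.
  by rewrite mulr_ge0// ?addr_ge0//; exact: kmin_ge0.
- exact: integrableZl.
Qed.

Lemma immigration_int_homo (p q : R) : 0 <= p -> p <= q ->
  immigration_int p <= immigration_int q.
Proof.
move=> p0 pq; apply: le_Rintegral => //; [exact: ie|apply: ie; exact: le_trans pq|].
by move=> z z0; rewrite lerD2l lerN2 ler_expR lerN2 ler_wpM2r// ltW.
Qed.

Lemma immigration_int_continuous (q : R) : 0 < q -> {for q, continuous immigration_int}.
Proof.
move=> q0; have := @continuity_under_integral R _ _ nu (fun q z : R => 1 - expR (- (q * z))) D mD 0 (q + 1).
move=> /(_ _ _ (fun z => (1 + (q + 1)) * kmin z)); apply.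
- move=> p /=; rewrite in_itv/= => /andP[p0 _]; apply: ie; exact: ltW.
- apply: aeW => z _ p _.
  have : {for p, continuous (fun p : R => 1 - expR (- (p * z)))}.
    apply: cvgB; first exact: cvg_cst.
    apply: (@continuous_comp _ _ _ (fun p : R => - (p * z)) expR); last exact: continuous_expR.
    by apply: cvgN; apply: cvgMr_tmp; exact: cvg_id.
  by [].
- exact: (integrableZl mD (1 + (q + 1)) ikmin).
- move=> p /=; rewrite in_itv/= => /andP[p0 pq]; apply: aeW => z z0.
  rewrite ger0_norm; last by apply: e_ge0 => //; exact: ltW.
  apply: le_trans (e_le (ltW p0) z0) _.
  by apply: ler_wpM2r; [exact: kmin_ge0|lra].
by rewrite inE/= in_itv/=; lra.
Qed.

Lemma immigration_homo (beta p q : R) : 0 <= beta -> 0 <= p -> p <= q -> Phi beta nu p <= Phi beta nu q.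
Proof.
move=> b0 p0 pq; apply: lerD; first exact: ler_wpM2l.
exact: immigration_int_homo.
Qed.

Lemma immigration_continuous (beta q : R) : 0 < q -> {for q, continuous (Phi beta nu)}.
Proof.
move=> q0; apply: cvgD; last exact: immigration_int_continuous.
by apply: cvgMl_tmp; exact: cvg_id.
Qed.

End ImmigrationIntegral.

(** * Regular variation at infinity *)

Section RegularVariation.
Context {R : realType}.
Implicit Types f l : R -> R.

Definition regvar f r :=
  forall c : R, 0 < c -> f (c * x) / f x @[x --> +oo] --> c `^ r.

Lemma near_pinfty_scale (P : R -> Prop) (c : R) : 0 < c ->
  (\forall x \near +oo, P x) -> \forall x \near +oo, P (c * x).
Proof.
move=> c0 [M [Mr MP]]; exists (M / c); split; first exact: num_real.
by move=> x Mx; apply: MP; rewrite mulrC -ltr_pdivrMr.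
Qed.

Lemma near_at_right_inv (P : R -> Prop) :
  (\forall x \near +oo, P x) -> \forall q \near 0^'+, P q^-1.
Proof.
move=> [M [Mr MP]]; near=> q; apply: MP.
have q0 : 0 < q by near: q; exact: nbhs_right_gt.
have M1 : 0 < `|M| + 1 by rewrite ltr_wpDl.
have qM : q < (`|M| + 1)^-1 by near: q; apply: nbhs_right_lt; rewrite invr_gt0.
apply: (@lt_trans _ _ (`|M| + 1)); first by have := ler_norm M; lra.
by rewrite -[ltLHS]invrK ltf_pV2// posrE invr_gt0.
Unshelve. all: by end_near.
Qed.

Lemma near_at_right_scale (P : R -> Prop) (c : R) : 0 < c ->
  (\forall q \near 0^'+, P q) -> \forall q \near 0^'+, P (c * q).
Proof.
move=> c0 [e /= e0 he]; exists (e / c) => /=; first exact: divr_gt0.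
move=> q /=; rewrite sub0r normrN => qe q0; apply: he => /=.
  by rewrite sub0r normrN normrM (gtr0_norm c0) mulrC -ltr_pdivlMr.
exact: mulr_gt0.
Qed.

(** Division by zero returns [0], so a ratio tending to [1] already forces [f u], its equivalent,
    and hence [k], to be nonzero. The constant [k] then cancels in the quotient. *)
Lemma regvar_equiv f l (k a : R) : slowly_varying l ->
  f u / (k * u `^ a * l u) @[u --> +oo] --> (1 : R) -> regvar f a.
Proof.
move=> [l0 hl] hf c c0.
pose rho u := k * u `^ a * l u.
have half : \forall u \near +oo, 2^-1 < f u / rho u.
  by move/cvgr_gt : hf; apply; lra.
have : ((f (c * u) / rho (c * u)) * (c `^ a * (l (c * u) / l u)) / (f u / rho u)) @[u --> +oo] -->
   (1 * (c `^ a * 1) / 1).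
  apply: cvgM; last by apply: cvgV => //; exact: oner_neq0.
  apply: cvgM; last by apply: cvgMl_tmp; exact: hl.
  move/cvgrPdist_lt : hf => hf; apply/cvgrPdist_lt => e e0.
  exact: near_pinfty_scale (hf e e0).
rewrite mul1r !mulr1 invr1 mulr1; apply: cvg_trans; apply: near_eq_cvg.
near=> u.
have u0 : 0 < u by near: u; apply: nbhs_pinfty_gt; exact: num_real.
have h1 : 2^-1 < f u / rho u by near: u.
have h2 : 2^-1 < f (c * u) / rho (c * u).
  by near: u; exact: near_pinfty_scale half.
have lu : 0 < l u by near: u.
have rho0 : rho u != 0.
  by apply/eqP => r0; move: h1; rewrite r0 invr0 mulr0; lra.
have rho1 : rho (c * u) != 0.
  by apply/eqP => r0; move: h2; rewrite r0 invr0 mulr0; lra.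
have f0 : f u != 0.
  by apply/eqP => r0; move: h1; rewrite r0 mul0r; lra.
have -> : c `^ a * (l (c * u) / l u) = rho (c * u) / rho u.
  have k0 : k != 0 by apply/eqP => k0; move: rho0; rewrite /rho k0 !mul0r eqxx.
  have ua : u `^ a != 0 by rewrite gt_eqF// powR_gt0.
  rewrite /rho powRM ?ltW//; field.
  by rewrite ua k0 gt_eqF.
by field; rewrite f0 rho0 rho1.
Unshelve. all: by end_near.
Qed.

(** Halving brings every [y >= y0] back to the fundamental interval [[y0, 2 * y0]], and each
    doubling multiplies [f] by at least [b], so the growth is geometric. *)
Lemma doubling_cvgy f (y0 m b : R) : 0 < y0 -> 0 < m -> 1 < b ->
  (forall y, y0 <= y -> b * f y <= f (2 * y)) ->
  (forall y, y0 <= y <= 2 * y0 -> m <= f y) -> f y @[y --> +oo] --> +oo.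
Proof.
move=> y00 m0 b1 hb hm.
have base y : y0 <= y -> m <= f y.
  move=> y0y; have [n yn] : exists n, y <= 2 ^+ n * (2 * y0).
    exists (Num.truncn (y / y0)).+1.
    apply: (@le_trans _ _ ((Num.truncn (y / y0)).+1%:R * y0)).
      by rewrite -ler_pdivrMr// ltW// truncnS_gt.
    rewrite mulrA; apply: ler_wpM2r; first exact: ltW.
    set k := _.+1; have : (k%:R : R) <= 2 ^+ k by rewrite -natrX ler_nat ltnW// ltn_expl.
    have : 0 < (2 : R) ^+ k by rewrite exprn_gt0.
    lra.
  elim: n y y0y yn => [|n IH] y y0y yn; first by apply: hm; rewrite y0y -[leRHS]mul1r -(expr0 2).
  have [y2|y2] := leP y (2 * y0); first by apply: hm; rewrite y0y.
  have -> : y = 2 * (y / 2) by lra.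
  have h2 : y0 <= y / 2 by lra.
  have := IH (y / 2) h2; have := hb _ h2; rewrite exprS in yn.
  have {}yn : y / 2 <= 2 ^+ n * (2 * y0) by lra.
  by move=> k1 /(_ yn); nra.
have pow n y : 2 ^+ n * y0 <= y -> b ^+ n * m <= f y.
  elim: n y => [|n IH] y; first by rewrite !expr0 !mul1r; exact: base.
  rewrite exprS => h; have h2 : 2 ^+ n * y0 <= y / 2 by lra.
  have h3 : y0 <= y / 2.
    apply: le_trans h2; rewrite -[leLHS]mul1r; apply: ler_wpM2r; first exact: ltW.
    by rewrite exprn_ege1// ler1n.
  have -> : y = 2 * (y / 2) by lra.
  apply: le_trans (hb _ h3); rewrite exprS -mulrA ler_pM2l; last lra.
  exact: IH.
apply/cvgryPge => A.
have [n hn] : exists n, A <= b ^+ n * m.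
  have bm : 0 < m * (b - 1) by apply: mulr_gt0 => //; lra.
  exists (Num.truncn (`|A| / (m * (b - 1)))).+1; set k := _.+1.
  have : `|A| / (m * (b - 1)) < k%:R by exact: truncnS_gt.
  rewrite ltr_pdivrMr// => h.
  have b0 : 0 <= b - 1 by lra.
  have := @bernoulli_ge R (b - 1) k b0; have -> : 1 + (b - 1) = b by lra.
  move=> /(ler_wpM2r (ltW m0)) h2.
  have := ler_norm A; lra.
near=> y; apply: le_trans hn _; apply: pow.
by near: y; apply: nbhs_pinfty_ge; exact: num_real.
Unshelve. all: by end_near.
Qed.

End RegularVariation.

(** * Regular variation of the branching mechanism at 0 *)

Section BranchingMechanism.
Context {R : realType} (sigma alpha : R) (pi : {measure set R -> \bar R}).
Hypothesis hpi : (\int[pi]_(z in [set z : R | (0 < z)%R]) ((Num.min z (z ^+ 2))%R)%:E < +oo)%E.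
Local Notation tail := (fun u : R => fine (pi [set z : R | u < z])).
Hypothesis alpha01 : 0 < alpha < 1.
Hypothesis tail_rv : regvar tail (-1 - alpha).
Hypothesis tail_gt0 : \forall u \near +oo, 0 < tail u.

Local Notation Psi0 := (Psi 0 sigma pi).
Local Notation W := (branching_int pi).

Let PsiE q : Psi0 q = sigma ^+ 2 / 2 * q ^+ 2 + W q.
Proof. by rewrite /Psi mul0r add0r mulrAC. Qed.

Lemma levy_tail_antimono (u v : R) : 0 < u -> u <= v -> tail v <= tail u.
Proof.
move=> u0 uv; have v0 : 0 < v by exact: lt_le_trans uv.
have [fu fv] : pi [set z : R | (u < z)%R] \is a fin_num /\ pi [set z : R | (v < z)%R] \is a fin_num.
  by rewrite !ge0_fin_numE ?levy_tail_lty.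
apply: fine_le => //; apply: le_measure; rewrite ?inE ?set_gtE; try exact: measurable_itv.
by rewrite -!set_gtE => z /=; exact: le_lt_trans.
Qed.

Lemma branching_gt0 q : 0 < q -> 0 < Psi0 q.
Proof.
move=> q0; rewrite PsiE ltr_wpDl//.
  by rewrite mulr_ge0 ?sqr_ge0// divr_ge0 ?sqr_ge0.
have [u [u0 tu]] : exists u, 0 < u /\ 0 < tail u.
  have [u [h1 h2]] := filter_ex (filterI (nbhs_pinfty_gt (num_real (0 : R))) tail_gt0).
  by exists u.
apply: lt_le_trans (branching_int_ge_tail hpi q0 u0).
by rewrite mulr_gt0// expm1_rem_gt0// mulr_gt0.
Qed.

Lemma branching_continuous q : 0 < q -> {for q, continuous Psi0}.
Proof.
move=> q0; apply: cvgD; last exact: branching_int_continuous.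
apply: cvgD; first by apply: cvgMl_tmp; exact: cvg_id.
by apply: cvgMr_tmp; apply: cvgMl_tmp; exact: exprn_continuous.
Qed.

(** The tail estimate at level [1 / q] bounds [Psi q] below by a constant times [tail q^-1], so it
    suffices that [y^2 * tail y] tends to infinity. It does because [alpha < 1] puts the index
    [-1 - alpha] of the tail above [-2]. *)
Lemma branching_dominates_sqr (K : R) : \forall q \near 0^'+, K * q ^+ 2 <= Psi0 q.
Proof.
have [a0 a1] := andP alpha01.
pose b : R := (1 + 2 `^ (1 - alpha)) / 2.
have b1 : 1 < b.
  have : 1 < 2 `^ (1 - alpha) :> R.
    have r0 : 0 < 1 - alpha by lra.
    have := @gt0_ltr_powR R _ r0 1 2; rewrite powR1 !nnegrE => h.
    by apply: h; lra.
  by rewrite /b; lra.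
have tail2 : \forall u \near +oo, b * (u ^+ 2 * tail u) <= (2 * u) ^+ 2 * tail (2 * u).
  have := @tail_rv 2 (ltr0Sn _ _).
  have : b / 4 < 2 `^ (-1 - alpha).
    have -> : 2 `^ (-1 - alpha) = 2 `^ (1 - alpha) / 4 :> R.
      have -> : 1 - alpha = (-1 - alpha) + 2%:R by lra.
      rewrite [in RHS]powRD; last by rewrite pnatr_eq0 implybT.
      by rewrite powR_mulrn//; lra.
    by move: b1; rewrite /b; lra.
  move=> h1 /(cvgr_gt _)/(_ _ h1) h2.
  near=> u; have tu : 0 < tail u by near: u.
  have : b / 4 < tail (2 * u) / tail u by near: u.
  rewrite ltr_pdivlMr// => h3.
  have u2 : 0 <= u ^+ 2 by exact: sqr_ge0.
  by rewrite exprMn; nra.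
have [M [Mr hM]] : \forall u \near +oo, 0 < tail u /\ b * (u ^+ 2 * tail u) <= (2 * u) ^+ 2 * tail (2 * u).
  exact: filterI.
pose y0 := `|M| + 1.
have y00 : 0 < y0 by rewrite ltr_wpDl.
have My0 : M < y0 by rewrite /y0; have := ler_norm M; lra.
have y02 : 0 < 2 * y0 by lra.
have t2 : 0 < tail (2 * y0) by have [] := hM (2 * y0) ltac:(lra).
have m0 : 0 < y0 ^+ 2 * tail (2 * y0) by rewrite mulr_gt0// exprn_gt0.
have div : y ^+ 2 * tail y @[y --> +oo] --> +oo.
  apply: (doubling_cvgy y00 m0 b1) => y.
    by move=> y0y; have [] := hM y ltac:(lra).
  move=> /andP[k1 k2]; apply: ler_pM; [exact: sqr_ge0|exact: ltW|..].
    by rewrite ler_sqr ?nnegrE; lra.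
  by apply: levy_tail_antimono => //; lra.
have k1 : 0 < expm1_rem (1 : R) by exact: expm1_rem_gt0.
have near_div := near_at_right_inv ((cvgryPge _).1 div (K / expm1_rem 1)).
near=> q; have hq : K / expm1_rem 1 <= q^-1 ^+ 2 * tail q^-1 by near: q; exact: near_div.
have q0 : 0 < q by near: q; exact: nbhs_right_gt.
have qi : 0 < q^-1 by rewrite invr_gt0.
apply: le_trans (_ : W q <= _); last first.
  by rewrite PsiE lerDr mulr_ge0 ?sqr_ge0// divr_ge0 ?sqr_ge0.
apply: le_trans (branching_int_ge_tail hpi q0 qi).
rewrite divff ?gt_eqF//.
have q2 : 0 < q ^+ 2 by rewrite exprn_gt0.
move: hq; rewrite ler_pdivrMr// exprVn => hq.
have := ler_wpM2r (ltW q2) hq.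
have -> : q ^- 2 * tail q^-1 * expm1_rem 1 * q ^+ 2 = expm1_rem 1 * tail q^-1.
  by field; rewrite gt_eqF.
by [].
Unshelve. all: by end_near.
Qed.

(** Half of [e] absorbs the deviation of the tail ratio from its limit. The other half absorbs the
    quadratic terms of the Gaussian part and of the small jumps, whose coefficients add up in the
    constant given to [branching_dominates_sqr]. *)
Lemma branching_scale_le (lam e : R) : 0 < lam -> 0 < e ->
  \forall q \near 0^'+, Psi0 (lam * q) <= (lam `^ (1 + alpha) + e) * Psi0 q.
Proof.
move=> lam0 e0.
pose C := lam `^ (1 + alpha) + e / 2.
have C0 : 0 <= C by rewrite addr_ge0 ?powR_ge0//; lra.
have [w [w0 hw]] : exists w, 0 < w /\ forall y, w <= y -> tail (y / lam) <= C * tail y.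
  have il : 0 < lam^-1 by rewrite invr_gt0.
  have := tail_rv il.
  have -> : lam^-1 `^ (-1 - alpha) = lam `^ (1 + alpha).
    rewrite -(powR_inv1 (ltW lam0)) -powRrM; congr (_ `^ _); lra.
  have lC : lam `^ (1 + alpha) < C by rewrite /C; lra.
  move=> /(cvgr_lt _)/(_ _ lC) h.
  have [M [Mr hM]] := filterI h tail_gt0.
  exists (`|M| + 1); split; first by rewrite ltr_wpDl.
  move=> y My; have /hM[] : M < y by have := ler_norm M; lra.
  by move=> h1 h2; move: h1; rewrite ltr_pdivrMr// mulrC => /ltW.
have [K hK] := branching_int_scale hpi lam0 C0 w0 hw.
have h := branching_dominates_sqr ((K + sigma ^+ 2 * lam ^+ 2 / 2) / (e / 2)).
near=> q; have q0 : 0 < q by near: q; exact: nbhs_right_gt.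
have h1 : (K + sigma ^+ 2 * lam ^+ 2 / 2) / (e / 2) * q ^+ 2 <= Psi0 q by near: q.
have h2 : (K + sigma ^+ 2 * lam ^+ 2 / 2) * q ^+ 2 <= e / 2 * Psi0 q.
  move: h1; rewrite mulrAC ler_pdivrMr; last by lra.
  by rewrite [Psi0 q * _]mulrC.
have := hK q q0; rewrite {1}PsiE exprMn => h3.
have h4 : C * W q <= C * Psi0 q.
  by apply: ler_wpM2l => //; rewrite PsiE lerDr mulr_ge0 ?sqr_ge0// divr_ge0 ?sqr_ge0.
rewrite /C in h3 h4 *; nra.
Unshelve. all: by end_near.
Qed.

(** The lower bound is the upper bound for the inverse factor [lam^-1], read at the point
    [lam * q]. *)
Lemma branching_regvar (lam : R) : 0 < lam ->
  Psi0 (lam * q) / Psi0 q @[q --> 0^'+] --> lam `^ (1 + alpha).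
Proof.
move=> lam0; apply/cvgrPdist_le => e e0.
pose A := lam `^ (1 + alpha).
have A0 : 0 < A by exact: powR_gt0.
have il : 0 < lam^-1 by rewrite invr_gt0.
have AV : lam^-1 `^ (1 + alpha) = A^-1.
  by rewrite -(powR_inv1 (ltW lam0)) -powRrM mulN1r powRN.
(* This error is chosen so that [(A - e) * (A^-1 + e / A^2) = 1 - e^2 / A^2], which is at most
   [1]. *)
have e1 : 0 < e / A ^+ 2 by rewrite divr_gt0// exprn_gt0.
have up := branching_scale_le lam0 e0.
have lo := near_at_right_scale lam0 (branching_scale_le il e1).
near=> q; have q0 : 0 < q by near: q; exact: nbhs_right_gt.
have h1 : Psi0 (lam * q) <= (A + e) * Psi0 q by near: q.
have : Psi0 (lam^-1 * (lam * q)) <= (lam^-1 `^ (1 + alpha) + e / A ^+ 2) * Psi0 (lam * q) by near: q.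
rewrite mulKf ?gt_eqF// AV => h2.
have p0 := branching_gt0 q0; have p1 : 0 < Psi0 (lam * q) by apply: branching_gt0; exact: mulr_gt0.
rewrite ler_norml -/A; apply/andP; split.
  have : Psi0 (lam * q) / Psi0 q <= A + e by rewrite ler_pdivrMr.
  lra.
suff : A - e <= Psi0 (lam * q) / Psi0 q by lra.
rewrite ler_pdivlMr//.
have [Ae|Ae] := leP (A - e) 0; first by apply: le_trans (ltW p1); rewrite mulr_le0_ge0// ltW.
apply: (@le_trans _ _ ((A - e) * ((A^-1 + e / A ^+ 2) * Psi0 (lam * q)))).
  by apply: ler_wpM2l => //; exact: ltW.
rewrite mulrA -[leRHS]mul1r; apply: ler_wpM2r; first exact: ltW.
have -> : (A - e) * (A^-1 + e / A ^+ 2) = 1 - e ^+ 2 / A ^+ 2 by field; rewrite gt_eqF.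
by rewrite gerBl divr_ge0// sqr_ge0.
Unshelve. all: by end_near.
Qed.

End BranchingMechanism.

Lemma mvt_closed (R : realType) (f df : R -> R) (a b : R) : a <= b ->
  (forall x, a <= x <= b -> is_derive x (1 : R) f (df x)) ->
  exists2 c, a <= c <= b & f b - f a = df c * (b - a).
Proof.
move=> ab hf.
have [||c cab ->] := @MVT_segment R f df a b ab.
- by move=> x; rewrite in_itv/= => /andP[h1 h2]; apply: hf; rewrite !ltW.
- by apply: derivable_within_continuous => x; rewrite in_itv/= => /hf[].
by exists c => //; move: cab; rewrite in_itv.
Qed.

(** * Clock and flow *)

Section Integ.
Context {R : realType} (F : R -> R).
Hypothesis cF : forall q, 0 < q -> {for q, continuous F}.
Local Notation mu := (@lebesgue_measure R).

Lemma integ_integrable (a b : R) : 0 < a -> mu.-integrable `[a, b] (EFin \o F).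
Proof.
move=> a0; apply: continuous_compact_integrable; first exact: segment_compact.
apply: continuous_in_subspaceT => x /[!inE] /=; rewrite in_itv/= => /andP[ax _].
by apply: cF; exact: lt_le_trans ax.
Qed.

Lemma integ_chasles (a y b : R) : 0 < a -> a <= y <= b ->
  integ a b F = integ a y F + integ y b F.
Proof.
move=> a0 /andP[ay yb].
have y0 : 0 < y by exact: lt_le_trans ay.
have := @Rintegral_itvB R F (BLeft a) (BRight b) y (integ_integrable b a0).
rewrite !bnd_simp ay yb => /(_ isT isT).
rewrite Rintegral_itv_obnd_cbnd; last first.
  by apply: integrableS (integ_integrable b y0) => //; apply: subset_itvr; rewrite bnd_simp.
by rewrite /integ /Rintegral => <-; rewrite addrC subrK.
Qed.

Lemma integ_ge0 (a b : R) : (forall x, a <= x -> 0 <= F x) -> 0 <= integ a b F.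
Proof.
move=> F0; apply: Rintegral_ge0 => x /=; rewrite in_itv/= => /andP[ax _]; exact: F0.
Qed.

Lemma integ_derive (y b : R) : 0 < y -> y < b ->
  (* The derivative in the lower endpoint comes from the one in the upper endpoint by splitting the
     integral, with base point [y / 2] to stay away from [0]. *)
  is_derive y (1 : R) (fun z => integ z b F) (- F y).
Proof.
move=> y0 yb; pose a := y / 2.
have a0 : 0 < a by rewrite /a; lra.
have ay : a < y by rewrite /a; lra.
have [d1 d2] := @continuous_FTC1_closed R F a y b yb (integ_integrable b a0) ay (cF y0).
have dG : is_derive y (1 : R) (fun z => integ a z F) (F y).
  by apply: DeriveDef; [exact: d1|rewrite -derive1E; exact: d2].
have dH : is_derive y (1 : R) (fun z => integ a b F - integ a z F) (0 - F y).
  exact: (is_deriveB (is_derive_cst (integ a b F) y 1) dG).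
rewrite sub0r in dH; apply: near_eq_is_derive dH.
near=> z; have az : a <= z by near: z; apply: (@cvgr_ge _ _ _ _ id); [exact: cvg_id|].
have zb : z <= b by near: z; apply: (@cvgr_le _ _ _ _ id); [exact: cvg_id|].
by rewrite (@integ_chasles a z b)// ?az// addrAC subrr add0r.
Unshelve. all: by end_near.
Qed.

Lemma oint_chasles (a b c : R) : 0 < a -> 0 < b -> 0 < c -> oint a b F + oint b c F = oint a c F.
Proof.
have self x : 0 < x -> integ x x F = 0.
  by move=> x0; have := @integ_chasles x x x x0; rewrite lexx => /(_ isT); lra.
move=> a0 b0 c0; rewrite /oint.
have [ab|ab] := leP a b; have [bc|bc] := leP b c; have [ac|ac] := leP a c.
- by rewrite (@integ_chasles a b c) ?ab.
- by have := lt_le_trans ac ab; lra.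
- by rewrite (@integ_chasles a c b) ?ac ?(ltW bc)//; lra.
- by rewrite (@integ_chasles c a b) ?(ltW ac) ?ab//; lra.
- by rewrite (@integ_chasles b a c) ?(ltW ab) ?ac//; lra.
- by rewrite (@integ_chasles b c a) ?bc ?(ltW ac)//; lra.
- by have := lt_trans bc ab; lra.
- by rewrite (@integ_chasles c b a) ?(ltW bc) ?(ltW ab)//; lra.
Qed.

Lemma ointE (a b : R) : a <= b -> oint a b F = integ a b F.
Proof. by rewrite /oint => ->. Qed.

End Integ.

(** * The clock, its inverse, and the flow *)

Section Clock.
Context {R : realType} (Psi Phi : R -> R) (lam0 : R) (g : R -> R).
Hypothesis lam0_gt0 : 0 < lam0.
Hypothesis Psi_gt0 : forall q, 0 < q -> 0 < Psi q.
Hypothesis Psi00 : 0 <= Psi 0.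
Hypothesis Psi_cts : forall q, 0 < q -> {for q, continuous Psi}.
Hypothesis Phi_gt0 : forall q, 0 < q -> 0 < Phi q.
Hypothesis Phi_cts : forall q, 0 < q -> {for q, continuous Phi}.
Hypothesis Phi_homo : forall p q, 0 < p -> p <= q -> Phi p <= Phi q.
Hypothesis gE : is_g Psi lam0 g.

Local Notation phi := (phi_fun Psi lam0).
Local Notation H := (H_fun Psi Phi lam0 g).
Local Notation h := (fun x => Phi (g x)).

Let ipsi_cts (q : R) : 0 < q -> {for q, continuous (fun u => `|Psi u|^-1)}.
Proof.
move=> q0; apply: cvgV; first by rewrite normr_eq0 gt_eqF// Psi_gt0.
by apply: cvg_norm; exact: Psi_cts.
Qed.

Let ratio_cts (q : R) : 0 < q -> {for q, continuous (fun u => Phi u / `|Psi u|)}.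
Proof. by move=> q0; apply: cvgM; [exact: Phi_cts|exact: ipsi_cts]. Qed.

Lemma g_range (x : R) : 0 < x -> 0 < g x < lam0.
Proof. by move=> /gE[]. Qed.

Lemma g_gt0 (x : R) : 0 < x -> 0 < g x.
Proof. by move=> /g_range/andP[]. Qed.

Lemma phi_g (x : R) : 0 < x -> phi (g x) = x.
Proof. by move=> /gE[]. Qed.

Lemma phi_derive (y : R) : 0 < y -> y < lam0 -> is_derive y (1 : R) phi (- (Psi y)^-1).
Proof.
move=> y0 yl; rewrite -[Psi y]gtr0_norm ?Psi_gt0//.
exact: (integ_derive ipsi_cts).
Qed.

Lemma phi_decr (y z : R) : 0 < y -> y < z -> z < lam0 -> phi z < phi y.
Proof.
move=> y0 yz zl.
have [||c /andP[yc cz] e] := @mvt_closed R phi (fun y => - (Psi y)^-1) y z; first exact: ltW.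
  by move=> x /andP[yx xz]; apply: phi_derive; [exact: lt_le_trans yx|exact: le_lt_trans zl].
rewrite -subr_lt0 e nmulr_rlt0 ?subr_gt0// oppr_lt0 invr_gt0.
by apply: Psi_gt0; exact: lt_le_trans yc.
Qed.

Lemma phi_anti (y z : R) : 0 < y -> y <= z -> z < lam0 -> phi z <= phi y.
Proof.
move=> y0; rewrite le_eqVlt => /predU1P[->//|yz] zl; apply: ltW; exact: phi_decr.
Qed.

Lemma phi_gt0 (y : R) : 0 < y -> y < lam0 -> 0 < phi y.
Proof.
move=> y0 yl; pose z := (y + lam0) / 2.
have := @phi_decr y z y0; rewrite /z => /(_ ltac:(lra) ltac:(lra)).
apply: le_lt_trans; apply: integ_ge0 => x _.
by rewrite invr_ge0.
Qed.

Lemma phi_inj (y z : R) : 0 < y < lam0 -> 0 < z < lam0 -> phi y = phi z -> y = z.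
Proof.
move=> /andP[y0 yl] /andP[z0 zl] e.
have [yz|zy|//] := ltgtP y z.
- by have := phi_decr y0 yz zl; rewrite e ltxx.
- by have := phi_decr z0 zy yl; rewrite e ltxx.
Qed.

Lemma g_phi (y : R) : 0 < y -> y < lam0 -> g (phi y) = y.
Proof.
move=> y0 yl; have p0 := phi_gt0 y0 yl.
apply: phi_inj; [exact: g_range|by rewrite y0|exact: phi_g].
Qed.

Lemma g_decr (x y : R) : 0 < x -> x < y -> g y < g x.
Proof.
move=> x0 xy; have y0 : 0 < y by exact: lt_trans xy.
rewrite ltNge; apply/negP => gg.
have /andP[gx0 _] := g_range x0; have /andP[_ gyl] := g_range y0.
by have := phi_anti gx0 gg gyl; rewrite !phi_g// leNgt xy.
Qed.

Lemma g_anti (x y : R) : 0 < x -> x <= y -> g y <= g x.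
Proof.
move=> x0; rewrite le_eqVlt => /predU1P[->//|xy]; apply: ltW; exact: g_decr.
Qed.

Lemma g_cvg0 : g x @[x --> +oo] --> (0 : R).
Proof.
have l2 : lam0 / 2 < lam0 by move: lam0_gt0; lra.
apply/cvgrPdist_le => /= e e0; pose e' : R := Num.min e (lam0 / 2).
have e'0 : 0 < e' by rewrite lt_min e0/=; lra.
have e'l : e' < lam0 by rewrite gt_min l2 orbT.
have p0 := phi_gt0 e'0 e'l.
near=> x; have px : phi e' <= x by near: x; apply: nbhs_pinfty_ge; exact: num_real.
have x0 : 0 < x by exact: lt_le_trans px.
rewrite sub0r normrN gtr0_norm ?g_gt0//.
by apply: le_trans (g_anti p0 px) _; rewrite g_phi// ge_min lexx.
Unshelve. all: by end_near.
Qed.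

Lemma g_derive (x : R) : 0 < x -> is_derive x (1 : R) g (- Psi (g x)).
Proof.
move=> x0; have /andP[g0 gl] := g_range x0.
have near_in : \forall y \near g x, 0 < y < lam0.
  near=> y; apply/andP; split; near: y.
    by apply: (@cvgr_gt _ _ _ _ id); [exact: cvg_id|].
  by apply: (@cvgr_lt _ _ _ _ id); [exact: cvg_id|].
rewrite -{1}[x]phi_g// -[Psi _]invrK -invrN.
apply: (@is_derive_inverse R phi g).
- by apply: filterS near_in => y /andP[y0 yl]; exact: g_phi.
- apply: filterS near_in => y /andP[y0 yl].
  by apply/differentiable_continuous/derivable1_diffP; case: (phi_derive y0 yl).
- exact: phi_derive.
- by rewrite oppr_eq0 invr_eq0 gt_eqF// Psi_gt0.
Unshelve. all: by end_near.
Qed.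

Lemma g_cts (x : R) : 0 < x -> {for x, continuous g}.
Proof.
by move=> x0; apply/differentiable_continuous/derivable1_diffP; case: (g_derive x0).
Qed.

Lemma h_gt0 (x : R) : 0 < x -> 0 < h x.
Proof. by move=> x0; apply: Phi_gt0; exact: g_gt0. Qed.

Lemma h_anti (x y : R) : 0 < x -> x <= y -> h y <= h x.
Proof.
move=> x0 xy; apply: Phi_homo; last exact: g_anti.
by apply: g_gt0; exact: lt_le_trans xy.
Qed.

Lemma h_cts (x : R) : 0 < x -> {for x, continuous h}.
Proof.
move=> x0; apply: (@continuous_comp _ _ _ g Phi); first exact: g_cts.
by apply: Phi_cts; exact: g_gt0.
Qed.

Lemma H_derive (x : R) : 0 < x -> is_derive x (1 : R) H (h x).
Proof.
move=> x0; have /andP[g0 gl] := g_range x0.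
have d1 := integ_derive ratio_cts g0 gl.
have d2 := is_derive1_comp d1 (g_derive x0).
have e : - (Phi (g x) / `|Psi (g x)|) * - Psi (g x) = h x.
  rewrite gtr0_norm ?Psi_gt0// mulrNN divfK// gt_eqF//; exact: Psi_gt0.
rewrite e in d2; apply: near_eq_is_derive d2.
near=> y; have y0 : 0 < y by near: y; apply: (@cvgr_gt _ _ _ _ id); [exact: cvg_id|].
by rewrite /H_fun gt_eqF.
Unshelve. all: by end_near.
Qed.

Lemma derive1_H (x : R) : 0 < x -> derive1 H x = h x.
Proof. by move=> x0; rewrite derive1E; case: (H_derive x0). Qed.

Lemma H_mvt (a b : R) : 0 < a -> a <= b -> exists2 c, a <= c <= b & H b - H a = h c * (b - a).
Proof.
move=> a0 ab; apply: (@mvt_closed R H h) => // x /andP[ax _].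
by apply: H_derive; exact: lt_le_trans ax.
Qed.

Lemma H_increment_bounds (a b : R) : 0 < a -> a <= b ->
  h b * (b - a) <= H b - H a <= h a * (b - a).
Proof.
move=> a0 ab; have [c /andP[ac cb] ->] := H_mvt a0 ab.
have c0 : 0 < c by exact: lt_le_trans ac.
by apply/andP; split; apply: ler_wpM2r; rewrite ?subr_ge0//; apply: h_anti.
Qed.

Lemma H_incr (a b : R) : 0 < a -> a < b -> H a < H b.
Proof.
move=> a0 ab; have /andP[l _] := H_increment_bounds a0 (ltW ab).
rewrite -subr_gt0; apply: lt_le_trans l; rewrite mulr_gt0 ?subr_gt0//.
by apply: h_gt0; exact: lt_trans ab.
Qed.

Lemma H_cts (x : R) : 0 < x -> {for x, continuous H}.
Proof.
by move=> x0; apply/differentiable_continuous/derivable1_diffP; case: (H_derive x0).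
Qed.

Section Flow.
Variable v : R -> R -> R.
Hypothesis hv : solves_v Psi v.
Variable lam : R.
Hypothesis lam_gt0 : 0 < lam.
Hypothesis lam_lt : lam < lam0.

Let v0 : v 0 lam = lam. Proof. by have [] := hv (ltW lam_gt0). Qed.
Let v_ge0 (t : R) : 0 <= t -> 0 <= v t lam. Proof. by have [_ k _ _] := hv (ltW lam_gt0); exact: k. Qed.
Let v_der (t : R) : 0 < t -> is_derive t (1 : R) (fun s => v s lam) (- Psi (v t lam)).
Proof. by have [_ _ _] := hv (ltW lam_gt0); apply. Qed.

Let v_within (t : R) : {within `[0, t], continuous (fun s => v s lam)}.
Proof.
have [t0|t0] := leP t 0.
  have [->|tn] := eqVneq t 0.
    by rewrite set_itv1; exact: continuous_subspace1.
  rewrite set_itv_ge; first exact: continuous_subspace0.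
  by rewrite bnd_simp -ltNge lt_neqAle tn.
apply/continuous_within_itvP => //; split.
- move=> x; rewrite in_itv/= => /andP[x0 _].
  by apply/differentiable_continuous/derivable1_diffP; case: (v_der x0).
- by rewrite v0; have [_ _ k _] := hv (ltW lam_gt0).
- apply: cvg_at_left_filter.
  by apply/differentiable_continuous/derivable1_diffP; case: (v_der t0).
Qed.

Let v_anti (s t : R) : 0 <= s -> s <= t -> v t lam <= v s lam.
Proof.
move=> s0; rewrite le_eqVlt => /predU1P[->//|st].
have [c /[!in_itv]/= /andP[sc ct] e] : exists2 c, c \in `]s, t[ & v t lam - v s lam = - Psi (v c lam) * (t - s).
  apply: (@MVT R (fun s => v s lam) (fun s => - Psi (v s lam)) s t st).
    by move=> x; rewrite in_itv/= => /andP[sx _]; apply: v_der; exact: le_lt_trans sx.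
  apply: continuous_subspaceW (v_within (t := t)).
  by apply: subset_itvr; rewrite bnd_simp.
have c0 : 0 <= v c lam by apply: v_ge0; exact/ltW/(le_lt_trans s0).
have P0 : 0 <= Psi (v c lam).
  by move: c0; rewrite le_eqVlt => /predU1P[<-//|/Psi_gt0/ltW].
have : 0 <= Psi (v c lam) * (t - s) by rewrite mulr_ge0// subr_ge0 ltW.
by move: e; rewrite mulNr; lra.
Qed.

(** The clock runs at unit speed along the flow: the derivative of [phi] is [- (Psi y)^-1] and that
    of the flow is [- Psi], so their product is [1]. *)
Let phi_flow (s : R) : 0 < s -> 0 < v s lam -> phi (v s lam) = s + phi lam.
Proof.
move=> s0 vs0.
have vr (r : R) : 0 <= r -> r <= s -> 0 < v r lam < lam0.
  move=> r0 rs; rewrite (lt_le_trans vs0 (v_anti r0 rs))/=.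
  by apply: le_lt_trans lam_lt; have := v_anti (lexx 0) r0; rewrite v0.
have dp (r : R) : 0 < r -> r <= s -> is_derive r (1 : R) (phi \o (fun s => v s lam)) 1.
  move=> r0 rs; have /andP[a b] := vr r (ltW r0) rs.
  have := is_derive1_comp (phi_derive a b) (v_der r0).
  by rewrite mulrNN mulVf// gt_eqF// Psi_gt0.
have [||c _] := @MVT R (phi \o (fun s => v s lam)) (fun=> 1) 0 s s0.
- by move=> r; rewrite in_itv/= => /andP[r0 /ltW rs]; exact: dp.
- apply/continuous_within_itvP => //; split.
  + move=> r; rewrite in_itv/= => /andP[r0 /ltW rs].
    by apply/differentiable_continuous/derivable1_diffP; case: (dp r r0 rs).
  + rewrite /= v0; apply: (cvg_comp (fun s => v s lam) phi).
      by have [_ _ k _] := hv (ltW lam_gt0); exact: k.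
    by apply/differentiable_continuous/derivable1_diffP; case: (phi_derive lam_gt0 lam_lt).
  + apply: cvg_at_left_filter.
    by apply/differentiable_continuous/derivable1_diffP; case: (dp s s0 (lexx s)).
by rewrite /= v0; lra.
Qed.

Lemma flowE (t : R) : 0 <= t -> v t lam = g (t + phi lam).
Proof.
move=> t0; have pl := phi_gt0 lam_gt0 lam_lt.
have [->|tn] := eqVneq t 0; first by rewrite v0 add0r g_phi.
have {}t0 : 0 < t by rewrite lt_neqAle eq_sym tn.
(* The flow cannot hit [0]: on its way it would reach a level whose clock value exceeds the elapsed time. *)
have vt : 0 < v t lam.
  rewrite lt_neqAle v_ge0 ?ltW// andbT; apply/eqP => vt0.
  have x0 : 0 < phi lam + t + 1 by lra.
  pose y := g (phi lam + t + 1).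
  have y0 : 0 < y by exact: g_gt0.
  have yl : y < lam by rewrite -[ltRHS]g_phi//; apply: g_decr => //; lra.
  have [|s1] := @IVT R (fun s => v s lam) 0 t y (ltW t0) (@v_within t).
    by rewrite v0 -vt0 ge_min le_max (ltW y0) (ltW yl) orbT.
  rewrite in_itv/= => /andP[s10 s1t] vs1.
  have {}s10 : 0 < s1.
    rewrite lt_neqAle s10 andbT; apply/eqP => s0; move: vs1 yl.
    by rewrite -s0 v0 => ->; rewrite ltxx.
  have := phi_flow s10; rewrite vs1 => /(_ y0).
  rewrite /y phi_g//; lra.
rewrite -[LHS]g_phi//; first by rewrite phi_flow.
by apply: le_lt_trans lam_lt; have := v_anti (lexx 0) (ltW t0); rewrite v0.
Qed.

Lemma flow_immigration (t : R) : 0 <= t ->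
  integ 0 t (fun s => Phi (v s lam)) = H (t + phi lam) - H (phi lam).
Proof.
move=> t0; have pl := phi_gt0 lam_gt0 lam_lt.
have [->|tn] := eqVneq t 0.
  by rewrite add0r subrr /integ set_itv1 integral_set1.
have {}t0 : 0 < t by rewrite lt_neqAle eq_sym tn.
have tp (s : R) : 0 <= s -> 0 < s + phi lam by move=> s0; lra.
have dH (s : R) : 0 <= s -> is_derive s (1 : R) (fun s => H (s + phi lam)) (h (s + phi lam)).
  move=> s0; have d1 : is_derive s (1 : R) (fun s => s + phi lam) 1.
    have := is_deriveD (is_derive_id s 1) (is_derive_cst (phi lam) s 1).
    by rewrite addr0.
  have := @is_derive1_comp R H (fun s => s + phi lam) s _ _ (H_derive (tp s s0)) d1.
  by rewrite mulr1.
have cH (s : R) : 0 <= s -> {for s, continuous (fun s => H (s + phi lam))}.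
  by move=> s0; apply/differentiable_continuous/derivable1_diffP; case: (dH s s0).
have -> : integ 0 t (fun s => Phi (v s lam)) = integ 0 t (fun s => h (s + phi lam)).
  rewrite /integ; congr fine; apply: eq_integral => s.
  by rewrite inE/= in_itv/= => /andP[s0 _]; rewrite flowE.
rewrite /integ (@continuous_FTC2 R _ (fun s => H (s + phi lam)) 0 t t0).
- by rewrite add0r.
- apply: continuous_in_subspaceT => s; rewrite inE/= in_itv/= => /andP[s0 _].
  apply: (@continuous_comp _ _ _ (fun s => s + phi lam) h); last exact: h_cts (tp s s0).
  by apply: cvgD; [exact: cvg_id|exact: cvg_cst].
- split.
  + by move=> s; rewrite in_itv/= => /andP[/ltW s0 _]; case: (dH s s0).
  + apply: (cvg_at_right_filter (f := fun s => H (s + phi lam))); exact: cH.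
  + apply: (cvg_at_left_filter (f := fun s => H (s + phi lam))); apply: cH; exact: ltW.
- move=> s; rewrite in_itv/= => /andP[/ltW s0 _].
  by rewrite derive1E; case: (dH s s0).
Qed.

End Flow.

End Clock.

Lemma at_right_ex (R : realType) (P : R -> Prop) : (\forall y \near 0^'+, P y) ->
  exists2 y0 : R, 0 < y0 & forall y, 0 < y -> y <= y0 -> P y.
Proof.
move=> [e /= e0 he]; exists (e / 2); first lra.
move=> y y0 ye; apply: he => //=.
by rewrite sub0r normrN gtr0_norm//; lra.
Qed.

(** * Regular variation of the clock *)

Section ClockRegvar.
Context {R : realType} (Psi : R -> R) (lam0 alpha : R) (g : R -> R).
Hypothesis lam0_gt0 : 0 < lam0.
Hypothesis Psi_gt0 : forall q, 0 < q -> 0 < Psi q.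
Hypothesis Psi_cts : forall q, 0 < q -> {for q, continuous Psi}.
Hypothesis gE : is_g Psi lam0 g.
Hypothesis Psi_rv : forall lam : R, 0 < lam ->
  Psi (lam * q) / Psi q @[q --> 0^'+] --> lam `^ (1 + alpha).

Local Notation phi := (phi_fun Psi lam0).

Let ratio_cvg (lam : R) : 0 < lam -> lam * Psi q / Psi (lam * q) @[q --> 0^'+] --> lam `^ (- alpha).
Proof.
move=> lam0'.
have A0 : 0 < lam `^ (1 + alpha) by exact: powR_gt0.
have -> : lam `^ (- alpha) = lam * (lam `^ (1 + alpha))^-1.
  have {2}-> : lam = lam `^ 1 by rewrite powRr1// ltW.
  rewrite -powRN -powRD; first by congr (_ `^ _); lra.
  by rewrite (gt_eqF lam0') implybT.
have : lam * (Psi (lam * q) / Psi q)^-1 @[q --> 0^'+] --> lam * (lam `^ (1 + alpha))^-1.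
  by apply: cvgMl_tmp; apply: cvgV; [rewrite gt_eqF|exact: Psi_rv].
apply: cvg_trans; apply: near_eq_cvg; near=> q.
by rewrite invfM invrK; ring.
Unshelve. all: by end_near.
Qed.

Lemma clock_regvar (lam : R) : 0 < lam ->
  phi (lam * g x) / x @[x --> +oo] --> lam `^ (- alpha).
Proof.
move=> lamp; apply/cvgrPdist_le => /= e e0.
have e2 : 0 < e / 2 by lra.
(* Below this bound both [y] and [lam * y] are less than [lam0], where [phi] is known to be
   differentiable. *)
have lr : 0 < Num.min lam0 (lam0 / lam) by rewrite lt_min lam0_gt0 divr_gt0.
move/cvgrPdist_le : (ratio_cvg lamp) => /(_ _ e2) hnear.
have [y0 y00 hy] := at_right_ex (filterI hnear (nbhs_right_lt lr)).
have range (y : R) : 0 < y -> y <= y0 -> [/\ y < lam0, 0 < lam * y & lam * y < lam0].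
  move=> y1 y2; have [_] := hy y y1 y2; rewrite lt_min ltr_pdivlMr// mulrC => /andP[-> ->].
  by rewrite mulr_gt0.
have dD (C y : R) : 0 < y -> y <= y0 ->
    is_derive y (1 : R) (fun y => phi (lam * y) - C * phi y)
      ((C - lam * Psi y / Psi (lam * y)) / Psi y).
  move=> y1 y2; have [k1 k2 k3] := range y y1 y2.
  have d1 : is_derive y (1 : R) (fun y => lam * y) lam.
    have := is_deriveZ lam (is_derive_id y (1 : R)).
    by rewrite [_ *: 1]mulr1.
  have d2 := @is_derive1_comp R phi (fun y => lam * y) y _ _ (phi_derive Psi_gt0 Psi_cts k2 k3) d1.
  have d3 := is_deriveZ C (phi_derive Psi_gt0 Psi_cts y1 k1).
  have := is_deriveB d2 d3.
  move=> d4; apply: is_derive_eq d4 _.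
  have -> : C *: - (Psi y)^-1 = C * - (Psi y)^-1 by [].
  by field; rewrite !gt_eqF// Psi_gt0.
have mono (C y : R) : 0 < y -> y <= y0 ->
    exists2 c, 0 < c <= y0 & (phi (lam * y0) - C * phi y0) - (phi (lam * y) - C * phi y) =
      (C - lam * Psi c / Psi (lam * c)) / Psi c * (y0 - y).
  move=> y1 y2.
  have hd (z : R) : y <= z <= y0 -> is_derive z (1 : R) (fun y => phi (lam * y) - C * phi y)
      ((C - lam * Psi z / Psi (lam * z)) / Psi z).
    by move=> /andP[yz zy]; apply: dD => //; exact: lt_le_trans yz.
  have [c /andP[yc cy] ec] := mvt_closed y2 hd.
  by exists c; rewrite ?(lt_le_trans y1 yc).
pose C1 := lam `^ (- alpha) + e / 2; pose C2 := lam `^ (- alpha) - e / 2.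
pose K1 := phi (lam * y0) - C1 * phi y0; pose K2 := phi (lam * y0) - C2 * phi y0.
have [yl _ _] := range y0 y00 (lexx y0).
near=> x.
have p0 : 0 < phi y0 by exact: phi_gt0.
have px : phi y0 <= x by near: x; apply: nbhs_pinfty_ge; exact: num_real.
have x0 : 0 < x by exact: lt_le_trans px.
have xK : (`|K1| + `|K2|) / (e / 2) <= x by near: x; apply: nbhs_pinfty_ge; exact: num_real.
have gx0 : 0 < g x by exact: g_gt0 gE _ x0.
have gxy : g x <= y0.
  rewrite -[leRHS](g_phi Psi_gt0 Psi_cts gE y00 yl).
  exact: (g_anti Psi_gt0 Psi_cts gE).
have pg := phi_g gE x0.
have b (c : R) : 0 < c <= y0 -> `|lam `^ (- alpha) - lam * Psi c / Psi (lam * c)| <= e / 2.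
  by move=> /andP[c0 cy]; have [] := hy c c0 cy.
have up : phi (lam * g x) - C1 * x <= K1.
  have [c cc] := mono C1 (g x) gx0 gxy; rewrite pg -/K1 => eq1.
  have := b c cc; rewrite ler_norml => /andP[l1 l2].
  have : 0 <= (C1 - lam * Psi c / Psi (lam * c)) / Psi c * (y0 - g x).
    apply: mulr_ge0; last by rewrite subr_ge0.
    apply: divr_ge0; first by rewrite /C1; lra.
    by apply/ltW/Psi_gt0; case/andP: cc.
  by rewrite -eq1; lra.
have lo : K2 <= phi (lam * g x) - C2 * x.
  have [c cc] := mono C2 (g x) gx0 gxy; rewrite pg -/K2 => eq1.
  have := b c cc; rewrite ler_norml => /andP[l1 l2].
  have : (C2 - lam * Psi c / Psi (lam * c)) / Psi c * (y0 - g x) <= 0.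
    apply: mulr_le0_ge0; last by rewrite subr_ge0.
    apply: mulr_le0_ge0; first by rewrite /C2; lra.
    by rewrite invr_ge0; apply/ltW/Psi_gt0; case/andP: cc.
  by rewrite -eq1; lra.
have K1x : K1 <= e / 2 * x /\ - (e / 2 * x) <= K2.
  move: xK; rewrite ler_pdivrMr// => xK.
  by have := ler_norm K1; have := ler_norm (- K2); rewrite normrN; have := normr_ge0 K1; have := normr_ge0 K2; lra.
have : phi (lam * g x) / x <= lam `^ (- alpha) + e.
  by rewrite ler_pdivrMr// mulrDl; move: up; rewrite /C1 mulrDl; lra.
have : lam `^ (- alpha) - e <= phi (lam * g x) / x.
  by rewrite ler_pdivlMr// mulrBl; move: lo; rewrite /C2 mulrBl; lra.
by rewrite ler_norml; lra.
Unshelve. all: by end_near.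
Qed.

End ClockRegvar.

(** * Increments of a function with decreasing derivative *)

Lemma powR_continuous (R : realType) (r c : R) : 0 < c -> {for c, continuous (fun x => x `^ r)}.
Proof.
move=> c0; apply/differentiable_continuous/derivable1_diffP.
by apply: derivable_powR; rewrite in_itv/= andbT.
Qed.

Section Increments.
Context {R : realType} (H h : R -> R).
Hypothesis h_gt0 : forall x, 0 < x -> 0 < h x.
Hypothesis h_anti : forall x y, 0 < x -> x <= y -> h y <= h x.
Hypothesis H_derive : forall x : R, 0 < x -> is_derive x (1 : R) H (h x).

Let H_bounds (a b : R) : 0 < a -> a <= b -> h b * (b - a) <= H b - H a <= h a * (b - a).
Proof.
move=> a0 ab.
have [|c /andP[ac cb] ->] := @mvt_closed R H h a b ab.
  by move=> x /andP[ax _]; apply: H_derive; exact: lt_le_trans ax.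
have c0 : 0 < c by exact: lt_le_trans ac.
by apply/andP; split; apply: ler_wpM2r; rewrite ?subr_ge0//; apply: h_anti.
Qed.

Lemma cvg_ratio_bounds (tau s : R -> R) (c c1 c2 : R) : tau t @[t --> +oo] --> +oo ->
  s t / tau t @[t --> +oo] --> c -> c1 < c -> c < c2 ->
  \forall t \near +oo, 0 < tau t /\ c1 * tau t <= s t <= c2 * tau t.
Proof.
move=> tauy sc c1c cc2.
have h1 : \forall t \near +oo, 0 < tau t by move/cvgryPgt : tauy; apply.
have h2 : \forall t \near +oo, c1 < s t / tau t by move/cvgr_gt : sc; apply.
have h3 : \forall t \near +oo, s t / tau t < c2 by move/cvgr_lt : sc; apply.
near=> t.
have t0 : 0 < tau t by near: t.
split=> //; apply/andP; split; [rewrite -ler_pdivlMr//|rewrite -ler_pdivrMr//].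
  by apply: ltW; near: t.
by apply: ltW; near: t.
Unshelve. all: by end_near.
Qed.

Lemma cvgy_ratio (tau s : R -> R) (c : R) : 0 < c -> tau t @[t --> +oo] --> +oo ->
  s t / tau t @[t --> +oo] --> c -> s t @[t --> +oo] --> +oo.
Proof.
move=> c0 tauy sc; apply/cvgryPge => A.
have c1 : c / 2 < c by lra.
have c2 : c < c + 1 by lra.
have hb := cvg_ratio_bounds tauy sc c1 c2.
have hA : \forall t \near +oo, A / (c / 2) <= tau t by move/cvgryPge : tauy; apply.
near=> t; have [t0 /andP[l _]] : 0 < tau t /\ c / 2 * tau t <= s t <= (c + 1) * tau t by near: t.
apply: le_trans l; rewrite mulrC -ler_pdivrMr; last lra.
by near: t.
Unshelve. all: by end_near.
Qed.

(** Since [h] is nonincreasing, [h (s t)] is trapped between its values at [(c - k) * tau t] and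
    [(c + k) * tau t]. The width [k] comes from continuity of the power at [c], with [k < c] to keep
    both factors positive. *)
Lemma regvar_ratio_cvg (delta : R) (tau s : R -> R) (c : R) : regvar h (- delta) -> 0 < c ->
  tau t @[t --> +oo] --> +oo -> s t / tau t @[t --> +oo] --> c ->
  h (s t) / h (tau t) @[t --> +oo] --> c `^ (- delta).
Proof.
move=> rv c0 tauy sc; apply/cvgrPdist_le => /= e e0.
have e2 : 0 < e / 2 by lra.
have /cvgrPdist_le/(_ _ e2)/nbhs_ballP[r /= r0 hr] := @powR_continuous R (- delta) c c0.
pose k := Num.min (r / 2) (c / 2).
have k0 : 0 < k by rewrite lt_min; apply/andP; split; lra.
have kr : k < r by rewrite gt_min; apply/orP; left; lra.
have kc : k < c by rewrite gt_min; apply/orP; right; lra.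
have c1 : 0 < c - k by lra.
have c2 : 0 < c + k by lra.
have p1 : `|c `^ (- delta) - (c - k) `^ (- delta)| <= e / 2.
  by apply: hr; rewrite /ball/= opprB addrC subrK gtr0_norm.
have p2 : `|c `^ (- delta) - (c + k) `^ (- delta)| <= e / 2.
  by apply: hr; rewrite /ball/= opprD addrA subrr sub0r normrN gtr0_norm.
have l1 := cvg_comp tau (fun x => h ((c - k) * x) / h x) tauy (rv _ c1).
have l2 := cvg_comp tau (fun x => h ((c + k) * x) / h x) tauy (rv _ c2).
move/cvgrPdist_le : l1 => /(_ _ e2) l1; move/cvgrPdist_le : l2 => /(_ _ e2) l2.
have b1 : c - k < c by lra.
have b2 : c < c + k by lra.
have hb := cvg_ratio_bounds tauy sc b1 b2.
near=> t.
have [t0 /andP[s1 s2]] : 0 < tau t /\ (c - k) * tau t <= s t <= (c + k) * tau t by near: t.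
have q1 : `|(c - k) `^ (- delta) - h ((c - k) * tau t) / h (tau t)| <= e / 2 by near: t.
have q2 : `|(c + k) `^ (- delta) - h ((c + k) * tau t) / h (tau t)| <= e / 2 by near: t.
have ht := h_gt0 t0.
have s0 : 0 < s t by apply: lt_le_trans s1; exact: mulr_gt0.
have u1 : h (s t) / h (tau t) <= h ((c - k) * tau t) / h (tau t).
  by rewrite ler_pM2r ?invr_gt0//; apply: h_anti => //; exact: mulr_gt0.
have u2 : h ((c + k) * tau t) / h (tau t) <= h (s t) / h (tau t).
  by rewrite ler_pM2r ?invr_gt0//; exact: h_anti.
move: p1 p2 q1 q2; rewrite !ler_norml => /andP[? ?] /andP[? ?] /andP[? ?] /andP[? ?].
lra.
Unshelve. all: by end_near.
Qed.

(** As [t * h (tau t)] stays equal to [u] while [tau t * h (tau t)] tends to infinity, [t / tau t]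
    tends to [0]. Both endpoints are thus equivalent to [c * tau t], and the increment lies between
    [t * h (t + s t)] and [t * h (s t)], where [t = u / h (tau t)]. *)
Lemma increment_cvg_fast (delta u c : R) (tau s : R -> R) : regvar h (- delta) ->
  x * h x @[x --> +oo] --> +oo -> 0 < u -> 0 < c ->
  tau t @[t --> +oo] --> +oo -> (\forall t \near +oo, t * h (tau t) = u) ->
  s t / tau t @[t --> +oo] --> c ->
  H (t + s t) - H (s t) @[t --> +oo] --> u * c `^ (- delta).
Proof.
move=> rv xh u0 c0 tauy htau sc.
have taup : \forall t \near +oo, 0 < tau t by move/cvgryPgt : tauy; apply.
have sy := cvgy_ratio c0 tauy sc.
have sp : \forall t \near +oo, 0 < s t by move/cvgryPgt : sy; apply.
have ttau : t / tau t @[t --> +oo] --> (0 : R).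
  have k : u * (tau t * h (tau t))^-1 @[t --> +oo] --> u * 0.
    apply: cvgMl_tmp; apply/gtr0_cvgV0.
      near=> t; have t0 : 0 < tau t by near: t.
      by rewrite mulr_gt0// h_gt0.
    exact: (cvg_comp tau (fun x => x * h x) tauy xh).
  rewrite mulr0 in k; apply: cvg_trans k; apply: near_eq_cvg; near=> t.
  have t0 : 0 < tau t by near: t.
  have ut : t * h (tau t) = u by near: t.
  rewrite -ut; field; rewrite !gt_eqF//; exact: h_gt0.
have sc' : (t + s t) / tau t @[t --> +oo] --> c.
  have k : t / tau t + s t / tau t @[t --> +oo] --> 0 + c by exact: cvgD.
  by rewrite add0r in k; under eq_fun do rewrite mulrDl.
have r1 := regvar_ratio_cvg rv c0 tauy sc.
have r2 := regvar_ratio_cvg rv c0 tauy sc'.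
apply: (@squeeze_cvgr _ _ _ _ (fun t => u * (h (t + s t) / h (tau t))) (fun t => u * (h (s t) / h (tau t)))); last 2 first.
- exact: cvgMl_tmp.
- exact: cvgMl_tmp.
near=> t.
have t0 : 0 < tau t by near: t.
have s0 : 0 < s t by near: t.
have ut : t * h (tau t) = u by near: t.
have tp : 0 < t by near: t; apply: nbhs_pinfty_gt; exact: num_real.
have := @H_bounds (s t) (t + s t) s0; rewrite lerDr => /(_ (ltW tp)).
rewrite addrK -ut.
have e z : t * h (tau t) * (h z / h (tau t)) = h z * t.
  by field; rewrite gt_eqF// h_gt0.
by rewrite !e.
Unshelve. all: by end_near.
Qed.

(** In the variable [ln x] the derivative of [H] is [x * h x], which tends to [a]. The mean value
    theorem for [H \o expR] compares the increment with [a * (ln (t + s t) - ln (s t))]. *)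
Lemma increment_cvg_log (a c : R) (s : R -> R) : x * h x @[x --> +oo] --> a -> 0 < c ->
  s t / t @[t --> +oo] --> c ->
  H (t + s t) - H (s t) @[t --> +oo] --> a * ln (1 + c^-1).
Proof.
move=> xh c0 sc.
have idy : (t : R) @[t --> +oo] --> +oo by exact: cvg_id.
have sy := cvgy_ratio c0 idy sc.
have sp : \forall t \near +oo, 0 < s t by move/cvgryPgt : sy; apply.
have lim : ln (1 + (s t / t)^-1) @[t --> +oo] --> ln (1 + c^-1).
  have k1 : 1 + (s t / t)^-1 @[t --> +oo] --> 1 + c^-1.
    by apply: cvgD; [exact: cvg_cst|apply: cvgV => //; rewrite gt_eqF].
  have k2 : {for 1 + c^-1, continuous (@ln R)}.
    by apply: continuous_ln; rewrite addr_gt0// invr_gt0.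
  exact: (cvg_comp (fun t => 1 + (s t / t)^-1) (@ln R) k1 k2).
have rat : (H (t + s t) - H (s t)) / ln (1 + (s t / t)^-1) @[t --> +oo] --> a.
  apply/cvgrPdist_le => /= e e0.
  move/cvgrPdist_le : xh => /(_ _ e0) [M [Mr hM]].
  have sM : \forall t \near +oo, M < s t by move/cvgryPgt : sy; apply.
  near=> t.
  have s0 : 0 < s t by near: t.
  have tp : 0 < t by near: t; apply: nbhs_pinfty_gt; exact: num_real.
  have Ms : M < s t by near: t.
  have ts0 : 0 < t + s t by lra.
  have lst : ln (s t) <= ln (t + s t) by rewrite ler_ln ?posrE//; lra.
  have [z hz|z /andP[z1 z2]] := @mvt_closed R (H \o expR) (fun z => h (expR z) * expR z) _ _ lst.
    have := is_derive1_comp (H_derive (expR_gt0 z)) (is_derive_expR z).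
    by [].
  rewrite /= !lnK ?posrE// => ->.
  have -> : ln (1 + (s t / t)^-1) = ln (t + s t) - ln (s t).
    rewrite -ln_div ?posrE//; congr ln; field.
    by rewrite !gt_eqF.
  have ll : 0 < ln (t + s t) - ln (s t).
    by rewrite subr_gt0 ltr_ln ?posrE//; lra.
  rewrite mulfK ?gt_eqF// mulrC; apply: hM; apply: lt_le_trans Ms _.
  by rewrite -[leLHS]lnK ?posrE// ler_expR.
have prod : (H (t + s t) - H (s t)) / ln (1 + (s t / t)^-1) * ln (1 + (s t / t)^-1)
    @[t --> +oo] --> a * ln (1 + c^-1) by exact: cvgM.
apply: cvg_trans prod; apply: near_eq_cvg; near=> t.
have s0 : 0 < s t by near: t.
have tp : 0 < t by near: t; apply: nbhs_pinfty_gt; exact: num_real.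
rewrite /= divfK// gt_eqF// ln_gt0// ltrDl invr_gt0 divr_gt0//.
Unshelve. all: by end_near.
Qed.

(** Between [x] and [y <= C * x] the increment is at most [h x * (C * x)], that is, [C] times the
    quantity [x * h x] that tends to [0]. *)
Lemma increment_cvg0 (C : R) (a b : R -> R) : x * h x @[x --> +oo] --> (0 : R) -> 1 <= C ->
  a t @[t --> +oo] --> +oo ->
  (\forall t \near +oo, a t <= C * b t /\ b t <= C * a t) ->
  H (b t) - H (a t) @[t --> +oo] --> (0 : R).
Proof.
move=> xh C1 ay ab.
have C0 : 0 < C by lra.
apply/cvgrPdist_le => /= e e0.
have eC : 0 < e / C by rewrite divr_gt0.
move/cvgrPdist_le : xh => /(_ _ eC) [M [Mr hM]].
have aM : \forall t \near +oo, C * (`|M| + 1) <= a t by move/cvgryPge : ay; apply.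
near=> t.
have [k1 k2] : a t <= C * b t /\ b t <= C * a t by near: t.
have k3 : C * (`|M| + 1) <= a t by near: t.
have nM := ler_norm M; have nM0 := normr_ge0 M.
have bM : `|M| + 1 <= b t by rewrite -(ler_pM2l C0); exact: le_trans k1.
have aM' : `|M| + 1 <= a t by nra.
have key (x y : R) : `|M| + 1 <= x -> x <= y -> y <= C * x -> 0 <= H y - H x <= e.
  move=> Mx xy yC; have x0 : 0 < x by lra.
  have /andP[lo up] := H_bounds x0 xy.
  have hx := h_gt0 x0; have hy := h_gt0 (lt_le_trans x0 xy).
  apply/andP; split; first by apply: le_trans lo; rewrite mulr_ge0 ?subr_ge0// ltW.
  apply: le_trans up _.
  have := hM x ltac:(lra); rewrite /= sub0r normrN gtr0_norm ?mulr_gt0//.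
  rewrite ler_pdivlMr// => hxe; apply: le_trans hxe.
  have -> : x * h x * C = h x * (C * x) by ring.
  by rewrite ler_pM2l//; lra.
rewrite sub0r normrN; have [ab'|ba] := leP (a t) (b t).
  by have /andP[q1 q2] := key _ _ aM' ab' k2; rewrite ger0_norm.
have /andP[q1 q2] := key _ _ bM (ltW ba) k1.
by rewrite ler0_norm; lra.
Unshelve. all: by end_near.
Qed.

End Increments.

(** * Limit theorems *)

Section LawCdfRelations.
Context d (T : measurableType d) (R : realType) (P : probability T R).
Variables X Z W : T -> R.
Hypotheses (mX : measurable_fun setT X) (mZ : measurable_fun setT Z) (mW : measurable_fun setT W).

Lemma law_cdf_le (a b : R) : (forall w, X w <= a -> Z w <= b) -> law_cdf P X a <= law_cdf P Z b.
Proof.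
move=> XZ; rewrite -lee_fin -!law_cdfE//.
by apply: le_measure; rewrite ?inE; [exact: measurable_le_cst..|exact: XZ].
Qed.

(** This and the next lemma serve when [Z] is a decreasing function of [X]: the event [Z <= b] is
    then compared with the complement of [X <= a], through union bounds. *)
Lemma law_cdf_cover (a b : R) : (forall w, X w <= a \/ Z w <= b) ->
  1 <= law_cdf P X a + law_cdf P Z b.
Proof.
move=> XZ; rewrite -lee_fin EFinD -!law_cdfE// -[leLHS](probability_setT P).
have -> : setT = [set w | X w <= a] `|` [set w | Z w <= b] by apply/seteqP; split => // w _; exact: XZ.
by apply: measureU2; exact: measurable_le_cst.
Qed.

Lemma law_cdf_inter (a b c : R) : (forall w, X w <= a -> Z w <= b -> W w <= c) ->
  law_cdf P X a + law_cdf P Z b <= 1 + law_cdf P W c.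
Proof.
move=> XZW; rewrite -lerBrDr addrAC.
have mb : measurable [set w | Z w <= b] by exact: measurable_le_cst.
rewrite -lee_fin EFinD EFinB -!law_cdfE// -(probability_setC P mb).
apply: (@le_trans _ _ (P (~` [set w | Z w <= b] `|` [set w | W w <= c]))).
  apply: le_measure; rewrite ?inE; [exact: measurable_le_cst| |].
    by apply: measurableU; [exact: measurableC|exact: measurable_le_cst].
  move=> w Xa; have [Zb|Zb] := pselect (Z w <= b); last by left.
  by right; exact: XZW.
by apply: measureU2; [exact: measurableC|exact: measurable_le_cst].
Qed.

End LawCdfRelations.

Lemma regvar_power_over_slow (R : realType) (h L : R -> R) (delta : R) :
  (forall x, 0 < x -> h x = x `^ (- delta) / L x) -> slowly_varying L -> regvar h (- delta).
Proof.
move=> hE [L0 hL] c c0.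
have k : c `^ (- delta) * (L (c * x) / L x)^-1 @[x --> +oo] --> c `^ (- delta) * 1^-1.
  by apply: cvgMl_tmp; apply: cvgV; [exact: oner_neq0|exact: hL].
rewrite invr1 mulr1 in k; apply: cvg_trans k; apply: near_eq_cvg; near=> x.
have x0 : 0 < x by near: x; apply: nbhs_pinfty_gt; exact: num_real.
have Lx : 0 < L x by near: x.
have Lcx : 0 < L (c * x) by near: x; exact: near_pinfty_scale L0.
rewrite !hE ?mulr_gt0// powRM ?ltW//; field.
by rewrite !gt_eqF// powR_gt0.
Unshelve. all: by end_near.
Qed.

(** * Laplace limits of the rescaled process *)

Section CBI.
Context {R : realType} (Psi Phi : R -> R) (lam0 alpha : R) (g : R -> R) (v : R -> R -> R).
Hypothesis lam0_gt0 : 0 < lam0.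
Hypothesis alpha_gt0 : 0 < alpha.
Hypothesis Psi_gt0 : forall q, 0 < q -> 0 < Psi q.
Hypothesis Psi00 : 0 <= Psi 0.
Hypothesis Psi_cts : forall q, 0 < q -> {for q, continuous Psi}.
Hypothesis Psi_rv : forall lam : R, 0 < lam ->
  Psi (lam * q) / Psi q @[q --> 0^'+] --> lam `^ (1 + alpha).
Hypothesis Phi_gt0 : forall q, 0 < q -> 0 < Phi q.
Hypothesis Phi00 : Phi 0 = 0.
Hypothesis Phi_cts : forall q, 0 < q -> {for q, continuous Phi}.
Hypothesis Phi_homo : forall p q, 0 <= p -> p <= q -> Phi p <= Phi q.
Hypothesis gE : is_g Psi lam0 g.
Hypothesis hv : solves_v Psi v.

Context d (T : measurableType d) (P : probability T R) (x : R) (Y : R -> T -> R).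
Hypothesis mY : forall t : R, measurable_fun setT (Y t).
Hypothesis Y0 : forall (t : R) (w : T), 0 <= Y t w.
Hypothesis laplaceY : forall t lam : R, 0 <= t -> 0 <= lam ->
     (\int[P]_w (expR (- (lam * Y t w)))%:E)%E =
     (expR (- (x * v t lam) - integ 0 t (fun s => Phi (v s lam))))%:E.

Local Notation phi := (phi_fun Psi lam0).
Local Notation H := (H_fun Psi Phi lam0 g).
Local Notation h := (fun x => Phi (g x)).

Let Phi_homo' p q : 0 < p -> p <= q -> Phi p <= Phi q.
Proof. by move=> /ltW; exact: Phi_homo. Qed.

Let g0 (s : R) : 0 < s -> 0 < g s. Proof. exact: g_gt0 gE _. Qed.
Let g_y : g s @[s --> +oo] --> (0 : R). Proof. exact: (g_cvg0 lam0_gt0 Psi_gt0 Psi_cts gE). Qed.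
Let h0 (s : R) : 0 < s -> 0 < h s. Proof. by move=> s0; apply: Phi_gt0; exact: g0. Qed.
Let hanti (r s : R) : 0 < r -> r <= s -> h s <= h r.
Proof. exact: (h_anti Psi_gt0 Psi_cts Phi_homo' gE). Qed.
Let Hder (s : R) : 0 < s -> is_derive s (1 : R) H (h s).
Proof. exact: (H_derive Psi_gt0 Psi_cts Phi_cts gE). Qed.

Let gtau0 (tau : R -> R) : tau t @[t --> +oo] --> +oo -> \forall t \near +oo, 0 < g (tau t).
Proof.
move=> tauy; have tp : \forall t \near +oo, 0 < tau t by move/cvgryPgt : tauy; apply.
by apply: filterS tp => t; exact: g0.
Qed.

Let mgY (tau : R -> R) t : measurable_fun setT (fun w => g (tau t) * Y t w).
Proof. by apply: measurable_funM => //; exact: measurable_cst. Qed.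

Let gY0 (tau : R -> R) : tau t @[t --> +oo] --> +oo ->
  \forall t \near +oo, forall w, 0 <= g (tau t) * Y t w.
Proof.
by move=> /gtau0; apply: filterS => t gt w; rewrite mulr_ge0// ltW.
Qed.

(** The starting point is forgotten: its term in the exponent is [x * g (t + phi (th * g (tau t)))],
    at most [x * g t] for [x >= 0] and vanishing in any case because [g] tends to [0]. What remains
    is the increment of [H]. *)
Lemma laplace_limit (tau : R -> R) (th l : R) : 0 < th -> tau t @[t --> +oo] --> +oo ->
  H (t + phi (th * g (tau t))) - H (phi (th * g (tau t))) @[t --> +oo] --> l ->
  (\int[P]_w expR (- (th * (g (tau t) * Y t w))))%R @[t --> +oo] --> expR (- l).
Proof.
move=> th0 tauy hl.
have gp := gtau0 tauy.
have gsmall : \forall t \near +oo, th * g (tau t) < lam0.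
  have k : th * g (tau t) @[t --> +oo] --> th * 0.
    by apply: cvgMl_tmp; exact: (cvg_comp tau g tauy g_y).
  by rewrite mulr0 in k; move/cvgr_lt : k; apply.
have xg : x * g (t + phi (th * g (tau t))) @[t --> +oo] --> x * 0.
  apply: cvgMl_tmp.
  apply: (@squeeze_cvgr _ _ _ _ (fun=> 0) g) => //; last exact: cvg_cst.
  near=> t; have tp : 0 < t by near: t; apply: nbhs_pinfty_gt; exact: num_real.
  have s0 : 0 < phi (th * g (tau t)).
    apply: phi_gt0 => //; last by near: t.
    by rewrite mulr_gt0//; near: t.
  rewrite ltW ?g0 ?addr_gt0//=; apply: (g_anti Psi_gt0 Psi_cts gE tp).
  by rewrite lerDl ltW.
have k : - (x * g (t + phi (th * g (tau t)))) -
    (H (t + phi (th * g (tau t))) - H (phi (th * g (tau t)))) @[t --> +oo] --> - (x * 0) - l.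
  by apply: cvgB => //; exact: cvgN.
rewrite mulr0 oppr0 sub0r in k.
have k2 := cvg_comp _ (@expR R) k (@continuous_expR R (- l)).
apply: cvg_trans k2; apply: near_eq_cvg; near=> t.
have tp : 0 < t by near: t; apply: nbhs_pinfty_gt; exact: num_real.
have a0 : 0 < th * g (tau t) by rewrite mulr_gt0//; near: t.
have al : th * g (tau t) < lam0 by near: t.
rewrite /= -[RHS]/(fine (\int[P]_w (expR (- (th * (g (tau t) * Y t w))))%:E)%E).
under eq_integral do rewrite mulrA.
rewrite laplaceY ?ltW//=; congr expR.
rewrite (flowE Psi_gt0 Psi00 Psi_cts gE hv a0 al (ltW tp)).
by rewrite (flow_immigration Psi_gt0 Psi00 Psi_cts Phi_cts gE hv a0 al (ltW tp)).
Unshelve. all: by end_near.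
Qed.

Let clock_tau (tau : R -> R) (th : R) : 0 < th -> tau t @[t --> +oo] --> +oo ->
  phi (th * g (tau t)) / tau t @[t --> +oo] --> th `^ (- alpha).
Proof.
move=> th0 tauy; have k := clock_regvar lam0_gt0 Psi_gt0 Psi_cts gE Psi_rv th0.
exact: (cvg_comp tau (fun s => phi (th * g s) / s) tauy k).
Qed.

Let laplace_cvg1 (tau : R -> R) :
  (\int[P]_w expR (- (0 * (g (tau t) * Y t w))))%R @[t --> +oo] --> (1 : R).
Proof.
have -> : (fun t => (\int[P]_w expR (- (0 * (g (tau t) * Y t w))))%R) = cst 1.
  apply/funext => t; rewrite (_ : (fun w => _) = cst 1); last first.
    by apply/funext => w; rewrite mul0r oppr0 expR0.
  exact: probability_Rintegral_cst.
exact: cvg_cst.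
Qed.

(** The filter [F] is left arbitrary because the limit is [0], [a] or [+oo] according to the
    condition. *)
Let condH_h (F : set_system R) : Filter F ->
  y * derive1 H y @[y --> +oo] `=>` F -> y * h y @[y --> +oo] `=>` F.
Proof.
move=> FF; apply: cvg_trans; apply: near_eq_cvg; near=> s.
have s0 : 0 < s by near: s; apply: nbhs_pinfty_gt; exact: num_real.
by rewrite (derive1_H Psi_gt0 Psi_cts Phi_cts gE).
Unshelve. all: by end_near.
Qed.

Lemma cbi_limit_L (a : R) : 0 < a -> condL H a ->
  exists m : probability R R,
    [/\ m [set y : R | y < 0] = 0%E,
        forall lam : R, 0 <= lam ->
          (\int[m]_y (expR (- (lam * y)))%:E)%E = ((1 + lam `^ alpha) `^ (- a))%:E &
        cvg_law P (fun t w => g t * Y t w) m].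
Proof.
move=> a0 cL; have xh := @condH_h (nbhs a) (nbhs_filter a) cL.
have idy : (t : R) @[t --> +oo] --> +oo by exact: cvg_id.
apply: (laplace_continuity (Z := fun t w => g t * Y t w)
  (L := fun lam => (1 + lam `^ alpha) `^ (- a))).
- exact: (mgY id).
- exact: (gY0 idy).
- move=> lam; rewrite le_eqVlt => /predU1P[<-|l0].
    by rewrite powR0 ?gt_eqF// addr0 powR1; exact: (laplace_cvg1 id).
  have c0 : 0 < lam `^ (- alpha) by exact: powR_gt0.
  have := increment_cvg_log Hder xh c0 (clock_tau l0 idy).
  rewrite powRN invrK => k.
  have := laplace_limit l0 idy k.
  by rewrite {2}/powR gt_eqF ?mulNr// ltr_wpDr ?powR_ge0.
- have k : 1 + lam `^ alpha @[lam --> 0^'+] --> (1 + 0 : R).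
    by apply: cvgD; [exact: cvg_cst|exact: powR_cvg0].
  have := cvg_comp _ _ k (@powR_continuous R (- a) (1 + 0) _).
  by rewrite addr0 powR1; apply.
Qed.

(** [h] is positive and nonincreasing, so [h (tau t)] can fall below [h A] only if [tau t] passes
    [A]. *)
Let tau_cvgy (tau : R -> R) : (\forall t \near +oo, 0 < tau t) ->
  h (tau t) @[t --> +oo] --> (0 : R) -> tau t @[t --> +oo] --> +oo.
Proof.
move=> tp htau; apply/cvgryPge => A.
have M0 : 0 < Num.max A 1 by rewrite lt_max ltr01 orbT.
have small : \forall t \near +oo, h (tau t) < h (Num.max A 1).
  by move/cvgr_lt : htau; apply; exact: h0.
near=> t; have t0 : 0 < tau t by near: t.
have hs : h (tau t) < h (Num.max A 1) by near: t.
have [le|/ltW le] := leP (tau t) (Num.max A 1).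
  by have := lt_le_trans hs (hanti t0 le); rewrite ltxx.
by apply: le_trans le; rewrite le_max lexx.
Unshelve. all: by end_near.
Qed.

Let tau_cvgy_eq (tau : R -> R) (u : R) : (\forall t \near +oo, 0 < tau t /\ t * h (tau t) = u) ->
  tau t @[t --> +oo] --> +oo.
Proof.
move=> htau; apply: tau_cvgy; first by apply: filterS htau => t [].
have k : u * t^-1 @[t --> +oo] --> u * 0.
  apply: cvgMl_tmp; apply/gtr0_cvgV0; last exact: cvg_id.
  by apply: nbhs_pinfty_gt; exact: num_real.
rewrite mulr0 in k; apply: cvg_trans k; apply: near_eq_cvg; near=> t.
have tp : 0 < t by near: t; apply: nbhs_pinfty_gt; exact: num_real.
have [_ <-] : 0 < tau t /\ t * h (tau t) = u by near: t.
by rewrite mulrAC divff ?mul1r// gt_eqF.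
Unshelve. all: by end_near.
Qed.

(** * Condition (F) *)

Section FastCase.
Variable delta : R.
Hypothesis cF : condF H delta.

Let hE : exists2 L : R -> R, slowly_varying L & forall s, 0 < s -> h s = s `^ (- delta) / L s.
Proof.
have [_ [_ [L [sL [LE _]]]]] := cF; exists L => // s s0.
by rewrite -(derive1_H Psi_gt0 Psi_cts Phi_cts gE s0) LE.
Qed.

Let h_rv : regvar h (- delta).
Proof. by have [L sL LE] := hE; exact: regvar_power_over_slow LE sL. Qed.

Let xh : y * h y @[y --> +oo] --> +oo.
Proof. by have [k _] := cF; exact: (@condH_h (pinfty_nbhs R) _ k). Qed.

Lemma laplace_limit_fast (tau : R -> R) (u th : R) : 0 < u -> 0 < th ->
  (\forall t \near +oo, 0 < tau t /\ t * h (tau t) = u) ->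
  (\int[P]_w expR (- (th * (g (tau t) * Y t w))))%R @[t --> +oo] -->
    expR (- (u * th `^ (delta * alpha))).
Proof.
move=> u0 th0 htau; have tauy := tau_cvgy_eq htau.
have htau' : \forall t \near +oo, t * h (tau t) = u by apply: filterS htau => t [].
have c0 : 0 < th `^ (- alpha) by exact: powR_gt0.
apply: laplace_limit => //.
have := increment_cvg_fast h0 hanti Hder h_rv xh u0 c0 tauy htau' (clock_tau th0 tauy).
by rewrite -powRrM mulrNN mulrC [alpha * delta]mulrC mulrC.
Qed.

Let phi_ratio (tau : R -> R) (k : R) : 0 < k -> tau t @[t --> +oo] --> +oo ->
  Phi (k * g (tau t)) / Phi (g (tau t)) @[t --> +oo] --> k `^ (delta * alpha).
Proof.
move=> k0 tauy.
have c0 : 0 < k `^ (- alpha) by exact: powR_gt0.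
have := regvar_ratio_cvg h0 hanti h_rv c0 tauy (clock_tau k0 tauy).
rewrite -powRrM mulrNN [alpha * delta]mulrC; apply: cvg_trans.
have gsmall : \forall t \near +oo, k * g (tau t) < lam0.
  have q : k * g (tau t) @[t --> +oo] --> k * 0.
    by apply: cvgMl_tmp; exact: (cvg_comp tau g tauy g_y).
  by rewrite mulr0 in q; move/cvgr_lt : q; apply.
have gp := gtau0 tauy.
apply: near_eq_cvg; near=> t.
rewrite (g_phi Psi_gt0 Psi_cts gE)//; last by near: t.
by rewrite mulr_gt0//; near: t.
Unshelve. all: by end_near.
Qed.

Section Rho.
Variable rho : R -> R.
Hypothesis delta_gt0 : 0 < delta.
Hypothesis hrho : \forall t \near +oo, 0 < rho t /\ Phi (rho t) = t^-1.

Let tau t := phi (rho t).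

(** Once [t^-1 < Phi lam0], monotonicity of [Phi] puts [rho t] below [lam0], where [g] inverts the
    clock. Thus [rho t] is [g (tau t)] for the [tau] belonging to [u = 1]. *)
Let rho_tau : \forall t \near +oo,
  [/\ 0 < t, 0 < rho t, g (tau t) = rho t, 0 < tau t & t * h (tau t) = 1].
Proof.
have tl : \forall t \near +oo, (Phi lam0)^-1 < t by apply: nbhs_pinfty_gt; exact: num_real.
near=> t; have tp : 0 < t by near: t; apply: nbhs_pinfty_gt; exact: num_real.
have [r0 rE] : 0 < rho t /\ Phi (rho t) = t^-1 by near: t.
have rl : rho t < lam0.
  rewrite ltNge; apply/negP => /(Phi_homo' lam0_gt0); rewrite rE.
  apply/negP; rewrite -ltNge -[ltRHS]invrK ltf_pV2 ?posrE ?invr_gt0 ?Phi_gt0//.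
  by near: t.
have gt : g (tau t) = rho t by apply: g_phi.
split => //; first exact: phi_gt0.
by rewrite gt rE divff// gt_eqF.
Unshelve. all: by end_near.
Qed.

Let htau : \forall t \near +oo, 0 < tau t /\ t * h (tau t) = 1.
Proof. by apply: filterS rho_tau => t []. Qed.

Let da : 0 < delta * alpha. Proof. exact: mulr_gt0. Qed.

Let rho_ratio (c : R) : 0 < c -> rho (c * t) / rho t @[t --> +oo] --> c `^ (- (delta * alpha)^-1).
Proof.
move=> c0; have tauy := tau_cvgy_eq htau.
pose k0 := c `^ (- (delta * alpha)^-1).
have k00 : 0 < k0 by exact: powR_gt0.
have k0E : k0 `^ (delta * alpha) = c^-1.
  by rewrite -powRrM mulNr mulVf ?gt_eqF// powR_inv1// ltW.
apply/cvgrPdist_le => /= e e0; rewrite -/k0.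
have rc := near_pinfty_scale c0 rho_tau.
have up : \forall t \near +oo, c^-1 < Phi ((k0 + e) * g (tau t)) / Phi (g (tau t)).
  have ke : 0 < k0 + e by exact: addr_gt0.
  move/cvgr_gt : (phi_ratio ke tauy); apply; rewrite -k0E.
  by apply: gt0_ltr_powR => //; rewrite ?nnegrE ?ltW// ltrDl.
have upper : \forall t \near +oo, rho (c * t) / rho t <= k0 + e.
  near=> t.
  have [tp r0 gt t0 ht] : [/\ 0 < t, 0 < rho t, g (tau t) = rho t, 0 < tau t & t * h (tau t) = 1] by near: t.
  have [ctp r1 gct ct0 hct] : [/\ 0 < c * t, 0 < rho (c * t), g (tau (c * t)) = rho (c * t),
    0 < tau (c * t) & c * t * h (tau (c * t)) = 1] by near: t.
  have : c^-1 < Phi ((k0 + e) * g (tau t)) / Phi (g (tau t)) by near: t.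
  rewrite gt in ht *; rewrite gct in hct.
  have P1 : Phi (rho t) = t^-1 by apply: (mulfI (lt0r_neq0 tp)); rewrite ht divff ?gt_eqF.
  have P2 : Phi (rho (c * t)) = (c * t)^-1 by apply: (mulfI (lt0r_neq0 ctp)); rewrite hct divff ?gt_eqF.
  rewrite P1 invrK -ltr_pdivrMr// -invfM -P2 ler_pdivrMr// => lt.
  rewrite leNgt; apply/negP => /ltW gtr.
  have kr : 0 < (k0 + e) * rho t by rewrite mulr_gt0// addr_gt0.
  by have := lt_le_trans lt (Phi_homo' kr gtr); rewrite ltxx.
have lower : \forall t \near +oo, k0 - e <= rho (c * t) / rho t.
  have [ke|ke] := leP (k0 - e) 0.
    near=> t; have r0 : 0 < rho t by near: t; apply: filterS rho_tau => t [].
    have r1 : 0 < rho (c * t) by near: t; apply: filterS rc => t [].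
    by apply: le_trans ke _; rewrite divr_ge0// ltW.
  have lo : \forall t \near +oo, Phi ((k0 - e) * g (tau t)) / Phi (g (tau t)) < c^-1.
    move/cvgr_lt : (phi_ratio ke tauy); apply; rewrite -k0E.
    by apply: gt0_ltr_powR => //; rewrite ?nnegrE ?ltW// ltrBlDr ltrDl.
  near=> t.
  have [tp r0 gt t0 ht] : [/\ 0 < t, 0 < rho t, g (tau t) = rho t, 0 < tau t & t * h (tau t) = 1] by near: t.
  have [ctp r1 gct ct0 hct] : [/\ 0 < c * t, 0 < rho (c * t), g (tau (c * t)) = rho (c * t),
    0 < tau (c * t) & c * t * h (tau (c * t)) = 1] by near: t.
  have : Phi ((k0 - e) * g (tau t)) / Phi (g (tau t)) < c^-1 by near: t.
  rewrite gt in ht *; rewrite gct in hct.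
  have P1 : Phi (rho t) = t^-1 by apply: (mulfI (lt0r_neq0 tp)); rewrite ht divff ?gt_eqF.
  have P2 : Phi (rho (c * t)) = (c * t)^-1 by apply: (mulfI (lt0r_neq0 ctp)); rewrite hct divff ?gt_eqF.
  rewrite P1 invrK -ltr_pdivlMr// -invfM -P2 ler_pdivlMr// => lt.
  rewrite leNgt; apply/negP => /ltW gtr.
  by have := lt_le_trans lt (Phi_homo' r1 gtr); rewrite ltxx.
near=> t; have u1 : rho (c * t) / rho t <= k0 + e by near: t.
have u2 : k0 - e <= rho (c * t) / rho t by near: t.
by rewrite ler_norml; lra.
Unshelve. all: by end_near.
Qed.

Lemma rho_slowly_varying : exists ellbar : R -> R, slowly_varying ellbar /\
  \forall t \near +oo, rho t = t `^ (- (delta * alpha)^-1) * ellbar t.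
Proof.
pose r := (delta * alpha)^-1.
exists (fun t => t `^ r * rho t); split; last first.
  near=> t; have tp : 0 < t by near: t; apply: nbhs_pinfty_gt; exact: num_real.
  by rewrite mulrA powRN mulVf ?mul1r// gt_eqF// powR_gt0.
split.
  near=> t; have tp : 0 < t by near: t; apply: nbhs_pinfty_gt; exact: num_real.
  by rewrite mulr_gt0 ?powR_gt0//; near: t; apply: filterS rho_tau => t [].
move=> c c0.
have k : c `^ r * (rho (c * t) / rho t) @[t --> +oo] --> c `^ r * c `^ (- r).
  by apply: cvgMl_tmp; exact: rho_ratio.
rewrite powRN divff ?gt_eqF ?powR_gt0// in k.
apply: cvg_trans k; apply: near_eq_cvg; near=> t.
have tp : 0 < t by near: t; apply: nbhs_pinfty_gt; exact: num_real.
have r0 : 0 < rho t by near: t; apply: filterS rho_tau => t [].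
rewrite powRM ?ltW//; field.
by rewrite !gt_eqF// powR_gt0.
Unshelve. all: by end_near.
Qed.

Lemma cbi_limit_F : exists m : probability R R,
  [/\ m [set y : R | y < 0] = 0%E,
      forall th : R, 0 <= th ->
        (\int[m]_y (expR (- (th * y)))%:E)%E = (expR (- th `^ (delta * alpha)))%:E &
      cvg_law P (fun t w => rho t * Y t w) m].
Proof.
apply: (laplace_continuity (Z := fun t w => rho t * Y t w)
  (L := fun th => expR (- th `^ (delta * alpha)))).
- by move=> t; apply: measurable_funM => //; exact: measurable_cst.
- apply: filterS rho_tau => t [_ r0 _ _ _] w.
  by rewrite mulr_ge0// ltW.
- move=> th th0.
  suff : (\int[P]_w expR (- (th * (g (tau t) * Y t w))))%R @[t --> +oo] -->
      expR (- th `^ (delta * alpha)).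
    apply: cvg_trans; apply: near_eq_cvg; apply: filterS rho_tau => t [_ _ gt _ _].
    by rewrite gt.
  move: th0; rewrite le_eqVlt => /predU1P[<-|l0].
    by rewrite powR0 ?gt_eqF// oppr0 expR0; exact: laplace_cvg1.
  by have := laplace_limit_fast ltr01 l0 htau; rewrite mul1r.
- have k : - (lam `^ (delta * alpha)) @[lam --> 0^'+] --> (- 0 : R).
    by apply: cvgN; exact: powR_cvg0.
  have := cvg_comp _ _ k (@continuous_expR R (- 0)).
  by rewrite oppr0 expR0.
Qed.

End Rho.

Section DeltaZero.
Hypothesis delta0 : delta = 0.

Let h_cvg0 : h y @[y --> +oo] --> (0 : R).
Proof.
have [_ [_ [L [sL [LE [Ly _]]]]]] := cF.
have k : (L y)^-1 @[y --> +oo] --> (0 : R) by apply/gtr0_cvgV0; [case: sL|exact: Ly].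
apply: cvg_trans k; apply: near_eq_cvg; near=> y.
have y0 : 0 < y by near: y; apply: nbhs_pinfty_gt; exact: num_real.
by rewrite -(derive1_H Psi_gt0 Psi_cts Phi_cts gE y0) LE// delta0 oppr0 powRr0 div1r.
Unshelve. all: by end_near.
Qed.

Let tau_exists (u : R) : 0 < u ->
  exists tau : R -> R, \forall t \near +oo, 0 < tau t /\ t * h (tau t) = u.
Proof.
move=> u0; pose S t := [set s : R | 0 < s /\ t * h s = u].
(* [xget] returns the default [1] where the equation has no solution; for large [t] the intermediate
   value theorem gives one, because [h] tends to [0]. *)
exists (fun t => xget 1 (S t)); near=> t.
suff : exists s, S t s by move=> ex; exact: (@xgetPex _ 1 (S t) ex).
have tp : 0 < t by near: t; apply: nbhs_pinfty_gt; exact: num_real.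
have h1 : 0 < h 1 by exact: h0.
have ut : u / t < h 1.
  rewrite ltr_pdivrMr// mulrC -ltr_pdivrMr//; near: t.
  by apply: nbhs_pinfty_gt; exact: num_real.
have ut0 : 0 < u / t by rewrite divr_gt0.
have [M [M1 hM]] : exists M, 1 <= M /\ h M < u / t.
  have k : \forall y \near +oo, h y < u / t by move/cvgr_lt : h_cvg0; apply.
  have [M [k1 k2]] := filter_ex (filterI k (nbhs_pinfty_ge (num_real (1 : R)))).
  by exists M.
have [||s] := @IVT R h 1 M (u / t) M1.
- apply: continuous_in_subspaceT => y /[!inE] /=; rewrite in_itv/= => /andP[y1 _].
  by apply: (h_cts Psi_gt0 Psi_cts Phi_cts gE); exact: lt_le_trans y1.
- by rewrite ge_min le_max (ltW hM) (ltW ut) orbT.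
rewrite in_itv/= => /andP[s1 _] hs; exists s; split; first exact: lt_le_trans s1.
by rewrite hs mulrC divfK// gt_eqF.
Unshelve. all: by end_near.
Qed.

Let scaled_cdf (tau : R -> R) (u : R) : 0 < u ->
  (\forall t \near +oo, 0 < tau t /\ t * h (tau t) = u) ->
  law_cdf P (fun w => g (tau t) * Y t w) 1 @[t --> +oo] --> expR (- u).
Proof.
move=> u0 htau; have tauy := tau_cvgy_eq htau.
apply: (degenerate_laplace_cdf (X := fun t w => g (tau t) * Y t w)).
- exact: mgY.
- exact: gY0.
- move=> th th0; have := laplace_limit_fast u0 th0 htau.
  by rewrite delta0 mul0r powRr0 mulr1.
Qed.

(** With [0^-1 = 0], the variable [t * Phi (Y t w)^-1] is [0], not infinite, where [Y t w = 0], so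
    this event must be shown negligible. It is contained in [g (tau t) * Y t <= 1] for every [u],
    whose probability tends to [expR (- u)]. *)
Let atom0 (e : R) : 0 < e -> \forall t \near +oo, law_cdf P (Y t) 0 <= e.
Proof.
move=> e0; pose u := Num.max 1 (- ln (e / 2)).
have u0 : 0 < u by rewrite lt_max ltr01.
have ue : expR (- u) < e.
  apply: (@le_lt_trans _ _ (e / 2)); last lra.
  have e2 : 0 < e / 2 by lra.
  by rewrite -[leRHS]lnK ?posrE// ler_expR lerNl /u le_max lexx orbT.
have [tau htau] := tau_exists u0.
move/cvgr_lt : (scaled_cdf u0 htau) => /(_ _ ue) small.
near=> t.
apply: (@le_trans _ _ (law_cdf P (fun w => g (tau t) * Y t w) 1)); last first.
  by apply: ltW; near: t.
apply: law_cdf_le => //.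
move=> w Yw; have -> : Y t w = 0 by apply: le_anti; rewrite Yw Y0.
by rewrite mulr0.
Unshelve. all: by end_near.
Qed.

Let mZ t : measurable_fun setT (fun w => t * Phi (Y t w)^-1).
Proof.
pose f (y : R) := Phi y^-1. pose D : set R := `]0, +oo[%classic.
have mf : measurable_fun D f.
  apply: open_continuous_measurable_fun; first exact: interval_open.
  move=> y; rewrite inE /D/= in_itv/= andbT => y0.
  apply: (@continuous_comp _ _ _ (fun y : R => y^-1) Phi).
    by apply: inv_continuous; rewrite gt_eqF.
  by apply: Phi_cts; rewrite invr_gt0.
have mr : measurable_fun setT (f \_ D).
  by apply: (iffLR (measurable_restrictT _ _)) => //; exact: measurable_itv.
have -> : (fun w => t * Phi (Y t w)^-1) = (fun w => t * (f \_ D) (Y t w)).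
  apply/funext => w; rewrite patchE.
  have := Y0 t w; rewrite le_eqVlt => /predU1P[<-|Yw].
    rewrite memNset ?invr0 ?Phi00 ?/D/= ?in_itv/= ?ltxx//.
  by rewrite mem_set// /D/= in_itv/= Yw.
by apply: measurable_funM; [exact: measurable_cst|exact: (measurableT_comp mr (mY t))].
Qed.

(** Since [t * Phi (g (tau t)) = u], the event [g (tau t) * Y t > 1] implies
    [t * Phi (Y t)^-1 <= u]. Conversely, where [Y t > 0], [g (tau t) * Y t <= 1] implies
    [t * Phi (Y t)^-1 >= u], which excludes values at most [y < u]. *)
Lemma cbi_limit_F0 : exists m : probability R R,
  (forall A : set R, m A = exponential_prob 1 A) /\
  cvg_law P (fun t w => t * Phi (Y t w)^-1) m.
Proof.
have [m [mE mcdf m0]] := exponential_law R.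
exists m; split => //; apply: cvg_law_of_cdf_pos => //.
- near=> t; move=> w; have tp : 0 < t by near: t; apply: nbhs_pinfty_gt; exact: num_real.
  apply: mulr_ge0; [exact: ltW|]; have := Y0 t w; rewrite le_eqVlt => /predU1P[<-|Yw].
    by rewrite invr0 Phi00.
  by rewrite ltW// Phi_gt0 ?invr_gt0.
- move=> y u e y0 yu e0; have u0 : 0 < u by exact: lt_trans yu.
  have [tau htau] := tau_exists u0.
  have e2 : 0 < e / 2 by lra.
  move/cvgrPdist_le : (scaled_cdf u0 htau) => /(_ _ e2) k.
  have a := atom0 e2.
  have gp := gtau0 (tau_cvgy_eq htau).
  rewrite mcdf//; near=> t.
  have tp : 0 < t by near: t; apply: nbhs_pinfty_gt; exact: num_real.
  have g1 : 0 < g (tau t) by near: t.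
  have [_ th] : 0 < tau t /\ t * h (tau t) = u by near: t.
  have a1 : law_cdf P (Y t) 0 <= e / 2 by near: t.
  have k1 : `|expR (- u) - law_cdf P (fun w => g (tau t) * Y t w) 1| <= e / 2 by near: t.
  have : law_cdf P (fun w => t * Phi (Y t w)^-1) y + law_cdf P (fun w => g (tau t) * Y t w) 1
      <= 1 + law_cdf P (Y t) 0.
    apply: law_cdf_inter => //.
    move=> w Zy gY1; rewrite leNgt; apply/negP => Yw.
    have gle : g (tau t) <= (Y t w)^-1 by rewrite -[leRHS]mul1r ler_pdivlMr.
    have := Phi_homo' g1 gle; rewrite -(ler_pM2l tp) th.
    by move=> /le_trans/(_ Zy); lra.
  by move: k1; rewrite ler_norml; lra.
- move=> u e u0 e0; have [tau htau] := tau_exists u0.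
  move/cvgrPdist_le : (scaled_cdf u0 htau) => /(_ _ e0) k.
  have gp := gtau0 (tau_cvgy_eq htau).
  rewrite mcdf//; near=> t.
  have tp : 0 < t by near: t; apply: nbhs_pinfty_gt; exact: num_real.
  have g1 : 0 < g (tau t) by near: t.
  have [_ th] : 0 < tau t /\ t * h (tau t) = u by near: t.
  have k1 : `|expR (- u) - law_cdf P (fun w => g (tau t) * Y t w) 1| <= e by near: t.
  have : 1 <= law_cdf P (fun w => g (tau t) * Y t w) 1 + law_cdf P (fun w => t * Phi (Y t w)^-1) u.
    apply: law_cdf_cover => //.
    move=> w; have [gY1|gY1] := leP (g (tau t) * Y t w) 1; [by left|right].
    have Yw : 0 < Y t w.
      rewrite lt_neqAle Y0 andbT; apply/eqP => Yw; move: gY1.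
      by rewrite -Yw mulr0 ltNge ler01.
    rewrite -th ler_pM2l//; apply: Phi_homo; first by rewrite invr_ge0.
    by rewrite -[leLHS]mul1r ler_pdivrMr// ltW.
  by move: k1; rewrite ler_norml; lra.
Unshelve. all: by end_near.
Qed.

End DeltaZero.

End FastCase.

(** * Condition (S) *)

Section SlowCase.
Hypothesis cS : condS H.

Let xh : y * h y @[y --> +oo] --> (0 : R).
Proof. by have [k _] := cS; exact: (@condH_h (nbhs (0 : R)) (nbhs_filter (0 : R)) k). Qed.

Let Hy : H y @[y --> +oo] --> +oo. Proof. by have [_] := cS. Qed.

Let Hincr (r s : R) : 0 < r -> r < s -> H r < H s.
Proof. exact: (H_incr Psi_gt0 Psi_cts Phi_gt0 Phi_cts Phi_homo' gE). Qed.

(** The shift [ln u] is dictated by [m]: up to a constant factor [m (g s)^-1] is [expR (H s)], so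
    this [tau] satisfies [m (g (tau t))^-1 = u * m (g t)^-1]. *)
Let tau_exists (u : R) : 0 < u < 1 ->
  exists tau : R -> R, \forall t \near +oo, 0 < tau t <= t /\ H (tau t) = H t + ln u.
Proof.
move=> /andP[u0 u1]; pose S t := [set s : R | 0 < s <= t /\ H s = H t + ln u].
exists (fun t => xget 1 (S t)).
have big : \forall t \near +oo, H 1 - ln u <= H t by move/cvgryPge : Hy; apply.
near=> t.
suff : exists s, S t s by move=> ex; exact: (@xgetPex _ 1 (S t) ex).
have tp : 1 <= t by near: t; apply: nbhs_pinfty_ge; exact: num_real.
have Ht : H 1 - ln u <= H t by near: t.
have lu : ln u <= 0 by apply: ln_le0; exact: ltW.
have [||s] := @IVT R H 1 t (H t + ln u) tp.
- apply: continuous_in_subspaceT => y /[!inE] /=; rewrite in_itv/= => /andP[y1 _].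
  by apply: (H_cts Psi_gt0 Psi_cts Phi_cts gE); exact: lt_le_trans y1.
- by rewrite ge_min le_max; apply/andP; split; apply/orP; [left|right]; lra.
rewrite in_itv/= => /andP[s1 st] hs; exists s; split => //.
by rewrite st andbT; exact: lt_le_trans s1.
Unshelve. all: by end_near.
Qed.

(** The time [s t] is comparable to [tau t], and [t + s t] to [t] because [tau t <= t]. Replacing
    [s t] by [tau t] and [t + s t] by [t] therefore changes [H] by [o(1)], and the increment becomes
    [H t - H (tau t) = - ln u]. *)
Let scaled_cdf (tau : R -> R) (u : R) : 0 < u < 1 ->
  (\forall t \near +oo, 0 < tau t <= t /\ H (tau t) = H t + ln u) ->
  tau t @[t --> +oo] --> +oo /\
  law_cdf P (fun w => g (tau t) * Y t w) 1 @[t --> +oo] --> u.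
Proof.
move=> /andP[u0 u1] htau.
have tauy : tau t @[t --> +oo] --> +oo.
  apply/cvgryPge => A; have M0 : 0 < Num.max A 1 by rewrite lt_max ltr01 orbT.
  have big : \forall t \near +oo, H (Num.max A 1) - ln u < H t by move/cvgryPgt : Hy; apply.
  near=> t; have Ht : H (Num.max A 1) - ln u < H t by near: t.
  have [/andP[t0 _] hs] : 0 < tau t <= t /\ H (tau t) = H t + ln u by near: t.
  apply: (@le_trans _ _ (Num.max A 1)); first by rewrite le_max lexx.
  rewrite leNgt; apply/negP => lt; have := Hincr t0 lt; lra.
split => //.
apply: (degenerate_laplace_cdf (X := fun t w => g (tau t) * Y t w)).
- exact: mgY.
- exact: gY0.
move=> th th0.
have c0 : 0 < th `^ (- alpha) by exact: powR_gt0.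
pose c := th `^ (- alpha); pose s t := phi (th * g (tau t)).
have sc : s t / tau t @[t --> +oo] --> c := clock_tau th0 tauy.
have c1 : c / 2 < c by rewrite /c; lra.
have c2 : c < c + 1 by lra.
have sb := cvg_ratio_bounds tauy sc c1 c2.
(* One constant for both comparisons: it exceeds [2 / c] and [c + 1], which relate [tau t] and
   [s t], and [c + 2], which bounds [t + s t] by a multiple of [t]. *)
pose C := c + 2 + 2 / c.
have C1 : 1 <= C.
  have : 0 < 2 / c by rewrite divr_gt0.
  by rewrite /C /c; lra.
have icp : 0 < 2 / c by rewrite divr_gt0.
have lim1 : H (s t) - H (tau t) @[t --> +oo] --> (0 : R).
  apply: (increment_cvg0 h0 hanti Hder xh C1 tauy).
  near=> t.
  have [t0 /andP[l1 l2]] : 0 < tau t /\ c / 2 * tau t <= s t <= (c + 1) * tau t by near: t.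
  have s0 : 0 < s t by apply: lt_le_trans l1; rewrite mulr_gt0// divr_gt0.
  split.
    apply: (@le_trans _ _ (2 / c * s t)).
      have := ler_wpM2l (ltW icp) l1.
      by have -> : 2 / c * (c / 2 * tau t) = tau t by field; rewrite gt_eqF.
    by apply: ler_wpM2r; [exact: ltW|rewrite /C /c; lra].
  by apply: le_trans l2 _; apply: ler_wpM2r; [exact: ltW|rewrite /C /c; lra].
have lim2 : H (t + s t) - H t @[t --> +oo] --> (0 : R).
  apply: (increment_cvg0 (a := fun t => t) (b := fun t => t + s t) h0 hanti Hder xh C1 _).
    exact: cvg_id.
  near=> t.
  have [t0 /andP[l1 l2]] : 0 < tau t /\ c / 2 * tau t <= s t <= (c + 1) * tau t by near: t.
  have [/andP[_ tt] _] : 0 < tau t <= t /\ H (tau t) = H t + ln u by near: t.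
  have tp : 0 < t by exact: lt_le_trans tt.
  have s0 : 0 < s t by apply: lt_le_trans l1; rewrite mulr_gt0// divr_gt0.
  split.
    apply: (@le_trans _ _ (t + s t)); first by rewrite lerDl ltW.
    by rewrite ler_peMl// addr_ge0// ltW.
  have st : s t <= (c + 1) * t by apply: le_trans l2 _; apply: ler_wpM2l => //; rewrite /c; lra.
  apply: (@le_trans _ _ ((c + 2) * t)); first by lra.
  by apply: ler_wpM2r; [exact: ltW|rewrite /C; lra].
have lim : H (t + s t) - H (s t) @[t --> +oo] --> - ln u.
  have k : (H (t + s t) - H t) - (H (s t) - H (tau t)) - ln u @[t --> +oo] --> (0 : R) - 0 - ln u.
    by apply: cvgB; [exact: cvgB|exact: cvg_cst].
  rewrite subr0 sub0r in k; apply: cvg_trans k; apply: near_eq_cvg; near=> t.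
  have [_ hs] : 0 < tau t <= t /\ H (tau t) = H t + ln u by near: t.
  by rewrite hs; lra.
by have := laplace_limit th0 tauy lim; rewrite opprK lnK.
Unshelve. all: by end_near.
Qed.

Local Notation rate := (fun u : R => Phi u / Psi u).
Local Notation m := (m_fun Psi Phi).

Let rate_cts (q : R) : 0 < q -> {for q, continuous rate}.
Proof.
move=> q0; apply: cvgM; first exact: Phi_cts.
by apply: cvgV; [rewrite gt_eqF// Psi_gt0|exact: Psi_cts].
Qed.

Let m_homo : nondecreasing_fun m.
Proof.
move=> y z yz; rewrite /m_fun; have [y0|y0] := ltP 0 y; last by case: ifP => // _; exact: expR_ge0.
have z0 : 0 < z by exact: lt_le_trans yz.
rewrite z0 ler_expR.
have iy : 0 < y^-1 by rewrite invr_gt0.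
have iz : 0 < z^-1 by rewrite invr_gt0.
rewrite -(oint_chasles rate_cts iz iy ltr01) lerDr ointE ?lef_pV2//.
apply: integ_ge0 => q zq; have q0 : 0 < q by exact: lt_le_trans zq.
by apply: divr_ge0; apply: ltW; [exact: Phi_gt0|exact: Psi_gt0].
Qed.

Let m_ge0 y : 0 <= m y.
Proof. by rewrite /m_fun; case: ifP => // _; exact: expR_ge0. Qed.

Let m_clock (s : R) : 0 < s -> m (g s)^-1 = expR (H s + oint lam0 1 rate).
Proof.
move=> s0; have gs := g0 s0; have /andP[_ gl] := g_range gE s0.
rewrite /m_fun invr_gt0 gs invrK -(oint_chasles rate_cts gs lam0_gt0 ltr01).
rewrite (_ : oint (g s) lam0 rate = H s)//.
rewrite ointE ?ltW// /H_fun gt_eqF// /integ; congr fine; apply: eq_integral => q; rewrite inE/= in_itv/= => /andP[gq _].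
by rewrite gtr0_norm// Psi_gt0//; exact: lt_le_trans gq.
Qed.

Lemma cbi_limit_S : exists V : probability R R,
  (forall A : set R, V A = uniform_prob (@ltr01 R) A) /\
  cvg_law P (fun t w => m (Y t w) / m (g t)^-1) V.
Proof.
have [V [VE Vcdf V0]] := uniform_law R.
have mm : measurable_fun setT m by exact: nondecreasing_measurable.
have mid : measurable_fun setT (fun y : R => y) by exact: measurable_id.
have mZ t : measurable_fun setT (fun w => m (Y t w) / m (g t)^-1).
  by apply: measurable_funM; [exact: (measurableT_comp mm (mY t))|exact: measurable_cst].
(* The level [u] of the ratio corresponds to [Y t = (g (tau t))^-1]. As [m] is only used as a
   nondecreasing function, [Y t <= (g (tau t))^-1] gives level [u], while the converse inclusion
   needs a level [y] strictly below [u]. *)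
have relate (u e : R) : 0 < u < 1 -> 0 < e -> \forall t \near +oo,
    (forall y, y < u -> law_cdf P (fun w => m (Y t w) / m (g t)^-1) y <= u + e) /\
    u - e <= law_cdf P (fun w => m (Y t w) / m (g t)^-1) u.
  move=> u01 e0; have [tau htau] := tau_exists u01.
  have [tauy lim] := scaled_cdf u01 htau.
  move/cvgrPdist_le : lim => /(_ _ e0) lim.
  have /andP[u0 u1] := u01.
  near=> t.
  have k : `|u - law_cdf P (fun w => g (tau t) * Y t w) 1| <= e by near: t.
  have [/andP[t0 tt] hs] : 0 < tau t <= t /\ H (tau t) = H t + ln u by near: t.
  have tp : 0 < t by exact: lt_le_trans tt.
  have gt := g0 t0.
  have mu : m (g (tau t))^-1 = u * m (g t)^-1.
    by rewrite !m_clock// hs !expRD (lnK (_ : u \is Num.pos)) ?posrE//; ring.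
  have mg0 : 0 < m (g t)^-1 by rewrite m_clock// expR_gt0.
  have inv w : (g (tau t) * Y t w <= 1) = (Y t w <= (g (tau t))^-1).
    by rewrite -[(g _)^-1]mul1r ler_pdivlMr// mulrC.
  have le1 : law_cdf P (fun w => g (tau t) * Y t w) 1 <=
      law_cdf P (fun w => m (Y t w) / m (g t)^-1) u.
    apply: law_cdf_le => //.
    by move=> w; rewrite inv => /m_homo; rewrite mu ler_pdivrMr.
  move: k; rewrite ler_distlC => /andP[k1 k2].
  split; last exact: le_trans k1 le1.
  move=> y yu; apply: le_trans k2.
  apply: law_cdf_le => //.
  move=> w; rewrite ler_pdivrMr// inv => my; rewrite leNgt; apply/negP => /ltW/m_homo.
  rewrite mu => /le_trans/(_ my); rewrite ler_pM2r// => uy.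
  by have := lt_le_trans yu uy; rewrite ltxx.
exists V; split => //; apply: cvg_law_of_cdf_pos => //.
- by near=> t; move=> w; rewrite divr_ge0.
- move=> y u e y0 yu e0; have [u1|u1] := ltP u 1.
    have u01 : 0 < u < 1 by rewrite (lt_trans y0 yu).
    have [] := filter_ex (relate u e u01 e0); last move=> _ _.
    have := relate u e u01 e0; apply: filterS => t [k _].
    by rewrite Vcdf; [exact: k|case/andP: u01 => /ltW -> /ltW ->].
  near=> t; apply: (@le_trans _ _ 1); first exact: law_cdf_le1.
  have := law_cdf_homo V mid u1; rewrite Vcdf; last lra.
  by move=> k; apply: le_trans k _; rewrite lerDl ltW.
- move=> y e y0 e0; have [y1|y1] := ltP y 1.
    have y01 : 0 < y < 1 by rewrite y0.
    have := relate y e y01 e0; apply: filterS => t [_ k].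
    by rewrite Vcdf; [lra|rewrite ltW//= ltW].
  (* No [tau] is available at levels [y >= 1]; they are reached by monotonicity from a level [u < 1]
     with [u >= 1 - e / 2]. *)
  pose u := Num.max 2^-1 (1 - e / 2).
  have u01 : 0 < u < 1 by rewrite lt_max gt_max; apply/andP; split; [apply/orP; left|apply/andP; split]; lra.
  have e2 : 0 < e / 2 by lra.
  have := relate u _ u01 e2; apply: filterS => t [_ k].
  have ue : 1 - e / 2 <= u by rewrite le_max lexx orbT.
  have uy : u <= y by case/andP: u01 => _ /ltW/le_trans; apply.
  have := law_cdf_homo P (mZ t) uy; have := law_cdf_le1 V mid y; lra.
Unshelve. all: by end_near.
Qed.

End SlowCase.

End CBI.

Lemma tail_near_gt0 (R : realType) (f r : R -> R) : (forall u, 0 <= f u) ->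
  f u / r u @[u --> +oo] --> (1 : R) -> \forall u \near +oo, 0 < f u.
Proof.
move=> f0 /cvgr_gt/(_ 0 ltr01); apply: filterS => u h.
rewrite lt_neqAle f0 andbT; apply/eqP => fu; move: h.
by rewrite -fu mul0r ltxx.
Qed.

Theorem theorem6 (R : realType) (sigma beta alpha lam0 : R)
  (pi nu : {measure set R -> \bar R}) (ell : R -> R)
  (v : R -> R -> R) (g : R -> R)
  (d : measure_display) (T : measurableType d) (P : probability T R)
  (x : R) (Y : R -> T -> R) :
  (* Levy measures on (0,oo) *)
  0 <= sigma -> 0 <= beta ->
  pi [set u : R | u <= 0] = 0%E -> nu [set u : R | u <= 0] = 0%E ->
  sigma_finite [set u : R | 0 < u] pi -> sigma_finite [set u : R | 0 < u] nu ->
  (\int[pi]_(z in [set z : R | (0 < z)%R]) ((Num.min z (z ^+ 2))%R)%:E < +oo)%E ->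
  (\int[nu]_(z in [set z : R | (0 < z)%R]) ((Num.min 1 z)%R)%:E < +oo)%E ->
  (forall q : R, 0 < q -> 0 < Phi beta nu q) ->
  (* b = 0 and regularly varying tail of pi *)
  0 < alpha < 1 -> slowly_varying ell ->
  (fun u => fine (pi [set z : R | u < z])
            / (- (GammaF (- alpha))^-1 * u `^ (-1 - alpha) * ell u))
     u @[u --> +oo] --> (1 : R) ->
  (* v_t(lambda), lambda0, g *)
  solves_v (Psi 0 sigma pi) v ->
  0 < lam0 -> is_g (Psi 0 sigma pi) lam0 g ->
  (* Y is a CBI(Psi,Phi) process started at x, under P *)
  0 <= x ->
  (forall t : R, measurable_fun setT (Y t)) ->
  (forall (t : R) (w : T), 0 <= Y t w) ->
  (forall t lam : R, 0 <= t -> 0 <= lam ->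
     (\int[P]_w (expR (- (lam * Y t w)))%:E)%E =
     (expR (- (x * v t lam) - integ 0 t (fun s => Phi beta nu (v s lam))))%:E) ->
  let H := H_fun (Psi 0 sigma pi) (Phi beta nu) lam0 g in
  let m := m_fun (Psi 0 sigma pi) (Phi beta nu) in
  (* (i) *)
  (condS H ->
     exists VU : probability R R,
       (forall A : set R, VU A = uniform_prob (@ltr01 R) A) /\
       cvg_law P (fun t w => m (Y t w) / m (g t)^-1) VU)
  /\
  (* (ii) *)
  (forall a : R, 0 < a -> condL H a ->
     exists VL : probability R R,
       VL [set y : R | y < 0] = 0%E /\
       (forall lam : R, 0 <= lam ->
          (\int[VL]_y (expR (- (lam * y)))%:E)%E =
          ((1 + lam `^ alpha) `^ (- a))%:E) /\
       cvg_law P (fun t w => g t * Y t w) VL)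
  /\
  (* (iii), delta > 0 *)
  (forall delta : R, 0 < delta -> condF H delta ->
     forall rho : R -> R,
       (\forall t \near +oo, 0 < rho t /\ Phi beta nu (rho t) = t^-1) ->
       (exists ellbar : R -> R, slowly_varying ellbar /\
          \forall t \near +oo, rho t = t `^ (- (delta * alpha)^-1) * ellbar t) /\
       exists VF : probability R R,
         VF [set y : R | y < 0] = 0%E /\
         (forall th : R, 0 <= th ->
            (\int[VF]_y (expR (- (th * y)))%:E)%E =
            (expR (- th `^ (delta * alpha)))%:E) /\
         cvg_law P (fun t w => rho t * Y t w) VF)
  /\
  (* (iii), delta = 0 *)
  (condF H 0 ->
     exists E1 : probability R R,
       (forall A : set R, E1 A = exponential_prob 1 A) /\
       cvg_law P (fun t w => t * Phi beta nu (Y t w)^-1) E1).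
Proof.
move=> _ beta0 _ _ _ _ hpi hnu Phi_gt0 alpha01 sell tail_eq hv lam0_gt0 gE _ mY Y0 hY H m.
have [alpha0 _] := andP alpha01.
have tail_gt0 := tail_near_gt0 (fun u => fine_ge0 (measure_ge0 pi _)) tail_eq.
have tail_rv := regvar_equiv sell tail_eq.
have Pg := branching_gt0 sigma hpi tail_gt0.
have Pc := @branching_continuous R sigma pi hpi.
have Prv := branching_regvar sigma hpi alpha01 tail_rv tail_gt0.
have P0 : 0 <= Psi 0 sigma pi 0.
  rewrite /Psi expr0n/= !mulr0 mul0r !add0r.
  by rewrite (_ : (fun u => _) = cst 0%E) ?integral0//; apply/funext => u; rewrite mul0r oppr0 expR0 addr0 subrr.
have F0 : Phi beta nu 0 = 0.
  rewrite /Phi mulr0 add0r.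
  by rewrite (_ : (fun u => _) = cst 0%E) ?integral0//; apply/funext => u; rewrite mul0r oppr0 expR0 subrr.
have Fc := @immigration_continuous R nu hnu beta.
have Fh p q := @immigration_homo R nu hnu beta p q beta0.
split; [|split; [|split]].
- exact: (cbi_limit_S lam0_gt0 Pg P0 Pc Prv Phi_gt0 Fc Fh gE hv mY Y0 hY).
- move=> a a0 cL.
  have [V [V0 VL Vlaw]] := cbi_limit_L lam0_gt0 alpha0 Pg P0 Pc Prv Fc gE hv mY Y0 hY a0 cL.
  by exists V.
- move=> delta delta0 cF rho hrho.
  split; first exact: (rho_slowly_varying lam0_gt0 alpha0 Pg Pc Prv Phi_gt0 Fc Fh gE cF delta0 hrho).
  have [V [V0 VL Vlaw]] := cbi_limit_F lam0_gt0 alpha0 Pg P0 Pc Prv Phi_gt0 Fc Fh gE hv mY Y0 hY cF delta0 hrho.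
  by exists V.
- move=> cF.
  exact: (cbi_limit_F0 lam0_gt0 Pg P0 Pc Prv Phi_gt0 F0 Fc Fh gE hv mY Y0 hY cF erefl).
Qed.
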